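(* Let $f$ satisfy $\|f(u)\|\le c(1+\|u\|)$ and $\|f(u)-f(v)\|\le c\|u-v\|$ for all $u,v\in H$, with some constant $c>0$. Let $s>\frac{1-H_1}{2}$, $\frac{2sH_2}{\alpha}+H_1-1>0$, $2\sigma\in\big[0,\min\{2s+H_1-1,\ \frac{2sH_2}{\alpha}+H_1-1\}\big)$ and $g\in\dot H^\sigma(D)$. Let $u$ be the solution of $$\partial_t u+\lambda\,\partial_t^{1-\beta}u+\mu\,\partial_t^{1-\alpha}A^s u=f(u)+\gamma(t)\,\xi^{H_1,H_2}\ \text{in } D\times(0,T],\qquad u=0\ \text{on }\partial D\times(0,T],\qquad u=g\ \text{in } D\times\{t=0\}.$$ Then there is a constant $c$, independent of $t$, such that for $t\in[0,T]$ $$\mathbb E\|u(t)\|^2_{\dot H^\sigma(D)}\le c.$$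
   Context: Let $l,T>0$, $D=(0,l)$, $I=[0,T]$, and $H=L^2(D)$ with norm $\|\cdot\|$ and inner product $(\cdot,\cdot)$. $A=-\Delta$ is the Dirichlet Laplacian on $D$, with nondecreasing positive eigenvalues $\rho_k$ and eigenfunctions $e_k$ ($k=1,2,\dots$) forming an orthonormal basis of $H$; $A^sv=\sum_k\rho_k^s(v,e_k)e_k$. For $q\ge0$, $\dot H^q(D)=D(A^{q/2})$ with $\|v\|_{\dot H^q(D)}^2=\|A^{q/2}v\|^2=\sum_k\rho_k^q(v,e_k)^2$. Parameters: $0<\beta\le\alpha<1$, $s\in(0,1)$, $\mu>0$, $\lambda\ge0$, $H_1,H_2\in(0,\frac12]$, $\gamma\in C^1([0,T])$ with $\gamma(0)=0$. For $\eta\in(0,1)$, $\partial_t^\eta y(x,t)=\frac1{\Gamma(1-\eta)}\partial_t\int_0^t(t-r)^{-\eta}y(x,r)\,dr$ is the Riemann-Liouville derivative. Noise: $\xi^{H_1,H_2}=\frac{\partial^2W^{H_1,H_2}}{\partial x\,\partial t}$, where $W^{H_1,H_2}$ is a fractional Brownian sheet on a stochastic basis $(\Omega,\mathcal F,(\mathcal F_t)_{t\in I},\mathbb P)$, i.e. a centered Gaussian field with $\mathbb E(W^{H_1,H_2}(x,t)W^{H_1,H_2}(y,r))=R_{H_1}(x,y)R_{H_2}(t,r)$, $R_K(x,y)=\frac12(|x|^{2K}+|y|^{2K}-|x-y|^{2K})$. Integrals of deterministic functions against $\xi^{H_1,H_2}(dy,d\tau)$ are Wiener integrals with respect to $W^{H_1,H_2}$.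 Let $h(z)=\mu^{-1}z^\alpha(1+\lambda z^{-\beta})$ and, for $\theta\in(0,\pi/2)$ and $\kappa>0$, let $\Gamma_{\kappa,\pi-\theta}=\{re^{-i(\pi-\theta)}:r\ge\kappa\}\cup\{\kappa e^{i\psi}:|\psi|\le\pi-\theta\}\cup\{re^{i(\pi-\theta)}:r\ge\kappa\}$, oriented with increasing imaginary part. Set $$S(t)=\frac1{2\pi i}\int_{\Gamma_{\kappa,\pi-\theta}}e^{zt}\mu^{-1}z^{\alpha-1}(h(z)I+A^s)^{-1}dz,\qquad u_k(t)=\frac1{2\pi i}\int_{\Gamma_{\kappa,\pi-\theta}}e^{zt}\mu^{-1}z^{\alpha-1}(h(z)+\rho_k^s)^{-1}dz,$$ and $F(t,x,y)=\sum_{k\ge1}u_k(t)e_k(x)e_k(y)$. The solution of the problem is the process $u\in C(I;L^2(\Omega;H))$ satisfying, for $t\in I$, $$u(t)=S(t)g+\int_0^tS(t-\tau)f(u(\tau))\,d\tau+\int_0^t\int_DF(t-\tau,x,y)\gamma(\tau)\,\xi^{H_1,H_2}(dy,d\tau).$$ *)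

(* Defs.v *)
From HB Require Import structures.
From mathcomp Require Import all_boot all_order all_algebra.
From mathcomp Require Import all_classical all_reals all_analysis.
From mathcomp Require Import complex.

Set Implicit Arguments.
Unset Strict Implicit.
Unset Printing Implicit Defensive.

Import Order.TTheory GRing.Theory Num.Theory.
Import numFieldNormedType.Exports.

Local Open Scope classical_set_scope.
Local Open Scope ring_scope.

(** * The space H = L^2(0,l) *)

Section space.
Context {R : realType}.

(* Lebesgue measure on D = ]0, l[. *)
Definition lebD (l : R) : {measure set (measurableTypeR R) -> \bar R} :=
  mrestr (@lebesgue_measure R) (measurable_itv `]0, l[).

(* Elements of H are represented by measurable square-integrable functions;
   a.e.-equal functions are identified through [heq], not by a quotient. *)
Definition L2 (l : R) := LfunType (lebD l) (lee1n 2).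

Definition inner (l : R) (v w : L2 l) : R := \int[lebD l]_x (v x * w x).

Definition hnorm (l : R) (v : L2 l) : R := Num.sqrt (inner v v).

Definition heq (l : R) (v w : L2 l) : Prop := hnorm (v - w) = 0.

(* w is the sum in H of the orthogonal series with general term c k *: e k. *)
Definition hsum (l : R) (e : nat -> L2 l) (c : nat -> R) (w : L2 l) : Prop :=
  (fun n => hnorm (\sum_(k < n) c k *: e k - w)) @ \oo --> (0 : R).

(* (rho k, e k) stands for the eigenpair of index k + 1: indices start at 0. *)
Record dirichlet_eigenbasis (l : R) (rho : nat -> R) (e : nat -> L2 l)
    : Prop := {
  eigenvalue_gt0 : forall k, 0 < rho k ;
  eigenvalue_nondecreasing :
    forall m n, (m <= n)%N -> rho m <= rho n ;
  eigenfunction_continuous : forall k,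
    {within `[0, l], continuous (e k : R -> R)} ;
  eigenfunction_boundary : forall k, e k 0 = 0 /\ e k l = 0 ;
  eigenfunction_derivable : forall k (x : R), x \in `]0, l[ ->
    derivable (e k : R -> R) x 1 /\ derivable (derive1 (e k : R -> R)) x 1 ;
  eigenfunction_eq : forall k (x : R), x \in `]0, l[ ->
    - derive1 (derive1 (e k : R -> R)) x = rho k * e k x ;
  eigenfunction_orthonormal : forall j k, inner (e j) (e k) = (j == k)%:R ;
  eigenfunction_basis : forall v, hsum e (fun k => inner v (e k)) v }.

(* v is in the domain of A^s and A^s v = w. *)
Definition is_Apow (l : R) (rho : nat -> R) (e : nat -> L2 l) (s : R)
    (v w : L2 l) : Prop :=
  hsum e (fun k => rho k `^ s * inner v (e k)) w.

(* Squared norm of \dot H^q(D); it is +oo outside of that space. *)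
Definition Hdot_sqnorm (l : R) (rho : nat -> R) (e : nat -> L2 l) (q : R)
    (v : L2 l) : \bar R :=
  (\sum_(0 <= k <oo) (rho k `^ q * inner v (e k) ^+ 2)%:E)%E.

Definition Hdot (l : R) (rho : nat -> R) (e : nat -> L2 l) (q : R)
    : set (L2 l) :=
  [set v | Hdot_sqnorm rho e q v < +oo]%E.

(* f is of class C^1 on the closed interval [0, T], with one-sided derivatives
   at the end points: f' extends continuously to [0, T]. *)
Definition C1_on (T : R) (f : R -> R) : Prop :=
  {within `[0, T], continuous f} /\
  exists2 f' : R -> R, {within `[0, T], continuous f'} &
    forall t : R, t \in `]0, T[ -> is_derive t 1 f (f' t).

End space.

(** * Complex functions, the contour and the solution operator *)

Section operators.
Context {R : realType}.
Local Notation leb := (@lebesgue_measure R).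

Local Notation Re := complex.Re.
Local Notation Im := complex.Im.

Definition polar (r psi : R) : R[i] := Complex (r * cos psi) (r * sin psi).

Definition cmod (z : R[i]) : R := Num.sqrt (Re z ^+ 2 + Im z ^+ 2).

(* Principal argument, in ]-pi, pi] for z != 0. *)
Definition carg (z : R[i]) : R :=
  if 0 <= Im z then acos (Re z / cmod z) else - acos (Re z / cmod z).

Definition cexp (z : R[i]) : R[i] := polar (expR (Re z)) (Im z).

(* Principal branch of z ^ a, for a real exponent a. *)
Definition cpow (z : R[i]) (a : R) : R[i] := polar (cmod z `^ a) (a * carg z).

Definition cintegral (A : set R) (f : R -> R[i]) : R[i] :=
  Complex (\int[leb]_(x in A) Re (f x)) (\int[leb]_(x in A) Im (f x)).

(* Point set of the contour Gamma_{kap, pi - th}. *)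
Definition contour (kap th : R) : set R[i] :=
  [set z | kap <= cmod z /\ `|carg z| = pi - th] `|`
  [set z | cmod z = kap /\ `|carg z| <= pi - th].

(* Integral of f along Gamma_{kap, pi - th}, oriented with increasing imaginary
   part: the lower ray is travelled from infinity to its end point. *)
Definition contour_integral (kap th : R) (f : R[i] -> R[i]) : R[i] :=
  let phi := pi - th in
  - cintegral `[kap, +oo[ (fun r => f (polar r (- phi)) * polar 1 (- phi))
  + cintegral `[- phi, phi]
      (fun psi => f (polar kap psi) * (Complex 0 1 * polar kap psi))
  + cintegral `[kap, +oo[ (fun r => f (polar r phi) * polar 1 phi).

(* (2 i pi)^-1 times the integral of e^{zt} q(z) along the contour. *)
Definition inverse_laplace (kap th : R) (q : R[i] -> R[i]) (t : R) : R[i] :=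
  (Complex 0 (2 * pi))^-1 *
  contour_integral kap th (fun z => cexp (Complex (Re z * t) (Im z * t)) * q z).

Definition symbol (al be mu la : R) (z : R[i]) : R[i] :=
  Complex mu^-1 0 * cpow z al * (1 + Complex la 0 * cpow z (- be)).

(* u_k(t), for rk = rho_k. The contour integral is real because its integrand
   takes conjugate values at conjugate points. *)
Definition ufun (al be s mu la kap th rk t : R) : R :=
  Re (inverse_laplace kap th (fun z => Complex mu^-1 0 * cpow z (al - 1) *
        (symbol al be mu la z + Complex (rk `^ s) 0)^-1) t).

(* Elements of the complexification of H are pairs (real part, imaginary part).
   (zeta I + A^s)^{-1} v = w, i.e. w is in the domain of A^s and
   zeta w + A^s w = v. *)
Definition is_resolvent (l : R) (rho : nat -> R) (e : nat -> L2 l) (s : R)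
    (zeta : R[i]) (v : L2 l) (w : L2 l * L2 l) : Prop :=
  exists a : L2 l * L2 l,
    [/\ is_Apow rho e s w.1 a.1, is_Apow rho e s w.2 a.2,
        heq (Re zeta *: w.1 - Im zeta *: w.2 + a.1) v &
        heq (Im zeta *: w.1 + Re zeta *: w.2 + a.2) 0].

(* S is the family (S(t))_{t >= 0}. The operator-valued contour integral is
   taken weakly, through its inner products. At t = 0 the contour integral does
   not converge absolutely, and S(0) is the identity, which is the strong limit
   of S(t) as t decreases to 0. *)
Definition solution_operator (l : R) (rho : nat -> R) (e : nat -> L2 l)
    (al be s mu la kap th : R) (S : R -> L2 l -> L2 l) : Prop :=
  (forall v, heq (S 0 v) v) /\
  exists2 Rs : R[i] -> L2 l -> L2 l * L2 l,
    forall z v, z \in contour kap th ->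
      is_resolvent rho e s (symbol al be mu la z) v (Rs z v) &
    forall (t : R) v w, 0 < t ->
      Complex (inner (S t v) w) 0 =
      inverse_laplace kap th (fun z => Complex mu^-1 0 * cpow z (al - 1) *
        Complex (inner (Rs z v).1 w) (inner (Rs z v).2 w)) t.

(* F(t,x,y) = \sum_k u_k(t) e_k(x) e_k(y), the series being summed in
   L^2(D x D) for every t > 0. *)
Definition solution_kernel (l : R) (rho : nat -> R) (e : nat -> L2 l)
    (al be s mu la kap th : R) (F : R -> R -> R -> R) : Prop :=
  measurable_fun
    [set p : measurableTypeR R * (measurableTypeR R * measurableTypeR R) |
      [/\ 0 < p.1, p.2.1 \in `]0, l[ & p.2.2 \in `]0, l[]]
    (fun p => F p.1 p.2.1 p.2.2) /\
  forall t : R, 0 < t ->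
    (fun n => \int[lebD l]_x \int[lebD l]_y
       ((F t x y - \sum_(k < n)
          ufun al be s mu la kap th (rho k) t * e k x * e k y) ^+ 2)%:E)%E
    @ \oo --> 0%E.

End operators.

(** * Random variables, noise and the mild solution *)

Section stochastic.
Context {R : realType} {d : measure_display} {Omega : measurableType d}.
Variable P : probability Omega R.
Local Notation leb := (@lebesgue_measure R).

Definition filtration (T : R) (Ft : R -> set (set Omega)) : Prop :=
  (forall t : R, t \in `[0, T] ->
     sigma_algebra setT (Ft t) /\ Ft t `<=` measurable) /\
  (forall r t : R, r \in `[0, T] -> t \in `[0, T] -> r <= t -> Ft r `<=` Ft t).

Definition hopen (l : R) (U : set (L2 l)) : Prop :=
  forall v, U v ->
    exists2 eps : R, 0 < eps & forall w, hnorm (w - v) < eps -> U w.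

Definition second_moment (l : R) (X : Omega -> L2 l) : \bar R :=
  (\int[P]_w (hnorm (X w) ^+ 2)%:E)%E.

(* L^2(Omega; H); measurability is with respect to the Borel sets of H. *)
Definition L2Omega (l : R) : set (Omega -> L2 l) :=
  [set X | (forall U, hopen U -> measurable (X @^-1` U)) /\
           (second_moment X < +oo)%E].

Definition C_L2Omega (l T : R) (u : R -> Omega -> L2 l) : Prop :=
  forall t : R, t \in `[0, T] -> L2Omega (u t) /\
    second_moment (fun w => u r w - u t w) @[r --> within `[0, T] (nbhs t)]
      --> 0%E.

(* Y is the integral over ]0, t[ of X with values in L^2(Omega; H), in the weak
   (Pettis) sense; it coincides with the Bochner integral whenever the latter
   exists. *)
Definition is_time_integral (l t : R) (X : R -> Omega -> L2 l)
    (Y : Omega -> L2 l) : Prop :=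
  [/\ L2Omega Y,
      forall tau : R, tau \in `]0, t[ -> L2Omega (X tau) &
      forall Psi, L2Omega Psi ->
        leb.-integrable `]0, t[
          (fun tau => (\int[P]_w inner (X tau w) (Psi w))%:E) /\
        \int[P]_w inner (Y w) (Psi w) =
        \int[leb]_(tau in `]0, t[) \int[P]_w inner (X tau w) (Psi w)].

(* X is normal with mean 0; sd = 0 is the degenerate case X = 0 a.s. *)
Definition centered_normal (X : Omega -> R) : Prop :=
  measurable_fun setT X /\
  exists sd : R, forall A : set R, measurable A ->
    P (X @^-1` A) = if sd == 0 then \d_(0 : R) A else normal_prob 0 sd A.

(* R_K *)
Definition fbm_cov (K x y : R) : R :=
  (`|x| `^ (2 * K) + `|y| `^ (2 * K) - `|x - y| `^ (2 * K)) / 2.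

Record fractional_brownian_sheet (l T H1 H2 : R) (W : R -> R -> Omega -> R)
    : Prop := {
  fbs_gaussian : forall n (a x t : 'I_n -> R),
    (forall i, x i \in `[0, l] /\ t i \in `[0, T]) ->
    centered_normal (fun w => \sum_(i < n) a i * W (x i) (t i) w) ;
  fbs_cov : forall x t y r : R,
    x \in `[0, l] -> y \in `[0, l] -> t \in `[0, T] -> r \in `[0, T] ->
    'E_P[fun w => (W x t w * W y r w)%R]%E =
      (fbm_cov H1 x y * fbm_cov H2 t r)%:E }.

(* The H-valued elementary integrand coef(x) 1_{]yl, yr]}(y) 1_{]tl, tr]}(tau). *)
Record rect_term (l : R) := RectTerm {
  coef : L2 l ; yl : R ; yr : R ; tl : R ; tr : R }.

Definition rect_in (l t : R) (q : rect_term l) : bool :=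
  [&& 0 <= yl q, yl q <= yr q, yr q <= l,
      0 <= tl q, tl q <= tr q & tr q <= t].

Definition elem_fun (l : R) (p : seq (rect_term l)) (tau x y : R) : R :=
  \sum_(q <- p) coef q x * \1_(`]yl q, yr q]) y * \1_(`]tl q, tr q]) tau.

(* Integral of an elementary integrand: rectangular increments of W. *)
Definition elem_integral (W : R -> R -> Omega -> R) (l : R)
    (p : seq (rect_term l)) (w : Omega) : L2 l :=
  \sum_(q <- p) (W (yr q) (tr q) w - W (yl q) (tr q) w
                 - W (yr q) (tl q) w + W (yl q) (tl q) w) *: coef q.

(* Z is the H-valued Wiener integral of (tau, y) |-> Phi tau . y over
   ]0, t[ x D, i.e. the extension of [elem_integral] by its isometry: Z is the
   limit in L^2(Omega; H) of the integrals of elementary integrands converging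
   to Phi. For Hurst indices in ]0, 1/2] the norm induced by the covariance of W
   dominates that of L^2(]0, t[ x D; H), and the completion of the elementary
   integrands embeds in this space; so the limit of the elementary integrands is
   taken in it, and Z only depends on Phi. *)
Definition is_wiener_integral (W : R -> R -> Omega -> R) (l t : R)
    (Phi : R -> R -> R -> R) (Z : Omega -> L2 l) : Prop :=
  L2Omega Z /\
  exists p : nat -> seq (rect_term l),
    [/\ forall n, all (rect_in t) (p n),
        (fun n => \int[leb]_(tau in `]0%R, t[) \int[lebD l]_x \int[lebD l]_y
           ((elem_fun (p n) tau x y - Phi tau x y) ^+ 2)%:E)%E
          @ \oo --> 0%E &
        second_moment (fun w => elem_integral W (p n) w - Z w)
          @[n --> \oo] --> 0%E].

(* u is in C([0,T]; L^2(Omega; H)) and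
   u(t) = S(t) g + \int_0^t S(t - tau) f(u(tau)) dtau
          + \int_0^t \int_D F(t - tau, x, y) gam(tau) xi(dy, dtau). *)
Definition mild_solution (l T : R) (W : R -> R -> Omega -> R)
    (S : R -> L2 l -> L2 l) (F : R -> R -> R -> R) (f : L2 l -> L2 l)
    (gam : R -> R) (g : L2 l) (u : R -> Omega -> L2 l) : Prop :=
  C_L2Omega T u /\
  forall t : R, t \in `[0, T] ->
    exists Y Z : Omega -> L2 l,
      [/\ is_time_integral t (fun tau w => S (t - tau) (f (u tau w))) Y,
          is_wiener_integral W t
            (fun tau x y => F (t - tau) x y * gam tau) Z &
          {ae P, forall w, heq (u t w) (S t g + Y w + Z w)}].

End stochastic.

(* Main.v *)
Require Import Defs.
From HB Require Import structures.
From mathcomp Require Import all_boot all_order all_algebra.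
From mathcomp Require Import all_classical all_reals all_analysis.
From mathcomp Require Import measurable_realfun complex zify ring lra.

(** In coordinates with respect to the eigenbasis, the equation splits
    u(t) = S(t) g + Y(t) + Z(t), where Y is the drift integral and Z the Wiener
    integral, and the squared norm of H^sg is the sum over k of rho_k^sg times
    the square of the k-th coordinate. So it suffices to bound the three
    weighted sums of second moments of coordinates, uniformly in t and in the
    number of modes.

    The operator S(t) is diagonal and acts on the k-th mode by u_k(t). On the
    contour |h(z) + rho_k^s| is comparable to |z|^al + rho_k^s ([den_lower]),
    which gives |u_k(t)| <= C ([ukernel_bounded], hence the bound on S(t) g) and
    |u_k(t)| <= C rho_k^(- s m) t^(- nu) whenever al m < nu <= 1 and
    0 <= m <= 1 ([ukernel_decay]).

    For the drift, rho_k^(sg / 2) |u_k(t - tau)| <= C (t - tau)^(- nu) with some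
    nu < 1, an integrable singularity, and the second moments of f(u(tau)) are
    bounded because f grows linearly and u is continuous on a compact interval.
    As the time integral is defined weakly, the estimate is obtained by duality
    ([drift_bound]).

    The k-th coordinate of Z(t) is formally the Wiener integral of
    e_k(y) gam(tau) u_k(t - tau). Since Z is a limit of integrals of unspecified
    elementary integrands, its variance is not accessible directly. By
    closability ([variance_lsc]) every bound on the variances of other elementary
    integrands with the same weak limit passes to it, and step functions on a
    uniform grid are taken. Closability is proved by averaging
    the covariance over translations, which makes its derivatives continuous
    ([dot_inc_approx]). For a separable integrand on a grid, the variance is the
    product of a quadratic form in space and one in time ([variance_grid]). For
    Hurst index H <= 1/2 distinct increments are negatively correlated, and such
    a form is bounded, uniformly in the grid, by interpolation between sup norm,
    L^2 norm and L^2 modulus of continuity ([fbm_form_bound]). The eigenfunction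
    is a sine of frequency w_k = sqrt rho_k and contributes C w_k^(1 - 2 H1)
    ([sine_form_bound]); the kernel contributes C rho_k^(- 2 s m) for al m < H2,
    by Minkowski's inequality along the contour, where exp(- r x) has fractional
    seminorm of order r^(- H2) ([kernel_form]). This is [noise_coord_bound].

    As w_k >= (k + 1) pi / l, the noise series converges if
    2 s m + H1 - 1 > sg. Such an m with m <= 1 and al m < H2 exists because
    sg is less than both 2 s + H1 - 1 and 2 s H2 / al + H1 - 1. *)

Set Implicit Arguments.
Unset Strict Implicit.
Unset Printing Implicit Defensive.

Import Order.TTheory GRing.Theory Num.Theory.
Import numFieldNormedType.Exports.

Local Open Scope classical_set_scope.
Local Open Scope ring_scope.

(** * Square-integrable functions and the space H *)

Section real_integrable.
Context d (T : measurableType d) (R : realType) (mu : {measure set T -> \bar R}).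
Variables (D : set T) (mD : measurable D).
Implicit Types f g : T -> R.

Lemma integrableRD f g : mu.-integrable D (EFin \o f) -> mu.-integrable D (EFin \o g) ->
  mu.-integrable D (EFin \o (fun x => f x + g x)).
Proof. by move=> hf hg; have := integrableD mD hf hg. Qed.

Lemma integrableRZ (a : R) f : mu.-integrable D (EFin \o f) ->
  mu.-integrable D (EFin \o (fun x => a * f x)).
Proof. by move=> hf; have := integrableZl mD a hf. Qed.

Lemma le_integrableR f g : measurable_fun D f -> mu.-integrable D (EFin \o g) ->
  (forall x, D x -> `|f x| <= g x) -> mu.-integrable D (EFin \o f).
Proof.
move=> mf ig fg; apply: (le_integrable mD _ _ ig); first exact/measurable_EFinP.
by move=> x Dx /=; rewrite lee_fin; apply: le_trans (fg x Dx) (ler_norm _).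
Qed.

End real_integrable.

Section square_integrable.
Context d (T : measurableType d) (R : realType) (mu : {measure set T -> \bar R}).
Implicit Types f g h : T -> R.

Definition sqi f : Prop :=
  measurable_fun setT f /\ mu.-integrable setT (EFin \o (fun x => f x ^+ 2)).

Definition dot f g : R := \int[mu]_x (f x * g x).

(** Because 2 |f g| <= f^2 + g^2. *)
Lemma sqi_mul f g : sqi f -> sqi g ->
  mu.-integrable setT (EFin \o (fun x => f x * g x)).
Proof.
move=> [mf f2] [mg g2].
apply: (@le_integrableR _ _ _ mu setT measurableT _ (fun x => f x ^+ 2 + g x ^+ 2)).
- exact: measurable_funM.
- exact: integrableRD.
- by move=> x _ /=; rewrite ler_norml; apply/andP; split; nra.
Qed.

Lemma sqi0 : sqi (fun=> 0).
Proof.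
split; first exact: measurable_cst.
have -> : EFin \o (fun _ : T => (0 : R) ^+ 2) = cst 0%E.
  by apply/funext => x /=; rewrite expr0n.
exact: integrable0.
Qed.

Lemma sqiZ a f : sqi f -> sqi (fun x => a * f x).
Proof.
move=> [mf f2]; split; first exact: measurable_funM.
under eq_fun do rewrite exprMn.
exact: integrableRZ.
Qed.

Lemma sqiD f g : sqi f -> sqi g -> sqi (fun x => f x + g x).
Proof.
move=> sf sg; have /(@sqi_mul f g sf) ifg := sg.
have [mf f2] := sf; have [mg g2] := sg.
split; first exact: measurable_funD.
have -> : (fun x => (f x + g x) ^+ 2) =
  (fun x => f x ^+ 2 + (g x ^+ 2 + 2 * (f x * g x))).
  by apply/funext => x /=; ring.
apply: integrableRD => //; apply: integrableRD => //; exact: integrableRZ.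
Qed.

Lemma sqiB f g : sqi f -> sqi g -> sqi (fun x => f x - g x).
Proof.
move=> sf sg; have -> : (fun x => f x - g x) = (fun x => f x + (-1) * g x).
  by apply/funext => x; rewrite mulN1r.
exact/sqiD/sqiZ.
Qed.

Lemma sqi_sum I (r : seq I) (c : I -> T -> R) :
  (forall i, sqi (c i)) -> sqi (fun x => \sum_(i <- r) c i x).
Proof.
move=> sc; elim: r => [|i r ih].
  by under eq_fun do rewrite big_nil; exact: sqi0.
under eq_fun do rewrite big_cons; exact: sqiD.
Qed.

Lemma dotC f g : dot f g = dot g f.
Proof. by rewrite /dot; under eq_Rintegral do rewrite mulrC. Qed.

Lemma dotDl f g h : sqi f -> sqi g -> sqi h ->
  dot (fun x => f x + g x) h = dot f h + dot g h.
Proof.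
move=> sf sg sh; rewrite /dot -RintegralD//; [|exact: sqi_mul|exact: sqi_mul].
by under eq_Rintegral do rewrite mulrDl.
Qed.

Lemma dotZl a f h : sqi f -> sqi h -> dot (fun x => a * f x) h = a * dot f h.
Proof.
move=> sf sh; rewrite /dot -RintegralZl//; last exact: sqi_mul.
by under eq_Rintegral do rewrite -mulrA.
Qed.

Lemma dotBl f g h : sqi f -> sqi g -> sqi h ->
  dot (fun x => f x - g x) h = dot f h - dot g h.
Proof.
move=> sf sg sh; have -> : (fun x => f x - g x) = (fun x => f x + (-1) * g x).
  by apply/funext => x; rewrite mulN1r.
by rewrite dotDl ?dotZl ?mulN1r//; exact: sqiZ.
Qed.

Lemma dotDr f g h : sqi f -> sqi g -> sqi h ->
  dot h (fun x => f x + g x) = dot h f + dot h g.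
Proof. by move=> sf sg sh; rewrite dotC dotDl// dotC [dot g h]dotC. Qed.

Lemma dotZr a f h : sqi f -> sqi h -> dot h (fun x => a * f x) = a * dot h f.
Proof. by move=> sf sh; rewrite dotC dotZl// dotC. Qed.

Lemma dotBr f g h : sqi f -> sqi g -> sqi h ->
  dot h (fun x => f x - g x) = dot h f - dot h g.
Proof. by move=> sf sg sh; rewrite dotC dotBl// dotC [dot g h]dotC. Qed.

Lemma dot0l h : dot (fun=> 0) h = 0.
Proof.
rewrite /dot; under eq_Rintegral do rewrite mul0r.
by rewrite /Rintegral integral0.
Qed.

Lemma dot_suml I (r : seq I) (c : I -> T -> R) h :
  (forall i, sqi (c i)) -> sqi h ->
  dot (fun x => \sum_(i <- r) c i x) h = \sum_(i <- r) dot (c i) h.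
Proof.
move=> sc sh; elim: r => [|i r ih].
  by under eq_fun do rewrite big_nil; rewrite big_nil dot0l.
under eq_fun do rewrite big_cons; rewrite big_cons dotDl ?ih//.
exact: sqi_sum.
Qed.

Lemma dot_ge0 f : 0 <= dot f f.
Proof. by apply: Rintegral_ge0 => x _; exact: sqr_ge0. Qed.

Lemma dotDD f g : sqi f -> sqi g ->
  dot (fun x => f x + g x) (fun x => f x + g x) = dot f f + 2 * dot f g + dot g g.
Proof.
move=> sf sg; rewrite dotDl ?dotDr//; try exact: sqiD.
by rewrite [dot g f]dotC; ring.
Qed.

Lemma dotBB f g : sqi f -> sqi g ->
  dot (fun x => f x - g x) (fun x => f x - g x) = dot f f - 2 * dot f g + dot g g.
Proof.
move=> sf sg; rewrite dotBl ?dotBr//; try exact: sqiB.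
by rewrite [dot g f]dotC; ring.
Qed.

Lemma cauchy_schwarz f g : sqi f -> sqi g -> dot f g ^+ 2 <= dot f f * dot g g.
Proof.
move=> sf sg.
have key a : 0 <= dot f f - 2 * a * dot f g + a ^+ 2 * dot g g.
  have := dot_ge0 (fun x => f x - a * g x).
  rewrite dotBB//; last exact: sqiZ.
  by rewrite !dotZr ?dotZl//; try exact: sqiZ; move=> h; apply: le_trans h _; nra.
have := dot_ge0 g; rewrite le_eqVlt => /orP[/eqP g0|g0].
  rewrite -g0 mulr0.
  have [->|n0] := eqVneq (dot f g) 0; first by rewrite expr0n.
  exfalso.
  have := key ((dot f f + 1) / (2 * dot f g)); rewrite -g0 mulr0 addr0.
  have -> : 2 * ((dot f f + 1) / (2 * dot f g)) * dot f g = dot f f + 1 by field.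
  by lra.
have := key (dot f g / dot g g).
have -> : dot f f - 2 * (dot f g / dot g g) * dot f g
    + (dot f g / dot g g) ^+ 2 * dot g g = dot f f - dot f g ^+ 2 / dot g g.
  by field; rewrite gt_eqF.
by rewrite subr_ge0 ler_pdivrMr.
Qed.

Lemma cauchy_schwarz_sqrt f g : sqi f -> sqi g ->
  `|dot f g| <= Num.sqrt (dot f f) * Num.sqrt (dot g g).
Proof.
move=> sf sg; rewrite -sqrtrM ?dot_ge0//.
by rewrite -sqrtr_sqr ler_sqrt ?mulr_ge0 ?dot_ge0// cauchy_schwarz.
Qed.

(** By Cauchy-Schwarz the error is at most the distance of fn n to f times the
    norm of g. *)
Lemma dot_cvg (fn : nat -> T -> R) f g : (forall n, sqi (fn n)) -> sqi f -> sqi g ->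
  (fun n => dot (fun x => fn n x - f x) (fun x => fn n x - f x)) @ \oo --> (0 : R) ->
  (fun n => dot (fn n) g) @ \oo --> dot f g.
Proof.
move=> sfn sf sg h.
apply/cvgrPdistC_le => /= eps e0; near=> n.
rewrite -dotBl//; apply: le_trans (cauchy_schwarz_sqrt _ sg) _.
  exact: sqiB.
have : dot (fun x => fn n x - f x) (fun x => fn n x - f x)
   <= (eps / (Num.sqrt (dot g g) + 1)) ^+ 2.
  rewrite -[leLHS]subr0; apply: le_trans (ler_norm _) _.
  near: n; move/cvgrPdistC_le: h; apply.
  by rewrite exprn_gt0// divr_gt0// ltr_wpDl// sqrtr_ge0.
set D := dot (fun x => fn n x - f x) _ => hD.
have q0 : 0 < Num.sqrt (dot g g) + 1 by rewrite ltr_wpDl// sqrtr_ge0.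
have : Num.sqrt D <= eps / (Num.sqrt (dot g g) + 1).
  by rewrite -[leRHS]ger0_norm ?divr_ge0 ?(ltW q0) ?(ltW e0)// -sqrtr_sqr ler_sqrt// sqr_ge0.
rewrite ler_pdivlMr// => hs; apply: le_trans hs.
by rewrite ler_wpM2l ?sqrtr_ge0// lerDl.
Unshelve. all: by end_near. Qed.

Lemma dot_cvg2 (fn : nat -> T -> R) f : (forall n, sqi (fn n)) -> sqi f ->
  (fun n => dot (fun x => fn n x - f x) (fun x => fn n x - f x)) @ \oo --> (0 : R) ->
  (fun n => dot (fn n) (fn n)) @ \oo --> dot f f.
Proof.
move=> sfn sf h.
have h2 := dot_cvg sfn sf sf h.
have -> : (fun n => dot (fn n) (fn n)) =
  (fun n => dot (fun x => fn n x - f x) (fun x => fn n x - f x)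
     + (2 * dot (fn n) f - dot f f)).
  by apply/funext => n; rewrite dotBB//; ring.
rewrite (_ : nbhs (dot f f) = nbhs (0 + (2 * dot f f - dot f f))); last first.
  by congr nbhs; ring.
apply: cvgD => //; apply: cvgB; last exact: cvg_cst.
by apply: cvgM => //; exact: cvg_cst.
Qed.

End square_integrable.

Section L2_inner.
Context {R : realType} (l : R).
Implicit Types v w : L2 l.

Lemma L2_sqi v : sqi (lebD l) v.
Proof.
split; first exact: measurable_funP.
exact: Lfun2_integrable_sqr (LfunP v).
Qed.

Lemma innerE v w : inner v w = dot (lebD l) v w. Proof. by []. Qed.

Lemma L2_addE v w x : (v + w) x = v x + w x. Proof. by []. Qed.
Lemma L2_scaleE a v x : (a *: v) x = a * v x. Proof. by []. Qed.
Lemma L2_oppE v x : (- v) x = - v x. Proof. by []. Qed.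

Lemma innerC v w : inner v w = inner w v. Proof. exact: dotC. Qed.
Lemma innerDl v1 v2 w : inner (v1 + v2) w = inner v1 w + inner v2 w.
Proof. exact: (dotDl (L2_sqi v1) (L2_sqi v2) (L2_sqi w)). Qed.
Lemma innerZl a v w : inner (a *: v) w = a * inner v w.
Proof. exact: (dotZl a (L2_sqi v) (L2_sqi w)). Qed.
Lemma innerBl v1 v2 w : inner (v1 - v2) w = inner v1 w - inner v2 w.
Proof. by rewrite innerDl -scaleN1r innerZl mulN1r. Qed.
Lemma inner0l w : inner 0 w = 0.
Proof. by rewrite -(scale0r 0) innerZl mul0r. Qed.
Lemma innerDr v1 v2 w : inner w (v1 + v2) = inner w v1 + inner w v2.
Proof. by rewrite innerC innerDl !(innerC w). Qed.
Lemma innerZr a v w : inner w (a *: v) = a * inner w v.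
Proof. by rewrite innerC innerZl innerC. Qed.
Lemma innerBr v1 v2 w : inner w (v1 - v2) = inner w v1 - inner w v2.
Proof. by rewrite innerC innerBl !(innerC w). Qed.
Lemma inner_suml I (r : seq I) (P : pred I) (F : I -> L2 l) w :
  inner (\sum_(i <- r | P i) F i) w = \sum_(i <- r | P i) inner (F i) w.
Proof.
elim/big_rec2: _ => [|i a b _ <-]; first exact: inner0l.
by rewrite innerDl.
Qed.
Lemma inner_ge0 v : 0 <= inner v v. Proof. exact: dot_ge0. Qed.
Lemma hnorm_sq v : hnorm v ^+ 2 = inner v v.
Proof. by rewrite sqr_sqrtr// inner_ge0. Qed.
Lemma hnorm_ge0 v : 0 <= hnorm v. Proof. exact: sqrtr_ge0. Qed.
Lemma inner_le v w : `|inner v w| <= hnorm v * hnorm w.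
Proof. exact: (cauchy_schwarz_sqrt (L2_sqi v) (L2_sqi w)). Qed.
Lemma heq_inner v v' w : heq v v' -> inner v w = inner v' w.
Proof.
move=> h; have := inner_le (v - v') w; rewrite h mul0r normr_le0 innerBl.
by rewrite subr_eq0 => /eqP.
Qed.
Lemma hnormD v w : hnorm (v + w) <= hnorm v + hnorm w.
Proof.
rewrite -[leRHS]ger0_norm ?addr_ge0 ?hnorm_ge0// -sqrtr_sqr ler_sqrt ?sqr_ge0//.
rewrite sqrrD !hnorm_sq innerDl !innerDr (innerC w v).
have := inner_le v w; rewrite ler_norml => /andP[_ h].
by rewrite mulr2n; lra.
Qed.
Lemma hnormZ a v : hnorm (a *: v) = `|a| * hnorm v.
Proof.
by rewrite /hnorm innerZl innerZr mulrA -expr2 sqrtrM ?sqr_ge0// sqrtr_sqr.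
Qed.
Lemma hnorm_sum I (r : seq I) (F : I -> L2 l) :
  hnorm (\sum_(i <- r) F i) <= \sum_(i <- r) hnorm (F i).
Proof.
elim/big_rec2: _ => [|i a b _ ih]; first by rewrite /hnorm inner0l sqrtr0.
by apply: le_trans (hnormD _ _) _; rewrite lerD2l.
Qed.
Lemma inner_sqD v w : inner (v + w) (v + w) <= 2 * inner v v + 2 * inner w w.
Proof.
have := inner_ge0 (v - w).
by rewrite !innerBl !innerBr !innerDl !innerDr (innerC w v); lra.
Qed.

End L2_inner.

(** * Fractional Brownian increments on a uniform grid *)

Section fractional_increments.
Context {R : realType}.
Implicit Types p h H a b c e A L V dl : R.

(** This is Young's inequality with exponents 1/p and 1/(1-p), one of the two
    factors being 1. *)
Lemma bernoulli_powR p a : 0 < p <= 1 -> 0 <= a -> a `^ p <= p * a + (1 - p).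
Proof.
move=> /andP[p0]; rewrite le_eqVlt => /orP[/eqP ->|p1] a0.
  by rewrite powRr1//; lra.
have := @conjugate_powR R (a `^ p) 1 p^-1 (1 - p)^-1 (powR_ge0 _ _) ler01.
rewrite !invr_gt0 subr_gt0 p0 p1 !invrK mulr1 powR1 mul1r => /(_ isT isT).
rewrite -powRrM mulfV ?gt_eqF// powRr1// => h.
by rewrite mulrC; apply: h; ring.
Qed.

(** Two unit increments of fractional Brownian motion at lag k + 1 have
    covariance (pinc p k.+1 - pinc p k) / 2, where p = 2 H. This first
    difference of k^p is therefore what monotonicity and summation by parts
    are applied to. *)
Definition pinc p (k : nat) : R := k.+1%:R `^ p - k%:R `^ p.

Lemma pinc0 p : 0 < p -> pinc p 0 = 1.
Proof. by move=> p0; rewrite /pinc powR1 powR0 ?gt_eqF// subr0. Qed.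

Lemma pinc_ge0 p k : 0 < p -> 0 <= pinc p k.
Proof.
by move=> p0; rewrite subr_ge0 ge0_ler_powR ?nnegrE ?ler0n ?ler_nat// ltW.
Qed.

(** The function k^(p-1) decreases, so k^p >= k (k+1)^(p-1), whereas (k+1)^p =
    (k+1) (k+1)^(p-1). *)
Lemma pinc_le p k : 0 < p <= 1 -> pinc p k <= k.+1%:R `^ (p - 1).
Proof.
move=> /andP[p0 p1]; rewrite /pinc lerBlDr.
have k1 : (0 : R) < k.+1%:R by rewrite ltr0n.
have -> : k.+1%:R `^ p = k.+1%:R * k.+1%:R `^ (p - 1) :> R.
  by rewrite mulr_powRB1// ltW.
set y := k.+1%:R `^ (p - 1); rewrite -natr1 mulrDl mul1r addrC lerD2l /y.
have [->|k0] := eqVneq k 0%N; first by rewrite mul0r powR_ge0.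
have kp : (0 : R) < k%:R by rewrite ltr0n lt0n.
rewrite -[leRHS](@mulr_powRB1 _ k%:R) ?ler0n// ler_wpM2l ?ler0n//.
rewrite -(opprB 1 p) !powRN lef_pV2 ?posrE ?powR_gt0//.
by rewrite ge0_ler_powR ?nnegrE ?ler0n ?ler_nat// subr_ge0.
Qed.

(** Concavity of x^p at k+1: Bernoulli's inequality at (k+2)/(k+1) and at
    k/(k+1), whose sum is 2. *)
Lemma pinc_decr p k : 0 < p <= 1 -> pinc p k.+1 <= pinc p k.
Proof.
move=> pp; rewrite /pinc lerBlDr addrAC lerBrDr.
have k1 : (0 : R) < k.+1%:R by rewrite ltr0n.
have e2 : k.+2%:R = k.+1%:R * (k.+2%:R / k.+1%:R) :> R by rewrite mulrC divfK ?gt_eqF.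
have e0 : k%:R = k.+1%:R * (k%:R / k.+1%:R) :> R by rewrite mulrC divfK ?gt_eqF.
rewrite e2 [in k%:R `^ p]e0 !powRM ?divr_ge0 ?ler0n//.
rewrite -mulrDr -mulr2n -[leRHS]mulr_natr ler_wpM2l ?powR_ge0//.
rewrite -!powRM ?invr_ge0 ?ler0n//.
have q2 : 0 <= k.+2%:R / k.+1%:R :> R by rewrite divr_ge0 ?ler0n.
have q0 : 0 <= k%:R / k.+1%:R :> R by rewrite divr_ge0 ?ler0n.
apply: le_trans (lerD (bernoulli_powR pp q2) (bernoulli_powR pp q0)) _.
rewrite addrACA -mulrDr -mulrDl.
have -> : (k.+2%:R + k%:R) / k.+1%:R = 2 :> R.
  by rewrite -natrD -(_ : 2 * k.+1 = k.+2 + k)%N ?natrM ?mulfK ?gt_eqF//; lia.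
by lra.
Qed.

Lemma sum_pinc_decr p m n : (m <= n)%N ->
  \sum_(m <= k < n) (pinc p k - pinc p k.+1) = pinc p m - pinc p n.
Proof.
move=> mn; rewrite -[RHS]opprB -telescope_sumr// -sumrN.
by apply: eq_bigr => k _; rewrite opprB.
Qed.

(** Summation by parts turns the sum into m^p - m (pinc p m). *)
Lemma sum_pinc_weighted p m : 0 < p <= 1 ->
  \sum_(0 <= k < m) k.+1%:R * (pinc p k - pinc p k.+1) <= m%:R `^ p.
Proof.
move=> /andP[p0 p1].
suff -> : \sum_(0 <= k < m) k.+1%:R * (pinc p k - pinc p k.+1) =
   m%:R `^ p - m%:R * pinc p m.
  by rewrite gerBl mulr_ge0 ?ler0n// pinc_ge0.
elim: m => [|m ih]; first by rewrite big_nil powR0 ?gt_eqF// mul0r subr0.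
rewrite big_nat_recr//= ih.
rewrite (_ : m.+1%:R `^ p = m%:R `^ p + pinc p m); last by rewrite /pinc; ring.
by rewrite -[in LHS]natr1 -[in RHS]natr1; ring.
Qed.

Definition fbm_inc (H a b c e : R) : R :=
  fbm_cov H b e - fbm_cov H b c - fbm_cov H a e + fbm_cov H a c.

Lemma fbm_incE H a b c e : fbm_inc H a b c e =
  (`|b - c| `^ (2 * H) + `|a - e| `^ (2 * H)
   - `|a - c| `^ (2 * H) - `|b - e| `^ (2 * H)) / 2.
Proof. by rewrite /fbm_inc /fbm_cov; field. Qed.

Lemma fbm_incC H a b c e : fbm_inc H a b c e = fbm_inc H c e a b.
Proof.
rewrite !fbm_incE (distrC b c) (distrC a e) (distrC a c) (distrC b e).
by congr (_ / 2); ring.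
Qed.

Lemma fbm_inc_diag H h i : 0 < H -> 0 <= h ->
  fbm_inc H (i%:R * h) (i.+1%:R * h) (i%:R * h) (i.+1%:R * h) = h `^ (2 * H).
Proof.
move=> H0 h0; rewrite fbm_incE.
have -> : i.+1%:R * h = i%:R * h + h by rewrite -natr1; ring.
rewrite !subrr normr0 powR0 ?mulf_neq0 ?gt_eqF//.
have -> : i%:R * h - (i%:R * h + h) = - h by ring.
have -> : i%:R * h + h - i%:R * h = h by ring.
by rewrite normrN ger0_norm//; field.
Qed.

(** For 2 H <= 1 this is nonpositive by [pinc_decr]: increments over disjoint
    intervals are negatively correlated, which is the property all the bounds
    below exploit. *)
Lemma fbm_inc_off H h i k : 0 < H -> 0 <= h ->
  fbm_inc H (i%:R * h) (i.+1%:R * h) ((i + k.+1)%:R * h) ((i + k.+1).+1%:R * h)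
  = - (h `^ (2 * H) * ((pinc (2 * H) k - pinc (2 * H) k.+1) / 2)).
Proof.
move=> H0 h0; rewrite fbm_incE -(natr1 i) -(natr1 (i + k.+1)) natrD -(natr1 k).
rewrite -!mulrBl !normrM (ger0_norm h0).
have -> : i%:R + 1 - (i%:R + (k%:R + 1)) = - k%:R :> R by ring.
have -> : i%:R - (i%:R + (k%:R + 1) + 1) = - (k.+2%:R) :> R by rewrite -!natr1; ring.
have -> : i%:R - (i%:R + (k%:R + 1)) = - (k.+1%:R) :> R by rewrite -!natr1; ring.
have -> : i%:R + 1 - (i%:R + (k%:R + 1) + 1) = - (k.+1%:R) :> R by rewrite -!natr1; ring.
rewrite !normrN !ger0_norm ?ler0n// !powRM ?ler0n// /pinc.
by field.
Qed.

Lemma sum_sym (f : nat -> nat -> R) N : (forall i j, f i j = f j i) ->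
  \sum_(0 <= i < N) \sum_(0 <= j < N) f i j =
  \sum_(0 <= i < N) f i i + 2 * \sum_(0 <= i < N) \sum_(i.+1 <= j < N) f i j.
Proof.
move=> fs; elim: N => [|N ih]; first by rewrite !big_nil mulr0 addr0.
rewrite big_nat_recr//= big_nat_recr//=.
under eq_bigr do rewrite big_nat_recr//=.
rewrite big_split/= ih.
rewrite (@big_nat_recr _ _ _ N 0 (fun i => f i i))//=.
rewrite [X in _ = _ + 2 * X]big_nat_recr//= (big_geq (m := N.+1))// addr0.
rewrite [X in _ = _ + 2 * X]big_nat_cond.
under [X in _ = _ + 2 * X]eq_bigr => i /andP[/andP[_ iN] _] do rewrite big_nat_recr//=.
rewrite -big_nat_cond big_split/=.
have -> : \sum_(0 <= i < N) f N i = \sum_(0 <= i < N) f i N.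
  by apply: eq_bigr => i _; rewrite fs.
by ring.
Qed.

(** The variance of the integral, against fractional Brownian motion, of the
    step function with values v on the grid of mesh h. *)
Definition fbm_form (H h : R) (N : nat) (v : nat -> R) : R :=
  \sum_(0 <= i < N) \sum_(0 <= j < N)
    v i * v j * fbm_inc H (i%:R * h) (i.+1%:R * h) (j%:R * h) (j.+1%:R * h).

(** The double sum only sees v through its autocorrelations. The number K of
    lags is free as soon as K >= N, since v vanishes from N on; this lets the
    lags be cut at an arbitrary place. *)
Lemma fbm_form_corr H h N K (v : nat -> R) : 0 < H -> 0 <= h -> (N <= K)%N ->
  (forall i, (N <= i)%N -> v i = 0) ->
  fbm_form H h N v = h `^ (2 * H) * (\sum_(0 <= i < N) v i ^+ 2 -
    \sum_(0 <= k < K) (pinc (2 * H) k - pinc (2 * H) k.+1) *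
      \sum_(0 <= i < N) v i * v (i + k.+1)%N).
Proof.
move=> H0 h0 NK v0; rewrite /fbm_form sum_sym; last first.
  by move=> i j; rewrite fbm_incC; ring.
rewrite mulrBr; congr (_ + _).
  by rewrite mulr_sumr; apply: eq_bigr => i _; rewrite fbm_inc_diag//; ring.
under [in RHS]eq_bigr do rewrite mulr_sumr.
rewrite exchange_big/= !mulr_sumr -sumrN; apply: eq_big_nat => i iN.
have -> : \sum_(i.+1 <= j < N) v i * v j *
     fbm_inc H (i%:R * h) (i.+1%:R * h) (j%:R * h) (j.+1%:R * h) =
   \sum_(i.+1 <= j < K + i.+1) v i * v j *
     fbm_inc H (i%:R * h) (i.+1%:R * h) (j%:R * h) (j.+1%:R * h).
  rewrite [RHS](big_cat_nat (n := N))//=; try lia.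
  rewrite [X in _ = _ + X](_ : _ = 0) ?addr0//.
  rewrite big_nat_cond big1// => j /andP[/andP[Nj _] _].
  by rewrite (v0 j)// mulr0 mul0r.
rewrite -[i.+1 in LHS]add0n big_addn addnK !mulr_sumr -sumrN.
apply: eq_bigr => k _.
rewrite (_ : (k + i.+1 = i + k.+1)%N); last by lia.
by rewrite fbm_inc_off//; field.
Qed.

(** In [fbm_form_corr] the weights pinc k - pinc k.+1 are nonnegative. Below
    the lag M, the autocorrelation at lag 0 minus the one at lag k is half a
    sum of squared increments of v, in which the jumps of v at both ends of
    the grid cost A^2 per unit of lag. Beyond M the autocorrelations are at
    most the one at lag 0 in absolute value and the weights telescope to pinc
    M. *)
Lemma fbm_form_boundM H h N M (v : nat -> R) A L : 0 < H <= 1 / 2 -> 0 <= h ->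
  (forall i, (N <= i)%N -> v i = 0) -> (forall i, `|v i| <= A) -> 0 <= L ->
  (forall k, h * \sum_(0 <= i < N - k) (v (i + k)%N - v i) ^+ 2 <= (k%:R * h) ^+ 2 * L) ->
  fbm_form H h N v <= h `^ (2 * H) * (2 * pinc (2 * H) M * \sum_(0 <= i < N) v i ^+ 2
     + A ^+ 2 * M%:R `^ (2 * H) + h * L * M%:R * M%:R `^ (2 * H) / 2).
Proof.
move=> /andP[H0 H1] h0 v0 vA L0 hL.
rewrite le_eqVlt in h0; case/orP: h0 => [/eqP h0|h0].
  by rewrite (fbm_form_corr (K := N)) -?h0// powR0 ?mul0r// mulf_neq0// gt_eqF.
set p := 2 * H.
have pp : 0 < p <= 1 by rewrite /p; lra.
have [p0 p1] := andP pp.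
rewrite (@fbm_form_corr H h N (M + N)) ?(ltW h0)//; last by lia.
rewrite ler_wpM2l ?powR_ge0//.
set g0 := \sum_(0 <= i < N) v i ^+ 2.
have g00 : 0 <= g0 by apply: sumr_ge0 => i _; exact: sqr_ge0.
pose g k := \sum_(0 <= i < N) v i * v (i + k.+1)%N.
rewrite -/p -/g0.
have A0 : 0 <= A by apply: le_trans (vA 0%N).
have sqA i : v i ^+ 2 <= A ^+ 2.
  by rewrite -[v i ^+ 2]real_normK ?num_real// ler_sqr ?nnegrE.
have shift k : \sum_(0 <= i < N) v (i + k)%N ^+ 2 + \sum_(0 <= i < k) v i ^+ 2 = g0.
  rewrite addrC.
  have -> : \sum_(0 <= i < N) v (i + k)%N ^+ 2 = \sum_(k <= i < N + k) v i ^+ 2.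
    by rewrite -{2}[k]add0n big_addn addnK.
  rewrite -big_cat_nat//=; last by lia.
  rewrite (big_cat_nat (n := N))//=; last by lia.
  rewrite [X in _ + X](_ : _ = 0) ?addr0//.
  rewrite big_nat_cond big1// => i /andP[/andP[Ni _] _].
  by rewrite v0// expr0n.
have gle k : - g k <= g0.
  have h1 : - (2 * g k) <= g0 + \sum_(0 <= i < N) v (i + k.+1)%N ^+ 2.
    rewrite /g0 /g mulr_sumr -sumrN -big_split/=; apply: ler_sum => i _.
    by have := sqr_ge0 (v i + v (i + k.+1)%N); rewrite sqrrD mulr2n; lra.
  have := shift k.+1; set a := \sum_(0 <= i < N) _; set b := \sum_(0 <= i < k.+1) _.
  move=> ab; have : 0 <= b by apply: sumr_ge0 => i _; exact: sqr_ge0.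
  by move: h1; rewrite -/a; lra.
have gs k : 2 * g0 - 2 * g k <= 2 * k.+1%:R * A ^+ 2 + k.+1%:R ^+ 2 * h * L.
  have -> : 2 * g0 - 2 * g k = \sum_(0 <= i < N) (v (i + k.+1)%N - v i) ^+ 2
      + \sum_(0 <= i < k.+1) v i ^+ 2.
    have -> : \sum_(0 <= i < N) (v (i + k.+1)%N - v i) ^+ 2 =
      \sum_(0 <= i < N) v (i + k.+1)%N ^+ 2 + (g0 - 2 * g k).
      rewrite /g0 /g mulr_sumr -sumrB -big_split/=; apply: eq_bigr => i _; ring.
    by rewrite addrAC (shift k.+1); ring.
  have b2 : \sum_(0 <= i < k.+1) v i ^+ 2 <= k.+1%:R * A ^+ 2.
    apply: le_trans (ler_sum _ (fun i _ => sqA i)) _.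
    by rewrite sumr_const_nat subn0 mulr_natl.
  have b1 : \sum_(0 <= i < N) (v (i + k.+1)%N - v i) ^+ 2 <=
     k.+1%:R * A ^+ 2 + k.+1%:R ^+ 2 * h * L.
    rewrite (big_cat_nat (n := N - k.+1))//=; last by lia.
    rewrite addrC lerD//.
      rewrite big_nat_cond.
      under eq_bigr => i /andP[/andP[ai _] _].
        rewrite (v0 (i + k.+1)%N); last by lia.
        rewrite sub0r sqrrN; over.
      rewrite -big_nat_cond; apply: le_trans (ler_sum _ (fun i _ => sqA i)) _.
      rewrite sumr_const_nat -[leLHS]mulr_natl ler_wpM2r ?sqr_ge0// ler_nat.
      by clear; lia.
    rewrite -(ler_pM2l h0); apply: le_trans (hL k.+1) _.
    by rewrite le_eqVlt; apply/orP; left; apply/eqP; ring.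
  by lra.
have Ek k : 0 <= pinc p k - pinc p k.+1 by rewrite subr_ge0 pinc_decr.
have -> : \sum_(0 <= k < M + N) (pinc p k - pinc p k.+1) * \sum_(0 <= i < N) v i * v (i + k.+1)%N
  = \sum_(0 <= k < M) (pinc p k - pinc p k.+1) * g k
  + \sum_(M <= k < M + N) (pinc p k - pinc p k.+1) * g k.
  by rewrite -big_cat_nat//=; lia.
(* e1 treats the lags from M on, e2 the ones below M *)
have e1 : - (\sum_(M <= k < M + N) (pinc p k - pinc p k.+1) * g k) <= pinc p M * g0.
  rewrite -sumrN.
  apply: (@le_trans _ _ (\sum_(M <= k < M + N) (pinc p k - pinc p k.+1) * g0)).
    by apply: ler_sum => k _; rewrite -mulrN ler_wpM2l.
  rewrite -mulr_suml sum_pinc_decr ?leq_addr// ler_wpM2r//.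
  by rewrite gerBl pinc_ge0.
have e2 : - (\sum_(0 <= k < M) (pinc p k - pinc p k.+1) * g k) <=
   - (1 - pinc p M) * g0 + A ^+ 2 * M%:R `^ p + h * L * M%:R * M%:R `^ p / 2.
  have <- : \sum_(0 <= k < M) (pinc p k - pinc p k.+1) = 1 - pinc p M.
    by rewrite sum_pinc_decr// pinc0.
  rewrite mulNr mulr_suml.
  rewrite -addrA -lerBlDl opprK -sumrN -big_split/=.
  apply: (@le_trans _ _ (\sum_(0 <= k < M) (k.+1%:R * (pinc p k - pinc p k.+1)) *
      (A ^+ 2 + h * L * M%:R / 2))).
    rewrite big_nat_cond [leRHS]big_nat_cond; apply: ler_sum => k /andP[/andP[_ kM] _].
    apply: (@le_trans _ _ ((pinc p k - pinc p k.+1) *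
       (k.+1%:R * A ^+ 2 + k.+1%:R ^+ 2 * h * L / 2))).
      rewrite -mulrN -mulrDr ler_wpM2l//; have := gs k; lra.
    rewrite mulrC [leRHS]mulrAC ler_wpM2r//.
    rewrite mulrDr lerD2l !mulrA ler_wpM2r ?invr_ge0//.
    rewrite expr2 -!mulrA ler_wpM2l ?ler0n// mulrC -!mulrA ler_wpM2l ?(ltW h0)//.
    by rewrite ler_wpM2l// ler_nat.
  rewrite -mulr_suml; apply: le_trans (ler_wpM2r _ (sum_pinc_weighted M pp)) _.
    by rewrite addr_ge0 ?sqr_ge0// !mulr_ge0// ltW.
  by rewrite le_eqVlt; apply/orP; left; apply/eqP; ring.
by lra.
Qed.

(** Interpolation between the sup norm (A), the squared L^2 norm (V) and the
    squared L^2 modulus of continuity (L) of the step function. The length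
    scale dl is arbitrary and will be chosen to balance the three terms; in
    [fbm_form_boundM] the cut M is the number of steps h in dl. The bound does
    not depend on the mesh h. *)
Lemma fbm_form_bound H h dl N (v : nat -> R) A V L :
  0 < H <= 1 / 2 -> 0 < h -> 0 < dl -> 0 <= L ->
  (forall i, (i < N)%N -> `|v i| <= A) ->
  h * \sum_(0 <= i < N) v i ^+ 2 <= V ->
  (forall k, h * \sum_(0 <= i < N - k) (v (i + k)%N - v i) ^+ 2 <= (k%:R * h) ^+ 2 * L) ->
  fbm_form H h N v <= 2 * dl `^ (2 * H - 1) * V + dl `^ (2 * H) * A ^+ 2
     + dl `^ (2 * H) * dl * L / 2.
Proof.
move=> HH h0 dl0 L0 vA vV vL.
have [H0 H1] := andP HH.
have [N0|N0] := posnP N.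
  rewrite N0 /fbm_form big_nil; move: vV; rewrite N0 big_nil mulr0 => V0.
  have := powR_ge0 dl (2 * H); have := powR_ge0 dl (2 * H - 1) => a1 a2.
  apply: addr_ge0; first apply: addr_ge0.
  - by rewrite !mulr_ge0.
  - by rewrite mulr_ge0// sqr_ge0.
  - by rewrite !mulr_ge0 ?invr_ge0// ltW.
have A0 : 0 <= A by apply: le_trans (vA _ N0).
pose w i := if (i < N)%N then v i else 0.
have vw : fbm_form H h N v = fbm_form H h N w.
  apply: eq_big_nat => i /andP[_ iN]; apply: eq_big_nat => j /andP[_ jN].
  by rewrite /w iN jN.
have vw2 : \sum_(0 <= i < N) v i ^+ 2 = \sum_(0 <= i < N) w i ^+ 2.
  by apply: eq_big_nat => i /andP[_ iN]; rewrite /w iN.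
pose M := Num.truncn (dl / h).
have dlh0 : 0 <= dl / h by rewrite divr_ge0// ltW.
have [hM hM1] : M%:R * h <= dl /\ dl <= M.+1%:R * h.
  split; [rewrite -ler_pdivlMr//|rewrite -ler_pdivrMr//]; first by rewrite truncn_le.
  by rewrite ltW// truncnS_gt.
rewrite vw; apply: le_trans (@fbm_form_boundM H h N M w A L HH (ltW h0) _ _ L0 _) _.
- by move=> i; rewrite /w ltnNge => ->.
- by move=> i; rewrite /w; case: ifP => // iN; [exact: vA|rewrite normr0].
- move=> k; apply: le_trans (vL k); rewrite ler_wpM2l ?(ltW h0)//.
  rewrite le_eqVlt; apply/orP; left; apply/eqP; apply: eq_big_nat => i /andP[_ iN].
  have ikN : (i + k < N)%N by clear -iN; lia.
  by rewrite /w ikN (leq_ltn_trans (leq_addr k i) ikN).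
rewrite -vw2 2!(mulrDr (h `^ (2 * H))); apply: lerD; first apply: lerD.
- rewrite -/(2 * H); set p := 2 * H.
  have pp : 0 < p <= 1 by rewrite /p; lra.
  have h1 : h `^ p = h * h `^ (p - 1) by rewrite mulr_powRB1 ?(ltW h0)//; lra.
  rewrite h1.
  have -> : h * h `^ (p - 1) * (2 * pinc p M * \sum_(0 <= i < N) v i ^+ 2) =
    2 * (h `^ (p - 1) * pinc p M) * (h * \sum_(0 <= i < N) v i ^+ 2) by ring.
  apply: ler_pM => //.
  + by rewrite !mulr_ge0 ?powR_ge0// pinc_ge0//; lra.
  + by rewrite mulr_ge0 ?(ltW h0)//; apply: sumr_ge0 => i _; exact: sqr_ge0.
  rewrite ler_wpM2l//; apply: le_trans (ler_wpM2l (powR_ge0 _ _) (pinc_le M pp)) _.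
  rewrite -powRM ?ler0n ?(ltW h0)// -(opprB 1 p) !powRN lef_pV2 ?posrE ?powR_gt0//; last first.
    by rewrite mulr_gt0.
  by rewrite ge0_ler_powR ?nnegrE ?mulr_ge0 ?(ltW h0) ?(ltW dl0) ?subr_ge0 1?mulrC//; lra.
- rewrite mulrCA mulrC ler_wpM2r ?sqr_ge0// -powRM ?ler0n ?(ltW h0)//.
  by rewrite ge0_ler_powR ?nnegrE ?mulr_ge0 ?(ltW h0) ?(ltW dl0) 1?mulrC//; lra.
- have -> : h `^ (2 * H) * (h * L * M%:R * M%:R `^ (2 * H) / 2) =
    (h `^ (2 * H) * M%:R `^ (2 * H)) * (M%:R * h) * L / 2 by ring.
  rewrite ler_wpM2r ?invr_ge0// ler_wpM2r//; apply: ler_pM => //.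
  + by rewrite mulr_ge0 ?powR_ge0.
  + by rewrite mulr_ge0 ?(ltW h0).
  rewrite -powRM ?ler0n ?(ltW h0)//.
  by rewrite ge0_ler_powR ?nnegrE ?mulr_ge0 ?(ltW h0) ?(ltW dl0) 1?mulrC//; lra.
Qed.

End fractional_increments.

(** * Smoothing the covariance *)

Section smoothed_covariance.
Context {R : realType}.
Implicit Types (p H s a b c e x L : R).

Lemma continuous_powR_pos p x : 0 < x -> {for x, continuous (fun s => s `^ p)}.
Proof.
move=> x0; have [d _] := @is_derive1_powR R p x x0.
exact/differentiable_continuous/derivable1_diffP.
Qed.

Lemma continuous_abs_powR p : 0 < p -> continuous (fun s : R => `|s| `^ p).
Proof.
move=> p0 x; have [->|x0] := eqVneq x 0.
  apply/cvgrPdist_le => /= eps e0.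
  rewrite normr0 powR0 ?gt_eqF//.
  have d0 : 0 < eps `^ p^-1 by rewrite powR_gt0.
  near=> y.
  have hy : `|y| <= eps `^ p^-1.
    by rewrite -[`|y|]normrN -sub0r; near: y; exact: cvgr_dist_le.
  rewrite sub0r normrN ger0_norm ?powR_ge0//.
  have -> : eps = (eps `^ p^-1) `^ p by rewrite -powRrM mulVf ?gt_eqF// powRr1// ltW.
  by rewrite ge0_ler_powR ?nnegrE ?normr_ge0 ?(ltW p0) ?(ltW d0).
apply: (@continuous_comp _ _ _ (fun s : R => `|s|) (fun s => s `^ p)).
  exact: norm_continuous.
by apply: continuous_powR_pos; rewrite normr_gt0.
Unshelve. all: by end_near. Qed.

(** The primitive of |s|^p vanishing at 0. *)
Definition abs_powR_prim p s : R := s * `|s| `^ p / (p + 1).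

Lemma is_derive_abs_powR_prim p s : 0 < p ->
  is_derive s 1 (abs_powR_prim p) (`|s| `^ p).
Proof.
move=> p0; have p1 : p + 1 != 0 by rewrite gt_eqF// addr_gt0.
have pos x : 0 < x -> is_derive x 1 (abs_powR_prim p) (`|x| `^ p).
  move=> x0.
  apply: (@near_eq_is_derive _ _ _ (fun y => (p + 1)^-1 * y `^ (p + 1))).
    near=> y; have y0 : 0 < y by near: y; exact: lt_nbhsr.
    rewrite /abs_powR_prim (ger0_norm (ltW y0)).
    by rewrite -[y `^ (p + 1)]mulr_powRB1 ?addr_gt0 ?(ltW y0)// addrK mulrC.
  apply: is_derive_eq; first exact: (@is_deriveZ _ _ _ _ (p + 1)^-1 _ _ _ (@is_derive1_powR _ (p + 1) x x0)).
  rewrite (ger0_norm (ltW x0)) addrK.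
  by rewrite /GRing.scale/= mulrA mulVf// mul1r.
have [s0|s0|->] := ltgtP s 0; [|exact: pos|].
  have h : is_derive s 1 (fun y => - abs_powR_prim p (- y)) (`|s| `^ p).
    have ms0 : 0 < - s by rewrite oppr_gt0.
    apply: is_derive_eq.
      apply: is_deriveN; apply: (@is_derive1_comp _ _ (fun y => - y)); first exact: (pos _ ms0).
    by rewrite mulrN1 opprK normrN.
  have -> // : abs_powR_prim p = (fun y => - abs_powR_prim p (- y)).
  by apply/funext => y; rewrite /abs_powR_prim normrN; ring.
rewrite normr0 powR0 ?gt_eqF//.
apply/is_derive1_caratheodory; exists (fun z => `|z| `^ p / (p + 1)); split.
- by move=> z; rewrite /abs_powR_prim; ring.
- by apply: cvgM; [exact: continuous_abs_powR|exact: cvg_cst].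
- by rewrite normr0 powR0 ?gt_eqF// mul0r.
Unshelve. all: by end_near. Qed.

Definition C1_prim (N : R -> R) : Prop :=
  exists2 n : R -> R, continuous n & forall x, is_derive x 1 N (n x).

(** The mean over x in [0, L] of fbm_inc H a b (c + x) (e + x) is the
    increment of this function between a and b, divided by L. For 2 H <= 1 the
    covariance is not differentiable in its end points, but this function is
    of class C^1. *)
Definition shift_prim H L c e (y : R) : R :=
  (abs_powR_prim (2 * H) (y - c) - abs_powR_prim (2 * H) (y - (c + L))
   - (abs_powR_prim (2 * H) (y - e) - abs_powR_prim (2 * H) (y - (e + L)))) / 2.

Lemma is_derive_shifted p c x : 0 < p ->
  is_derive x 1 (fun y => abs_powR_prim p (y - c)) (`|x - c| `^ p).
Proof.
move=> p0; apply: is_derive_eq.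
  apply: (@is_derive1_comp _ _ (fun y => y - c)); first exact: is_derive_abs_powR_prim.
by rewrite subr0 mulr1.
Qed.

Lemma is_derive_reflected p c x : 0 < p ->
  is_derive x 1 (fun y => abs_powR_prim p (c - y)) (- (`|c - x| `^ p)).
Proof.
move=> p0; apply: is_derive_eq.
  apply: (@is_derive1_comp _ _ (fun y => c - y)); first exact: is_derive_abs_powR_prim.
by rewrite add0r mulrN mulr1 mulrN1.
Qed.

Lemma shift_prim_C1 H L c e : 0 < H -> C1_prim (shift_prim H L c e).
Proof.
move=> H0; have p0 : 0 < 2 * H by rewrite mulr_gt0.
exists (fun y => (`|y - c| `^ (2 * H) - `|y - (c + L)| `^ (2 * H)
   - (`|y - e| `^ (2 * H) - `|y - (e + L)| `^ (2 * H))) / 2).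
  have cs (z : R) : continuous (fun y : R => `|y - z| `^ (2 * H)).
    move=> y; apply: (@continuous_comp _ _ _ (fun y => y - z) (fun s : R => `|s| `^ (2 * H))).
      by apply: cvgB; [exact: cvg_id|exact: cvg_cst].
    exact: continuous_abs_powR.
  move=> y; apply: cvgM; last exact: cvg_cst.
  by apply: cvgB; apply: cvgB; exact: cs.
move=> x.
have d z := is_derive_shifted z x p0.
have h := is_deriveZ 2^-1 (is_deriveB (is_deriveB (d c) (d (c + L))) (is_deriveB (d e) (d (e + L)))).
have -> : shift_prim H L c e = 2^-1 \*: ((fun y => abs_powR_prim (2 * H) (y - c)) -
  (fun y => abs_powR_prim (2 * H) (y - (c + L))) - ((fun y => abs_powR_prim (2 * H) (y - e)) -
   (fun y => abs_powR_prim (2 * H) (y - (e + L))))).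
  by apply/funext => y; rewrite /shift_prim mulrC.
by apply: is_derive_eq h _; rewrite /GRing.scale/= mulrC.
Qed.

Lemma is_derive_fbm_inc_shift H a b c e x : 0 < H ->
  is_derive x 1 (fun y => (abs_powR_prim (2 * H) (a - c - y) + abs_powR_prim (2 * H) (b - e - y)
     - abs_powR_prim (2 * H) (b - c - y) - abs_powR_prim (2 * H) (a - e - y)) / 2)
   (fbm_inc H a b (c + x) (e + x)).
Proof.
move=> H0; have p0 : 0 < 2 * H by rewrite mulr_gt0.
have d z := is_derive_reflected z x p0.
have h := is_deriveZ 2^-1 (is_deriveB (is_deriveB (is_deriveD (d (a - c)) (d (b - e))) (d (b - c))) (d (a - e))).
rewrite (_ : (fun y => _) = 2^-1 \*: ((fun y => abs_powR_prim (2 * H) (a - c - y)) +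
  (fun y => abs_powR_prim (2 * H) (b - e - y)) - (fun y => abs_powR_prim (2 * H) (b - c - y)) -
   (fun y => abs_powR_prim (2 * H) (a - e - y)))); last first.
  by apply/funext => y; rewrite [RHS]mulrC.
apply: is_derive_eq h _; rewrite /GRing.scale/= fbm_incE !opprD !addrA.
by field.
Qed.

Lemma is_derive_seq_sum I (r : seq I) (w : I -> R) (f df : I -> R -> R) x :
  (forall i, is_derive x 1 (f i) (df i x)) ->
  is_derive x 1 (fun y => \sum_(i <- r) w i * f i y) (\sum_(i <- r) w i * df i x).
Proof.
move=> hf; elim: r => [|i r ih].
  rewrite big_nil; under eq_fun do rewrite big_nil; exact: is_derive_cst.
rewrite big_cons; under eq_fun do rewrite big_cons.
exact: (is_deriveD (is_deriveZ (w i) (hf i)) ih).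
Qed.

(** By the mean value theorem in the shift x, the mean over [0, L] of the sum
    is its value at a single shift, to which the assumed bound applies. *)
Lemma mean_shift_bound I (r : seq I) (w a b : I -> R) H L c e (G eps : R) : 0 < H -> 0 < L ->
  (forall x, 0 <= x <= L ->
     `|G - \sum_(i <- r) w i * fbm_inc H (a i) (b i) (c + x) (e + x)| <= eps) ->
  `|G - \sum_(i <- r) w i *
      ((shift_prim H L c e (b i) - shift_prim H L c e (a i)) / L)| <= eps.
Proof.
move=> H0 L0 hx.
pose kap i y := (abs_powR_prim (2 * H) (a i - c - y) + abs_powR_prim (2 * H) (b i - e - y)
     - abs_powR_prim (2 * H) (b i - c - y) - abs_powR_prim (2 * H) (a i - e - y)) / 2.
pose Psi y := \sum_(i <- r) w i * kap i y.
have dPsi x : is_derive x 1 Psi (\sum_(i <- r) w i * fbm_inc H (a i) (b i) (c + x) (e + x)).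
  apply: (@is_derive_seq_sum _ r w kap (fun i y => fbm_inc H (a i) (b i) (c + y) (e + y))).
  by move=> i; exact: is_derive_fbm_inc_shift.
have cPsi : {within `[0, L], continuous Psi}.
  apply: derivable_within_continuous => x _; exact: (@ex_derive _ _ _ _ _ _ _ (dPsi x)).
have [x xL /esym hm] := MVT L0 (fun x _ => dPsi x) cPsi.
rewrite subr0 in hm.
have xL2 : 0 <= x <= L by move: xL; rewrite in_itv/= => /andP[? ?]; rewrite !ltW.
have := hx x xL2.
have <- : \sum_(i <- r) w i * fbm_inc H (a i) (b i) (c + x) (e + x) =
    \sum_(i <- r) w i * ((shift_prim H L c e (b i) - shift_prim H L c e (a i)) / L).
  rewrite -[LHS](mulfK (lt0r_neq0 L0)) hm /Psi -sumrB mulr_suml.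
  apply: eq_bigr => i _; rewrite /kap /shift_prim !opprD !addrA !subr0.
  have -> : a i - c - L = a i + - c - L by [].
  by rewrite -mulrBr -mulrA; congr (_ * _); field; rewrite gt_eqF.
by [].
Qed.

End smoothed_covariance.

(** * Increments of the sheet and closability of the Wiener integral *)

Section l2norm.
Context d (T : measurableType d) (R : realType) (mu : {measure set T -> \bar R}).
Implicit Types f g : T -> R.

Definition nrm f : R := Num.sqrt (dot mu f f).

Lemma nrm_ge0 f : 0 <= nrm f. Proof. exact: sqrtr_ge0. Qed.

Lemma nrm_sq f : nrm f ^+ 2 = dot mu f f.
Proof. by rewrite sqr_sqrtr// dot_ge0. Qed.

Lemma nrmD f g : sqi mu f -> sqi mu g -> nrm (fun x => f x + g x) <= nrm f + nrm g.
Proof.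
move=> sf sg; rewrite -(@ler_pXn2r _ 2) ?nnegrE ?addr_ge0 ?nrm_ge0//.
rewrite sqrrD !nrm_sq dotDD// lerD2r lerD2l -[leRHS]mulr_natl.
rewrite ler_wpM2l//; apply: le_trans (ler_norm _) _; exact: cauchy_schwarz_sqrt.
Qed.

Lemma nrmN f : sqi mu f -> nrm (fun x => - f x) = nrm f.
Proof.
move=> sf; rewrite /nrm; congr Num.sqrt.
have -> : (fun x => - f x) = (fun x => (-1) * f x) by apply/funext => x; rewrite mulN1r.
by rewrite dotZl ?dotZr ?mulrA ?mulN1r ?opprK ?mul1r//; exact: sqiZ.
Qed.

Lemma nrmB f g : sqi mu f -> sqi mu g -> nrm (fun x => f x - g x) <= nrm f + nrm g.
Proof.
move=> sf sg; rewrite -(nrmN sg); apply: nrmD => //.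
have -> : (fun x => - g x) = (fun x => (-1) * g x) by apply/funext => x; rewrite mulN1r.
exact: sqiZ.
Qed.

End l2norm.

Section sheet.
Context {R : realType} {d : measure_display} {Omega : measurableType d}.
Variable P : probability Omega R.
Variables (l T H1 H2 : R) (W : R -> R -> Omega -> R).
Hypothesis hW : fractional_brownian_sheet P l T H1 H2 W.
Hypothesis HH1 : 0 < H1 <= 1 / 2.
Hypothesis HH2 : 0 < H2 <= 1 / 2.
Implicit Types (x y z t r a b c e eta C B : R) (q : rect_term l) (p : seq (rect_term l)).

Lemma sheet_sqi x t : x \in `[0, l] -> t \in `[0, T] -> sqi P (W x t).
Proof.
move=> xl tT.
have mW : measurable_fun setT (W x t).
  have [+ _] := @fbs_gaussian _ _ _ _ _ _ _ _ _ hW 1 (fun=> 1) (fun=> x) (fun=> t) (fun=> conj xl tT).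
  by under eq_fun do rewrite big_ord1 mul1r.
split => //.
have := fbs_cov hW xl xl tT tT; rewrite unlock => h.
apply/integrableP; split; first by apply/measurable_EFinP; exact: measurable_funX.
under eq_integral do rewrite /= ger0_norm ?sqr_ge0// expr2.
by rewrite h ltry.
Qed.

Lemma sheet_dot x t y r : x \in `[0, l] -> y \in `[0, l] -> t \in `[0, T] -> r \in `[0, T] ->
  dot P (W x t) (W y r) = fbm_cov H1 x y * fbm_cov H2 t r.
Proof.
move=> xl yl tT rT.
by have := fbs_cov hW xl yl tT rT; rewrite unlock /dot /Rintegral => ->.
Qed.

Definition sheet_inc a b c e : Omega -> R :=
  fun w => W b e w - W a e w - (W b c w - W a c w).

Definition in_rect a b c e :=
  [/\ a \in `[0, l], b \in `[0, l], c \in `[0, T] & e \in `[0, T]].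

Lemma sheet_inc_sqi a b c e : in_rect a b c e -> sqi P (sheet_inc a b c e).
Proof. by move=> [al bl cT eT]; apply: sqiB; apply: sqiB; exact: sheet_sqi. Qed.

Lemma sheet_inc_dot a b c e a' b' c' e' : in_rect a b c e -> in_rect a' b' c' e' ->
  dot P (sheet_inc a b c e) (sheet_inc a' b' c' e') =
  fbm_inc H1 a b a' b' * fbm_inc H2 c e c' e'.
Proof.
move=> [al bl cT eT] [al' bl' cT' eT'].
rewrite /sheet_inc.
have s x t : x \in `[0, l] -> t \in `[0, T] -> sqi P (W x t) by exact: sheet_sqi.
have sB x y t : x \in `[0, l] -> y \in `[0, l] -> t \in `[0, T] ->
  sqi P (fun w => W x t w - W y t w) by move=> *; apply: sqiB; exact: s.
rewrite dotBl; [|exact: sB|exact: sB|by apply: sqiB; exact: sB].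
rewrite !dotBr; try exact: sB.
do !(rewrite dotBl; [|exact: s|exact: s|exact: sB || exact: s]).
rewrite !sheet_dot// /fbm_inc.
by do 4!move: (fbm_cov H1 _ _) => ?; do 4!move: (fbm_cov H2 _ _) => ?; ring.
all: exact: s.
Qed.

(** Only one variable moves at a time, and the variance of a one-parameter
    increment is |x - y|^(2H) times a bounded factor. *)
Lemma sheet_move x y t r : x \in `[0, l] -> y \in `[0, l] -> t \in `[0, T] -> r \in `[0, T] ->
  nrm P (fun w => W x t w - W y r w) <=
   `|x - y| `^ H1 * T `^ H2 + l `^ H1 * `|t - r| `^ H2.
Proof.
move=> xl yl tT rT.
have s z u : z \in `[0, l] -> u \in `[0, T] -> sqi P (W z u) by exact: sheet_sqi.
have -> : (fun w => W x t w - W y r w) =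
   (fun w => (W x t w - W y t w) + (W y t w - W y r w)).
  by apply/funext => w; ring.
apply: le_trans (nrmD _ _) _; try by apply: sqiB; exact: s.
have [/andP[H10 _] /andP[H20 _]] := (HH1, HH2).
have cov0 (K z : R) : 0 < K -> fbm_cov K z z = `|z| `^ (2 * K).
  by move=> K0; rewrite /fbm_cov subrr normr0 powR0 ?mulf_neq0 ?gt_eqF//; field.
have sq2 (K z : R) : 0 <= z -> z `^ (2 * K) = (z `^ K) ^+ 2.
  by move=> z0; rewrite mulrC powRrM powR_mulrn// powR_ge0.
have l0 z : z \in `[0, l] -> `|z| `^ H1 <= l `^ H1.
  rewrite in_itv/= => /andP[z0 zl].
  by rewrite ge0_ler_powR ?nnegrE ?normr_ge0 ?(ltW H10) ?(le_trans z0)// ger0_norm.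
have t0 z : z \in `[0, T] -> `|z| `^ H2 <= T `^ H2.
  rewrite in_itv/= => /andP[z0 zl].
  by rewrite ge0_ler_powR ?nnegrE ?normr_ge0 ?(ltW H20) ?(le_trans z0)// ger0_norm.
apply: lerD.
  rewrite -(@ler_pXn2r _ 2) ?nnegrE ?mulr_ge0 ?nrm_ge0 ?powR_ge0//.
  rewrite nrm_sq dotBB ?sheet_dot//; try exact: s.
  have -> : fbm_cov H1 x x * fbm_cov H2 t t - 2 * (fbm_cov H1 x y * fbm_cov H2 t t)
     + fbm_cov H1 y y * fbm_cov H2 t t = `|x - y| `^ (2 * H1) * fbm_cov H2 t t.
    by rewrite !(cov0 H1)// /fbm_cov; field.
  rewrite cov0// !sq2 ?normr_ge0// exprMn ler_wpM2l ?sqr_ge0//.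
  by rewrite ler_pXn2r ?nnegrE ?powR_ge0// t0.
rewrite -(@ler_pXn2r _ 2) ?nnegrE ?mulr_ge0 ?nrm_ge0 ?powR_ge0//.
rewrite nrm_sq dotBB ?sheet_dot//; try exact: s.
have -> : fbm_cov H1 y y * fbm_cov H2 t t - 2 * (fbm_cov H1 y y * fbm_cov H2 t r)
   + fbm_cov H1 y y * fbm_cov H2 r r = fbm_cov H1 y y * `|t - r| `^ (2 * H2).
  by rewrite !(cov0 H2)// /fbm_cov; field.
rewrite cov0// !sq2 ?normr_ge0// exprMn ler_wpM2r ?sqr_ge0//.
by rewrite ler_pXn2r ?nnegrE ?powR_ge0// l0.
Qed.

Section scalar_integral.
Variables (t : R) (tT : t \in `[0, T]) (e0 : L2 l).

Definition term_inc q := sheet_inc (yl q) (yr q) (tl q) (tr q).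

Definition scalar_integral p : Omega -> R :=
  fun w => \sum_(q <- p) inner (coef q) e0 * term_inc q w.

Lemma scalar_integralE p w : inner (elem_integral W p w) e0 = scalar_integral p w.
Proof.
rewrite inner_suml; apply: eq_bigr => q _; rewrite innerZl mulrC /term_inc /sheet_inc.
by congr (_ * _); ring.
Qed.

Lemma rect_in_rect q : rect_in t q -> in_rect (yl q) (yr q) (tl q) (tr q).
Proof.
move: tT; rewrite in_itv/= => /andP[t0 tTT].
move=> /and5P[y0 yy yl0 t00 /andP[tt trt]].
by split; rewrite in_itv/=; apply/andP; split; lra.
Qed.

Lemma scalar_integral_sqi p : all (rect_in t) p -> sqi P (scalar_integral p).
Proof.
elim: p => [|q p ih] /=.
  move=> _; rewrite /scalar_integral; under eq_fun do rewrite big_nil; exact: sqi0.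
move=> /andP[rq rp]; rewrite /scalar_integral; under eq_fun do rewrite big_cons.
by apply: sqiD; [apply/sqiZ/sheet_inc_sqi/rect_in_rect|exact: ih].
Qed.

Lemma scalar_integral_dotl p f : all (rect_in t) p -> sqi P f ->
  dot P (scalar_integral p) f = \sum_(q <- p) inner (coef q) e0 * dot P (term_inc q) f.
Proof.
elim: p => [|q p ih] /= + sf.
  by move=> _; rewrite /scalar_integral; under eq_fun do rewrite big_nil; rewrite dot0l big_nil.
move=> /andP[rq rp]; rewrite big_cons -ih//.
rewrite {1}/scalar_integral; under eq_fun do rewrite big_cons.
have h := sheet_inc_sqi (rect_in_rect rq).
by rewrite dotDl ?dotZl//; [exact: sqiZ|exact: scalar_integral_sqi].
Qed.

(** The integral of the e0-component of the elementary integrand against the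
    product density N1' (y) N2' (tau). *)
Definition pairing (N1 N2 : R -> R) p : R :=
  \sum_(q <- p) inner (coef q) e0 * (N1 (yr q) - N1 (yl q)) * (N2 (tr q) - N2 (tl q)).

Lemma all_sum_in p (f g : rect_term l -> R) : all (rect_in t) p ->
  (forall q, rect_in t q -> f q = g q) -> \sum_(q <- p) f q = \sum_(q <- p) g q.
Proof.
elim: p => [|q p ih]; first by rewrite !big_nil.
by move=> /= /andP[rq rp] h; rewrite !big_cons h// ih.
Qed.

(** The rectangle of the increment is contracted by 1 - eta, which leaves room
    to translate it by up to eta times the side lengths. Every translate is
    close to the original increment by [sheet_move]. Averaging over the
    translations replaces the covariance by densities of class C^1, hence the
    covariance with X by a difference of pairings. *)
Lemma dot_inc_approx p p' a b c e eta C : 0 < t -> 0 < l -> 0 < eta < 1 ->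
  all (rect_in t) p -> all (rect_in t) p' ->
  a \in `[0, l] -> b \in `[0, l] -> c \in `[0, t] -> e \in `[0, t] ->
  nrm P (fun w => scalar_integral p w - scalar_integral p' w) <= C ->
  `|dot P (fun w => scalar_integral p w - scalar_integral p' w) (sheet_inc a b c e)| <=
   4 * C * ((eta * l) `^ H1 * T `^ H2 + l `^ H1 * (eta * T) `^ H2) +
   `|pairing (shift_prim H1 (eta * l) ((1 - eta) * a) ((1 - eta) * b))
            (shift_prim H2 (eta * t) ((1 - eta) * c) ((1 - eta) * e)) p -
    pairing (shift_prim H1 (eta * l) ((1 - eta) * a) ((1 - eta) * b))
            (shift_prim H2 (eta * t) ((1 - eta) * c) ((1 - eta) * e)) p'| / (eta * l * (eta * t)).
Proof.
move=> t0 l0 /andP[eta0 eta1] rp rp' al bl ct et hC.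
have [/andP[H10 _] /andP[H20 _]] := (HH1, HH2).
have [t0' tTT] : 0 <= t /\ t <= T by move: tT; rewrite in_itv/= => /andP[].
set X := (fun w => _ - _) in hC *.
set eps := 4 * C * _.
set N1 := shift_prim H1 _ _ _; set N2 := shift_prim H2 _ _ _.
have sX : sqi P X by apply: sqiB; exact: scalar_integral_sqi.
have inT z : z \in `[0, t] -> z \in `[0, T].
  by rewrite !in_itv/= => /andP[-> /le_trans]; apply.
have conv z L x : z \in `[0, L] -> 0 <= x <= eta * L -> (1 - eta) * z + x \in `[0, L].
  by rewrite !in_itv/= => /andP[z0 zL] /andP[x0 xL]; apply/andP; split; nra.
have dist z L x : z \in `[0, L] -> 0 <= x <= eta * L -> `|z - ((1 - eta) * z + x)| <= eta * L.
  rewrite !in_itv/= => /andP[z0 zL] /andP[x0 xL].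
  by rewrite ler_norml; apply/andP; split; nra.
pose SI := sheet_inc.
have bnd x x' : 0 <= x <= eta * l -> 0 <= x' <= eta * t ->
   `|dot P X (SI a b c e) - dot P X (SI ((1 - eta) * a + x) ((1 - eta) * b + x)
       ((1 - eta) * c + x') ((1 - eta) * e + x'))| <= eps.
  move=> hx hx'.
  have rr : in_rect a b c e by split => //; exact: inT.
  have rr' : in_rect ((1 - eta) * a + x) ((1 - eta) * b + x)
       ((1 - eta) * c + x') ((1 - eta) * e + x').
    by split; try exact: conv; apply/inT/conv.
  rewrite -dotBr//; [|exact: sheet_inc_sqi|exact: sheet_inc_sqi].
  apply: le_trans (cauchy_schwarz_sqrt sX _) _; first by apply: sqiB; exact: sheet_inc_sqi.
  rewrite -/(nrm P X) -/(nrm P (fun w => SI a b c e w - SI _ _ _ _ w)).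
  rewrite /eps mulrAC mulrC ler_pM ?nrm_ge0//.
  set B := (eta * l) `^ H1 * T `^ H2 + l `^ H1 * (eta * T) `^ H2.
  have mv y y' z z' : y \in `[0, l] -> y' \in `[0, l] -> z \in `[0, T] -> z' \in `[0, T] ->
     `|y - y'| <= eta * l -> `|z - z'| <= eta * T -> nrm P (fun w => W y z w - W y' z' w) <= B.
    move=> yl0 yl' zT zT' hy hz; apply: le_trans (sheet_move yl0 yl' zT zT') _.
    by apply: lerD; [rewrite ler_wpM2r ?powR_ge0//|rewrite ler_wpM2l ?powR_ge0//];
      rewrite ge0_ler_powR ?nnegrE ?mulr_ge0 ?normr_ge0 ?(ltW H10) ?(ltW H20) ?(ltW eta0) ?(ltW l0)//;
      exact: le_trans t0' tTT.
  have [_ _ rc re] := rr.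
  have [ra' rb' rc' re'] := rr'.
  have dT z : z \in `[0, t] -> `|z - ((1 - eta) * z + x')| <= eta * T.
    by move=> zt; apply: le_trans (dist _ _ _ zt hx') _; rewrite ler_wpM2l ?(ltW eta0).
  set D := fun y y' z z' (w : Omega) => W y z w - W y' z' w.
  have sD y y' z z' : y \in `[0, l] -> y' \in `[0, l] -> z \in `[0, T] -> z' \in `[0, T] -> sqi P (D y y' z z').
    by move=> *; apply: sqiB; exact: sheet_sqi.
  have -> : (fun w => SI a b c e w - SI ((1 - eta) * a + x) ((1 - eta) * b + x)
       ((1 - eta) * c + x') ((1 - eta) * e + x') w) =
    (fun w => (D b ((1 - eta) * b + x) e ((1 - eta) * e + x') w
             - D a ((1 - eta) * a + x) e ((1 - eta) * e + x') w)
            - (D b ((1 - eta) * b + x) c ((1 - eta) * c + x') w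
             - D a ((1 - eta) * a + x) c ((1 - eta) * c + x') w)).
    by apply/funext => w; rewrite /D /SI /sheet_inc; ring.
  have dl z : z \in `[0, l] -> `|z - ((1 - eta) * z + x)| <= eta * l by move=> zl; exact: dist.
  apply: (@le_trans _ _ ((B + B) + (B + B))); last by lra.
  by apply: le_trans (nrmB _ _) _; try (apply: sqiB; exact: sD); apply: lerD;
    apply: le_trans (nrmB _ _) _; try exact: sD; apply: lerD; apply: mv => //; exact: dl || exact: dT.
(* both pairs of shifts are averaged, one variable at a time *)
pose pp := [seq (true, q) | q <- p] ++ [seq (false, q) | q <- p'].
pose sgn (i : bool) : R := if i then 1 else -1.
have sum_pp (f : rect_term l -> R) : \sum_(i <- pp) sgn i.1 * f i.2 =
    \sum_(q <- p) f q - \sum_(q <- p') f q.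
  rewrite big_cat !big_map/=; congr (_ + _).
    by apply: eq_bigr => q _; rewrite /sgn mul1r.
  by rewrite -sumrN; apply: eq_bigr => q _; rewrite /sgn mulN1r.
have dotE x x' : 0 <= x <= eta * l -> 0 <= x' <= eta * t ->
   dot P X (SI ((1 - eta) * a + x) ((1 - eta) * b + x)
       ((1 - eta) * c + x') ((1 - eta) * e + x')) =
   \sum_(i <- pp) (sgn i.1 * (inner (coef i.2) e0 *
      fbm_inc H2 (tl i.2) (tr i.2) ((1 - eta) * c + x') ((1 - eta) * e + x'))) *
      fbm_inc H1 (yl i.2) (yr i.2) ((1 - eta) * a + x) ((1 - eta) * b + x).
  move=> hx hx'.
  under [RHS]eq_bigr do rewrite -mulrA.
  rewrite (sum_pp (fun q => inner (coef q) e0 *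
      fbm_inc H2 (tl q) (tr q) ((1 - eta) * c + x') ((1 - eta) * e + x') *
      fbm_inc H1 (yl q) (yr q) ((1 - eta) * a + x) ((1 - eta) * b + x))).
  have rr' : in_rect ((1 - eta) * a + x) ((1 - eta) * b + x)
       ((1 - eta) * c + x') ((1 - eta) * e + x').
    by split; try exact: conv; apply/inT/conv.
  have h2 := sheet_inc_sqi rr'.
  rewrite dotBl ?scalar_integral_dotl//; try exact: scalar_integral_sqi.
  by congr (_ - _); apply: all_sum_in => // q rq;
    rewrite sheet_inc_dot//; [ring|exact: rect_in_rect|ring|exact: rect_in_rect].
have L10 : 0 < eta * l by rewrite mulr_gt0.
have L20 : 0 < eta * t by rewrite mulr_gt0.
have step1 x' : 0 <= x' <= eta * t ->
  `|dot P X (SI a b c e) - \sum_(i <- pp) (sgn i.1 * (inner (coef i.2) e0 *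
      fbm_inc H2 (tl i.2) (tr i.2) ((1 - eta) * c + x') ((1 - eta) * e + x'))) *
      ((N1 (yr i.2) - N1 (yl i.2)) / (eta * l))| <= eps.
  move=> hx'; apply: mean_shift_bound => // x hx.
  by rewrite -dotE//; exact: bnd.
have step2 :
  `|dot P X (SI a b c e) - \sum_(i <- pp) (sgn i.1 * (inner (coef i.2) e0 *
      ((N1 (yr i.2) - N1 (yl i.2)) / (eta * l)))) *
      ((N2 (tr i.2) - N2 (tl i.2)) / (eta * t))| <= eps.
  apply: mean_shift_bound => // x' hx'.
  apply: le_trans (step1 _ hx'); rewrite le_eqVlt; apply/orP; left; apply/eqP.
  by congr (`|_ - _|); apply: eq_bigr => i _; ring.
rewrite -lerBlDr; apply: le_trans step2.
rewrite -[X in _ - X](_ : `|\sum_(i <- pp) (sgn i.1 * (inner (coef i.2) e0 *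
      ((N1 (yr i.2) - N1 (yl i.2)) / (eta * l)))) *
      ((N2 (tr i.2) - N2 (tl i.2)) / (eta * t))| = _); first exact: lerB_dist.
have -> : \sum_(i <- pp) (sgn i.1 * (inner (coef i.2) e0 *
      ((N1 (yr i.2) - N1 (yl i.2)) / (eta * l)))) *
      ((N2 (tr i.2) - N2 (tl i.2)) / (eta * t)) =
    (pairing N1 N2 p - pairing N1 N2 p') / (eta * l * (eta * t)).
  rewrite -(sum_pp (fun q => inner (coef q) e0 * (N1 (yr q) - N1 (yl q)) * (N2 (tr q) - N2 (tl q)))) mulr_suml; apply: eq_bigr => i _.
  by field; rewrite !gt_eqF.
by rewrite normrM normfV [X in _ / X]ger0_norm// mulr_ge0// ltW.
Qed.

(** This is the closability of the Wiener integral. Z is defined through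
    approximations p over which there is no control; q are other
    approximations with the same weak limit and with variance at most B. The
    differences I(p n) - I(q n) are bounded in L^2(P) and asymptotically
    orthogonal to every increment of the sheet by [dot_inc_approx], hence to
    every I(p m). Therefore E[Z I(p m)] = lim E[I(q n) I(p m)] <= sqrt B |I(p
    m)|, and m tends to infinity. *)
Lemma variance_lsc (p q : nat -> seq (rect_term l)) (Z : Omega -> R) B :
  0 < t -> 0 < l -> sqi P Z ->
  (forall n, all (rect_in t) (p n)) -> (forall n, all (rect_in t) (q n)) ->
  (fun n => dot P (fun w => scalar_integral (p n) w - Z w)
                  (fun w => scalar_integral (p n) w - Z w)) @ \oo --> (0 : R) ->
  (forall n, dot P (scalar_integral (q n)) (scalar_integral (q n)) <= B) ->
  (forall N1 N2, C1_prim N1 -> C1_prim N2 ->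
     (fun n => pairing N1 N2 (p n) - pairing N1 N2 (q n)) @ \oo --> (0 : R)) ->
  dot P Z Z <= B.
Proof.
move=> t0 l0 sZ rp rq cvZ hB hw.
have [/andP[H10 _] /andP[H20 _]] := (HH1, HH2).
have T0 : 0 < T by move: tT; rewrite in_itv/= => /andP[_]; exact: lt_le_trans.
have sp n := scalar_integral_sqi (rp n).
have sq n := scalar_integral_sqi (rq n).
have B0 : 0 <= B by apply: le_trans (dot_ge0 _ _) (hB 0%N).
pose C := (1 + nrm P Z) + Num.sqrt B.
have C0 : 0 < C by rewrite /C -addrA ltr_wpDr// addr_ge0 ?nrm_ge0 ?sqrtr_ge0.
have Xbnd : \forall n \near \oo,
    nrm P (fun w => scalar_integral (p n) w - scalar_integral (q n) w) <= C.
  near=> n.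
  have h1 : dot P (fun w => scalar_integral (p n) w - Z w)
                  (fun w => scalar_integral (p n) w - Z w) <= 1.
    apply: le_trans (ler_norm _) _; rewrite -[X in `|X|]subr0; near: n.
    by move/cvgrPdistC_le : cvZ; apply.
  apply: le_trans (nrmB (sp n) (sq n)) _; apply: lerD; last by rewrite ler_sqrt.
  have -> : scalar_integral (p n) = (fun w => (scalar_integral (p n) w - Z w) + Z w).
    by apply/funext => w; rewrite subrK.
  apply: le_trans (nrmD (sqiB (sp n) sZ) sZ) _; rewrite lerD2r.
  by rewrite -sqrtr1 ler_sqrt.
have inc0 a b c e : a \in `[0, l] -> b \in `[0, l] -> c \in `[0, t] -> e \in `[0, t] ->
  (fun n => dot P (fun w => scalar_integral (p n) w - scalar_integral (q n) w)
              (sheet_inc a b c e)) @ \oo --> (0 : R).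
  move=> al bl ct et; apply/cvgrPdistC_le => eps eps0.
  have : (fun eta => 4 * C * ((eta * l) `^ H1 * T `^ H2 + l `^ H1 * (eta * T) `^ H2)) x
     @[x --> 0^'+] --> 4 * C * (0 * l `^ H1 * T `^ H2 + l `^ H1 * (0 * T `^ H2)).
    have ev (K z : R) : 0 < K -> 0 <= z -> (eta * z) `^ K @[eta --> 0^'+] --> 0 * z `^ K.
      move=> K0 z0; apply: (@cvg_trans _ (eta `^ K * z `^ K @[eta --> 0^'+])).
        by apply: near_eq_cvg; near=> eta; rewrite powRM.
      by apply: cvgM; [exact: powR_cvg0|exact: cvg_cst].
    apply: cvgM; first exact: cvg_cst.
    apply: cvgD; apply: cvgM; try exact: cvg_cst; try exact: ev.
    - by apply: ev => //; exact: ltW.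
    - by apply: ev => //; exact: ltW.
  rewrite !mul0r mulr0 addr0 mulr0 => /cvgrPdistC_le /(_ _ (divr_gt0 eps0 (ltr0n _ 2))) hev.
  have [eta [eta0 eta1] heta] : exists2 eta : R, (0 < eta /\ eta < 1) &
     4 * C * ((eta * l) `^ H1 * T `^ H2 + l `^ H1 * (eta * T) `^ H2) <= eps / 2.
    have : \forall eta \near (0 : R)^'+, (0 < eta /\ eta < 1) /\
      4 * C * ((eta * l) `^ H1 * T `^ H2 + l `^ H1 * (eta * T) `^ H2) <= eps / 2.
      near=> eta; split.
        by split; near: eta; [exact: nbhs_right_gt|exact: nbhs_right_lt].
      apply: le_trans (ler_norm _) _; rewrite -[X in `|X|]subr0.
      by near: eta; exact: hev.
    by move=> /filter_ex[eta [? ?]]; exists eta.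
  have L0 : 0 < eta * l * (eta * t) by rewrite !mulr_gt0.
  near=> n; rewrite subr0.
  have etaI : 0 < eta < 1 by rewrite eta0 eta1.
  apply: le_trans (@dot_inc_approx _ _ a b c e eta C t0 l0 etaI (rp n) (rq n) al bl ct et _) _.
    by near: n; exact: Xbnd.
  rewrite [leRHS]splitr lerD// ler_pdivrMr//.
  rewrite -[X in `|X|]subr0; near: n.
  have := hw _ _ (shift_prim_C1 (eta * l) ((1 - eta) * a) ((1 - eta) * b) H10)
     (shift_prim_C1 (eta * t) ((1 - eta) * c) ((1 - eta) * e) H20).
  by move/cvgrPdistC_le; apply; rewrite mulr_gt0// divr_gt0.
have cross m : (fun n => dot P (scalar_integral (q n)) (scalar_integral (p m))) @ \oo -->
     dot P Z (scalar_integral (p m)).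
  have h1 := dot_cvg sp sZ (sp m) cvZ.
  have h2 : (fun n => dot P (fun w => scalar_integral (p n) w - scalar_integral (q n) w)
      (scalar_integral (p m))) @ \oo --> (0 : R).
    have -> : (fun n => dot P (fun w => scalar_integral (p n) w - scalar_integral (q n) w)
      (scalar_integral (p m))) = (fun n => \sum_(r <- p m) inner (coef r) e0 *
       dot P (fun w => scalar_integral (p n) w - scalar_integral (q n) w) (term_inc r)).
      apply/funext => n; rewrite dotC scalar_integral_dotl//; last exact: sqiB.
      by apply: eq_bigr => r _; rewrite dotC.
    elim: (p m) (rp m) => [_|r r' ih /= /andP[rr rr']].
      by under eq_fun do rewrite big_nil; exact: cvg_cst.
    pose D (r : rect_term l) n := dot P (fun w => scalar_integral (p n) w - scalar_integral (q n) w) (term_inc r).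
    rewrite (_ : (fun n => _) = (fun n => inner (coef r) e0 * D r n +
       \sum_(j <- r') inner (coef j) e0 * D j n)); last by apply/funext => n; rewrite big_cons.
    rewrite (_ : (0 : R) = inner (coef r) e0 * 0 + 0); last by rewrite mulr0 addr0.
    apply: cvgD; last by rewrite mulr0 addr0; exact: ih.
    apply: cvgM; first exact: cvg_cst.
    move: rr => /and5P[y0 yy yl0 t00 /andP[tt trt]].
    by apply: inc0; rewrite in_itv/=; apply/andP; split; lra.
  have -> : (fun n => dot P (scalar_integral (q n)) (scalar_integral (p m))) =
    (fun n => dot P (scalar_integral (p n)) (scalar_integral (p m)) -
       dot P (fun w => scalar_integral (p n) w - scalar_integral (q n) w)
      (scalar_integral (p m))).
    by apply/funext => n; rewrite dotBl//; ring.
  by rewrite -[X in _ --> X]subr0; apply: cvgB.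
have cs m : dot P Z (scalar_integral (p m)) ^+ 2 <=
    B * dot P (scalar_integral (p m)) (scalar_integral (p m)).
  rewrite expr2; apply: (ler_cvg_to (cvgM (cross m) (cross m)) (cvg_cst _)).
  near=> n => /=; rewrite -expr2; apply: le_trans (cauchy_schwarz (sq n) (sp m)) _.
  by rewrite ler_wpM2r ?dot_ge0.
have lim1 := dot_cvg sp sZ sZ cvZ.
have lim2 := dot_cvg2 sp sZ cvZ.
have fin : dot P Z Z ^+ 2 <= B * dot P Z Z.
  rewrite expr2.
  apply: (ler_cvg_to (cvgM lim1 lim1) (cvgM (cvg_cst B) lim2)).
  by near=> m => /=; rewrite -expr2 dotC; exact: cs.
have := dot_ge0 P Z; rewrite le_eqVlt => /orP[/eqP <-//|Z0].
by move: fin; rewrite expr2 ler_pM2r.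
Unshelve. all: by end_near. Qed.

End scalar_integral.
End sheet.

(** * Measure restriction and the sine eigenfunctions *)

Section restricted_measure.
Import HBNNSimple.
Context d (T : measurableType d) (R : realType) (mu : {measure set T -> \bar R}).
Variables (D : set T) (mD : measurable D).
Local Open Scope ereal_scope.

(** The integral of a nonnegative function is the supremum over the simple
    functions below it, so it is monotone on all functions, measurable or not.
    *)
Lemma ge0_le_integral_nomeas (f g : T -> \bar R) : (forall x, D x -> 0 <= f x) ->
  (forall x, D x -> f x <= g x) -> \int[mu]_(x in D) f x <= \int[mu]_(x in D) g x.
Proof.
move=> f0 fg; rewrite !ge0_integralE//; last by move=> x Dx; exact: le_trans (f0 x Dx) (fg x Dx).
apply: le_ereal_sup => _ [h hf <-]; exists h => // x; apply: le_trans (hf x) _.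
by rewrite /patch; case: ifPn => // /[!inE] /fg.
Qed.

(** Restriction to D and extension by 0 match the simple functions below f
    with those below the restriction of f to D. *)
Lemma ge0_integral_mrestr (f : T -> \bar R) : (forall x, 0 <= f x) ->
  \int[mrestr mu mD]_x f x = \int[mu]_(x in D) f x.
Proof.
move=> f0.
have si (h : {nnsfun T >-> R}) : sintegral (mrestr mu mD) h = sintegral mu (h \_ D).
  rewrite -(integral_nnsfun mu mD).
  have -> : sintegral (mrestr mu mD) h = \int[mrestr mu mD]_x (h x)%:E.
    by rewrite (integral_nnsfun (mrestr mu mD) measurableT) patch_setT.
  have mh : measurable_fun setT (EFin \o h) by apply/measurable_EFinP.
  rewrite (@ge0_negligible_integral _ _ _ (mrestr mu mD) setT (~` D))//.
  - rewrite setDE setCK setTI; apply: eq_measure_integral => A mA AD.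
    by rewrite /= /mrestr setIidl.
  - exact: measurableC.
  - by move=> x _ /=; rewrite lee_fin.
  - by rewrite /= /mrestr setICl measure0.
rewrite ge0_integralTE// [RHS]ge0_integralE//.
apply/eqP; rewrite eq_le; apply/andP; split; apply: le_ereal_sup => _ [h hf <-].
  exists (proj_nnsfun h mD); last by rewrite si mrestrict.
  move=> x; rewrite -mrestrict /patch; case: ifPn => // _; exact: hf.
exists h.
  move=> x; apply: le_trans (hf x) _; rewrite /patch; case: ifPn => // _; exact: f0.
rewrite si; congr sintegral; apply/funext => x; rewrite /patch; case: ifPn => // xD.
have := hf x; rewrite /patch (negbTE xD) lee_fin => hx.
suff -> : h x = 0%R by [].
by apply/eqP; rewrite eq_le hx/=.
Qed.

Lemma integral_mrestr (f : T -> \bar R) :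
  \int[mrestr mu mD]_x f x = \int[mu]_(x in D) f x.
Proof. by rewrite (integralE (mrestr mu mD) setT f) (integralE mu D f) !ge0_integral_mrestr. Qed.

End restricted_measure.

Section bounded.
Context d (T : measurableType d) (R : realType) (mu : {measure set T -> \bar R}).

Lemma bounded_integrableR (D : set T) (f : T -> R) (C : R) : measurable D ->
  (mu D < +oo)%E -> measurable_fun D f -> (forall x, D x -> `|f x| <= C) ->
  mu.-integrable D (EFin \o f).
Proof.
move=> mD muD mf fC; apply: (@le_integrableR _ _ _ mu D mD f (fun=> C)) => //.
apply/integrableP; split; first exact: measurable_cst.
by rewrite /= integral_cst// lte_mul_pinfty// ?lee_fin.
Qed.

Lemma Rintegral_le_cst (D : set T) (f : T -> R) (C : R) : measurable D ->
  (mu D < +oo)%E -> measurable_fun D f -> (forall x, D x -> `|f x| <= C) ->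
  `|\int[mu]_(x in D) f x| <= C * fine (mu D).
Proof.
move=> mD muD mf fC.
have intf := bounded_integrableR mD muD mf fC.
apply: le_trans (le_normr_Rintegral mD intf) _.
rewrite -Rintegral_cst//; apply: le_Rintegral => //.
  exact: integrable_norm.
apply/integrableP; split; first exact: measurable_cst.
by rewrite /= integral_cst// lte_mul_pinfty// ?lee_fin.
Qed.

End bounded.

Lemma lebesgue_itv_lty (R : realType) (a b : R) (b0 b1 : bool) :
  (@lebesgue_measure R [set` Interval (BSide b0 a) (BSide b1 b)] < +oo)%E.
Proof.
rewrite lebesgue_measure_itv/=; case: ifP => _ //=.
by rewrite -EFinB ltry.
Qed.

Section sine.
Context {R : realType}.
Implicit Types x y w : R.

Lemma mvt_const (f : R -> R) (a b : R) :
  (forall x, x \in `]a, b[ -> is_derive x 1 f 0) ->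
  forall x y, x \in `]a, b[ -> y \in `]a, b[ -> f x = f y.
Proof.
move=> hf x y.
wlog xy : x y / x < y.
  move=> h xI yI; have [xy|xy|->//] := ltgtP x y; first exact: h.
  by apply/esym; exact: h.
move=> xI yI.
have sub z : z \in `[x, y] -> z \in `]a, b[.
  move: xI yI; rewrite !in_itv/= => /andP[ax _] /andP[_ yb] /andP[xz zy].
  by rewrite (lt_le_trans ax xz) (le_lt_trans zy yb).
have dd (z : R) : z \in `]x, y[ -> is_derive z 1 f ((fun=> 0) z).
  by move=> zI; apply/hf/sub; move: zI; rewrite !in_itv/= => /andP[? ?]; rewrite !ltW.
have cc : {within `[x, y], continuous f}.
  by apply: derivable_within_continuous => z /sub /hf [].
have [z _ /eqP] := @MVT R f (fun=> 0) x y xy dd cc.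
by rewrite mul0r subr_eq0 => /eqP.
Qed.

Lemma lipschitz_of_derive (f df : R -> R) C : (forall x, is_derive x 1 f (df x)) ->
  (forall x, `|df x| <= C) -> forall x y, `|f x - f y| <= C * `|x - y|.
Proof.
move=> hf hC x y.
wlog xy : x y / y < x.
  move=> h; have [xy|xy|->] := ltgtP y x; first exact: h.
    by rewrite distrC [`|x - y|]distrC; exact: h.
  by rewrite !subrr normr0 mulr0.
have [z _ ->] := @MVT _ f df y x xy (fun z _ => hf z) (derivable_within_continuous (fun z _ => @ex_derive _ _ _ _ _ _ _ (hf z))).
by rewrite normrM ler_wpM2r.
Qed.

Lemma sin_lip x y : `|sin x - sin y| <= `|x - y|.
Proof.
rewrite -[leRHS]mul1r; apply: (@lipschitz_of_derive sin cos) => z.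
exact: cos_max.
Qed.

Lemma cos_lip x y : `|cos x - cos y| <= `|x - y|.
Proof.
rewrite -[leRHS]mul1r; apply: (@lipschitz_of_derive cos (fun x => - sin x)) => z.
by rewrite normrN sin_max.
Qed.

Lemma sin_eq0_nat x : 0 <= x -> sin x = 0 -> exists n : nat, x = n%:R * pi.
Proof.
move=> x0 sx; have p0 := @pi_gt0 R.
pose n := Num.truncn (x / pi); exists n.
have xp0 : 0 <= x / pi by rewrite divr_ge0// ltW.
have [h1 h2] : n%:R * pi <= x /\ x < n.+1%:R * pi.
  split; [rewrite -ler_pdivlMr//|rewrite -ltr_pdivrMr//]; first by rewrite truncn_le.
  by rewrite truncnS_gt.
have := alternatingn (@sinDpi R) n (x - n%:R * pi).
rewrite -[pi *+ n]mulr_natl subrK sx => /esym/eqP; rewrite mulf_eq0 signr_eq0/= => /eqP s0.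
move: h1; rewrite le_eqVlt => /orP[/eqP ->//|h1].
have := @sin_gt0_pi R (x - n%:R * pi); rewrite s0 ltxx subr_gt0 h1/= ltrBlDl.
by rewrite -natr1 mulrDl mul1r in h2; move/(_ h2).
Qed.

Lemma continuous_sin_scale w : continuous (fun x => sin (w * x)).
Proof.
move=> x; apply: (@continuous_comp _ _ _ (fun x => w * x) sin).
  by apply: cvgM; [exact: cvg_cst|exact: cvg_id].
exact: continuous_sin.
Qed.

Lemma integral_sin_sq l w (n : nat) : 0 < l -> 0 < w -> w * l = n%:R * pi ->
  \int[@lebesgue_measure R]_(x in `]0, l[) (sin (w * x) * sin (w * x)) = l / 2.
Proof.
move=> l0 w0 wl.
pose F x := x / 2 - sin (2 * w * x) / (4 * w).
have dF x : is_derive x 1 F (sin (w * x) * sin (w * x)).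
  have h1 : is_derive x 1 (fun x => sin (2 * w * x)) (cos (2 * w * x) * (2 * w)).
    by apply: is_derive_eq; rewrite /GRing.scale/= mulr1.
  have h2 := is_deriveB (is_deriveZ 2^-1 (is_derive_id x 1)) (is_deriveZ (4 * w)^-1 h1).
  have -> : F = 2^-1 \*: id - (4 * w)^-1 \*: (fun x => sin (2 * w * x)).
    by apply/funext => y; rewrite /F [y / 2]mulrC [_ / (4 * w)]mulrC.
  apply: is_derive_eq h2 _; rewrite /GRing.scale/= -!mulrA (mulr_natl _ 2) mulr2n cosD.
  have := cos2Dsin2 (w * x); set cc := cos _; set ss := sin _ => h.
  have -> : cc * cc = 1 - ss * ss by rewrite -!expr2 -h; ring.
  by field; rewrite gt_eqF.
have cf : continuous (fun x => sin (w * x) * sin (w * x)).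
  by move=> x; apply: cvgM; exact: continuous_sin_scale.
have cF : continuous F.
  by move=> x; apply/differentiable_continuous/derivable1_diffP; exact: (@ex_derive _ _ _ _ _ _ _ (dF x)).
have mf : measurable_fun setT (fun x => sin (w * x) * sin (w * x)).
  exact: continuous_measurable_fun.
rewrite /Rintegral integral_itv_bndo_bndc; last exact/measurable_EFinP/measurable_funTS.
rewrite integral_itv_obnd_cbnd; last exact/measurable_EFinP/measurable_funTS.
rewrite (@continuous_FTC2 _ _ F)//.
- rewrite -EFinB/= /F mulr0 sin0 !mul0r subr0 subr0 -mulrA wl.
  have -> : 2 * (n%:R * pi) = 0 + pi *+ (2 * n) :> R by rewrite -[pi *+ _]mulr_natl natrM; ring.
  by rewrite (alternatingn (@sinDpi R)) sin0 mulr0 mul0r subr0.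
- exact: continuous_subspaceT.
- split; first by move=> x _; exact: (@ex_derive _ _ _ _ _ _ _ (dF x)).
  + by apply: cvg_at_right_filter; exact: cF.
  + by apply: cvg_at_left_filter; exact: cF.
- by move=> x _; rewrite derive1E; exact: (@derive_val _ _ _ _ _ _ _ (dF x)).
Qed.

End sine.

Section eigen.
Context {R : realType} (l : R) (hl : 0 < l).
Variables (rho : nat -> R) (e : nat -> L2 l).
Hypothesis hA : dirichlet_eigenbasis rho e.
Implicit Types x y : R.

Lemma inner_restr (v w : L2 l) :
  inner v w = \int[@lebesgue_measure R]_(x in `]0, l[) (v x * w x).
Proof. by rewrite /inner /Rintegral /lebD integral_mrestr. Qed.

(** With w = sqrt (rho k), the functions w f cos (w x) - f' sin (w x) and w f
    sin (w x) + f' cos (w x) have zero derivative. So f is a combination of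
    cos (w x) and sin (w x), and the boundary condition at 0 leaves the sine
    only. *)
Lemma eigen_sine k : exists a : R, forall x, x \in `[0, l] ->
  (e k : R -> R) x = a * sin (Num.sqrt (rho k) * x).
Proof.
set f := (e k : R -> R); set w := Num.sqrt (rho k).
have r0 : 0 < rho k := eigenvalue_gt0 hA k.
have w0 : 0 < w by rewrite sqrtr_gt0.
have ww : w * w = rho k by rewrite -expr2 sqr_sqrtr// ltW.
have df x : x \in `]0, l[ -> is_derive x 1 f (derive1 f x).
  by move=> xI; have [d _] := eigenfunction_derivable hA k xI; rewrite derive1E; exact: derivableP.
have ddf x : x \in `]0, l[ -> is_derive x 1 (derive1 f) (- (rho k * f x)).
  move=> xI; have [_ d] := eigenfunction_derivable hA k xI.
  rewrite -(eigenfunction_eq hA k xI) opprK derive1E; exact: derivableP.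
have dsin x : is_derive x 1 (fun y => sin (w * y)) (w * cos (w * x)).
  by apply: is_derive_eq; rewrite /GRing.scale/= mulr1 mulrC.
have dcos x : is_derive x 1 (fun y => cos (w * y)) (- (w * sin (w * x))).
  by apply: is_derive_eq; rewrite /GRing.scale/= mulr1 mulNr mulrC.
pose G1 x := w * (f x * cos (w * x)) - derive1 f x * sin (w * x).
pose G2 x := w * (f x * sin (w * x)) + derive1 f x * cos (w * x).
have G1c := @mvt_const R G1 0 l.
have G2c := @mvt_const R G2 0 l.
have dG1 x : x \in `]0, l[ -> is_derive x 1 G1 0.
  move=> xI; have := is_deriveB (is_deriveZ w (is_deriveM (df x xI) (dcos x))) (is_deriveM (ddf x xI) (dsin x)).
  move=> h; apply: is_derive_eq h _; rewrite /GRing.scale/= -ww; ring.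
have dG2 x : x \in `]0, l[ -> is_derive x 1 G2 0.
  move=> xI; have := is_deriveD (is_deriveZ w (is_deriveM (df x xI) (dsin x))) (is_deriveM (ddf x xI) (dcos x)).
  move=> h; apply: is_derive_eq h _; rewrite /GRing.scale/= -ww; ring.
have mid : l / 2 \in `]0, l[ by rewrite in_itv/= divr_gt0//= gtr_pMr// invf_lt1// ltr1n.
pose c1 := G1 (l / 2) / w; pose c2 := G2 (l / 2) / w.
have fE x : x \in `]0, l[ -> f x = c1 * cos (w * x) + c2 * sin (w * x).
  move=> xI; rewrite /c1 /c2 (G1c dG1 _ x)// (G2c dG2 _ x)//.
  rewrite /G1 /G2; have := cos2Dsin2 (w * x) => h.
  apply: (mulfI (lt0r_neq0 w0)).
  have -> : w * (f x) = w * f x * (cos (w * x) ^+ 2 + sin (w * x) ^+ 2) by rewrite h mulr1.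
  by field; rewrite gt_eqF.
pose g x := c1 * cos (w * x) + c2 * sin (w * x).
have cg : continuous g.
  have cw (h : R -> R) : continuous h -> continuous (fun x => h (w * x)).
    move=> ch x; apply: (@continuous_comp _ _ _ (fun x => w * x) h); last exact: ch.
    by apply: cvgM; [exact: cvg_cst|exact: cvg_id].
  move=> x; apply: cvgD; apply: cvgM; try exact: cvg_cst; apply: cw.
    exact: continuous_cos.
  exact: continuous_sin.
have [_ f0 fl] := (continuous_within_itvP f hl).1 (@eigenfunction_continuous _ _ _ _ hA k).
have [e0 el] := eigenfunction_boundary hA k.
have g0 : g x @[x --> 0^'+] --> f 0.
  apply: cvg_trans f0; apply: near_eq_cvg; near=> x.
  apply: fE; rewrite in_itv/=; apply/andP; split; near: x;
   [exact: nbhs_right_gt|exact: nbhs_right_lt].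
have g0' : g x @[x --> 0^'+] --> g 0 by apply: cvg_at_right_filter; exact: cg.
have fg0 : g 0 = 0 by have -> : g 0 = f 0 := cvg_unique _ g0' g0.
have gl : g x @[x --> l^'-] --> f l.
  apply: cvg_trans fl; apply: near_eq_cvg; near=> x.
  apply: fE; rewrite in_itv/=; apply/andP; split; near: x;
   [exact: nbhs_left_gt|exact: nbhs_left_lt].
have gl' : g x @[x --> l^'-] --> g l by apply: cvg_at_left_filter; exact: cg.
have fgl : g l = 0 by have -> : g l = f l := cvg_unique _ gl' gl.
have c10 : c1 = 0 by move: fg0; rewrite /g mulr0 cos0 sin0 mulr0 addr0 mulr1.
exists c2 => x; rewrite in_itv/= => /andP[]; rewrite le_eqVlt => /orP[/eqP <- _|x0].
  by rewrite mulr0 sin0 mulr0 /f e0.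
rewrite le_eqVlt => /orP[/eqP ->|xl].
  by rewrite /f el -fgl /g c10 mul0r add0r.
by rewrite fE ?c10 ?mul0r ?add0r// in_itv/= x0.
Unshelve. all: by end_near. Qed.

(** The boundary condition at l gives w_k l = n_k pi for a natural number n_k,
    where w_k = sqrt (rho k). Orthonormality makes n_k injective in k and
    monotonicity of the eigenvalues makes it nondecreasing, so n_k >= k + 1.
    *)
Lemma eigen_explicit : exists a : nat -> R, [/\
  forall k x, x \in `[0, l] -> (e k : R -> R) x = a k * sin (Num.sqrt (rho k) * x),
  forall k, a k ^+ 2 = 2 / l &
  forall k, k.+1%:R * (pi / l) <= Num.sqrt (rho k)].
Proof.
have /choice [a ha] := eigen_sine.
have oo x : x \in `]0, l[ -> x \in `[0, l].
  by rewrite !in_itv/= => /andP[? ?]; rewrite !ltW.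
pose w k := Num.sqrt (rho k).
have w0 k : 0 < w k by rewrite sqrtr_gt0; exact: (eigenvalue_gt0 hA).
have a0 k : a k != 0.
  apply/negP => /eqP ak; have := eigenfunction_orthonormal hA k k.
  rewrite eqxx inner_restr; under eq_Rintegral.
    move=> x; rewrite inE => /oo xI; rewrite !ha// ak !mul0r; over.
  by rewrite /Rintegral integral0/= => /eqP; rewrite eq_sym oner_eq0.
have s0 k : sin (w k * l) = 0.
  have [_ el] := eigenfunction_boundary hA k.
  move: el; rewrite ha ?in_itv/= ?lexx ?(ltW hl)// => /eqP.
  by rewrite mulf_eq0 (negbTE (a0 k)) => /eqP.
have /choice [n hn] : forall k, exists n : nat, w k * l = n%:R * pi.
  by move=> k; apply: sin_eq0_nat => //; rewrite mulr_ge0// ltW.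
have inn j k : w j = w k -> inner (e j) (e k) = a j * a k * (l / 2).
  move=> jk; rewrite inner_restr.
  rewrite -(integral_sin_sq hl (w0 k) (hn k)) -RintegralZl//.
    apply: eq_Rintegral => x; rewrite inE => /oo xI; rewrite !ha// -/(w j) jk -/(w k); ring.
  apply: (@bounded_integrableR _ _ _ _ _ _ 1) => //; first exact: lebesgue_itv_lty.
    apply: measurable_funTS; apply: continuous_measurable_fun => x.
    by apply: cvgM; exact: continuous_sin_scale.
  by move=> x _; rewrite normrM mulr_ile1// sin_max.
have a2 k : a k ^+ 2 = 2 / l.
  have := eigenfunction_orthonormal hA k k; rewrite eqxx inn// => h.
  by apply: (mulIf (x := l / 2)); [rewrite gt_eqF// divr_gt0|rewrite expr2 h mulr1n; field; rewrite gt_eqF].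
exists a; split => //.
have n_inj j k : n j = n k -> j = k.
  move=> njk; apply/eqP; apply: contraT => jk.
  have wjk : w j = w k by apply: (mulIf (lt0r_neq0 hl)); rewrite !hn njk.
  have := eigenfunction_orthonormal hA j k; rewrite (negbTE jk) inn// => /eqP.
  by rewrite !mulf_eq0 (negbTE (a0 j)) (negbTE (a0 k))/= invr_eq0 pnatr_eq0 orbF gt_eqF.
have p0 := @pi_gt0 R.
have n_mono j k : (j <= k)%N -> (n j <= n k)%N.
  move=> jk; rewrite -(ler_nat R) -(ler_pM2r p0) -!hn ler_pM2r// ler_sqrt.
    exact: (eigenvalue_nondecreasing hA).
  by apply/ltW/(eigenvalue_gt0 hA).
have n_ge k : (k.+1 <= n k)%N.
  elim: k => [|k ih].
    by rewrite lt0n; apply/negP => /eqP n0; have := hn 0%N; rewrite n0 mul0r => /eqP; rewrite gt_eqF// mulr_gt0.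
  have := n_mono _ _ (leqnSn k); rewrite leq_eqVlt => /orP[/eqP/n_inj/eqP|].
    by rewrite ltn_eqF.
  exact: leq_ltn_trans.
move=> k; rewrite mulrA ler_pdivrMr// -/(w k) hn ler_pM2r// ler_nat; exact: n_ge.
Qed.

End eigen.

(** * One-dimensional integrals *)

Section improper.
Context {R : realType}.
Local Notation leb := (@lebesgue_measure R).
Implicit Types x y t r a b c p q kap nu : R.

Lemma is_derive_cont (f : R -> R) x df : is_derive x 1 f df -> {for x, continuous f}.
Proof. by move=> [d _]; exact/differentiable_continuous/derivable1_diffP. Qed.

Lemma ftc_tail (f F : R -> R) kap L : (forall x, kap <= x -> 0 <= f x) ->
  (forall x, kap <= x -> {for x, continuous f}) -> F x @[x --> +oo] --> L ->
  (forall x, kap <= x -> is_derive x 1 F (f x)) ->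
  leb.-integrable `[kap, +oo[ (EFin \o f) /\
  \int[leb]_(x in `[kap, +oo[) f x = L - F kap.
Proof.
move=> f0 cf FL dF.
have kap1 : kap <= kap by [].
have cfw : {within `[kap, +oo[, continuous f}.
  by apply: continuous_in_subspaceT => x; rewrite inE/= in_itv/= andbT; exact: cf.
have dF1 x : kap < x -> derivable F x 1 by move=> /ltW /dF [].
have F0 : F x @[x --> kap^'+] --> F kap.
  by apply: cvg_at_right_filter; exact: is_derive_cont (dF _ kap1).
have dF2 : {in `]kap, +oo[, derive1 F =1 f}.
  by move=> x; rewrite in_itv/= andbT => /ltW /dF h; rewrite derive1E; exact: derive_val.
have h := ge0_continuous_FTC2y f0 cfw FL dF1 F0 dF2.
split; last by rewrite /Rintegral h -EFinB.
apply/integrableP; split.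
  by apply/measurable_EFinP; exact: subspace_continuous_measurable_fun.
under eq_integral.
  move=> x; rewrite inE/= in_itv/= andbT => kx.
  rewrite ger0_norm ?f0//; over.
by rewrite /= h -EFinB ltry.
Qed.

Lemma powR_cvg0y p : 0 < p -> x `^ (- p) @[x --> +oo] --> (0 : R).
Proof.
move=> p0; apply/cvgrPdist_le => eps e0; near=> x.
have x0 : 0 < x by near: x; exact: nbhs_pinfty_gt.
rewrite sub0r normrN ger0_norm ?powR_ge0// powRN.
rewrite -[leRHS]invrK lef_pV2 ?posrE ?powR_gt0 ?invr_gt0//.
have -> : eps^-1 = (eps^-1 `^ p^-1) `^ p.
  by rewrite -powRrM mulVf ?gt_eqF// powRr1// invr_ge0 ltW.
rewrite ge0_ler_powR ?nnegrE ?powR_ge0 ?(ltW x0) ?(ltW p0)//.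
Unshelve. all: by end_near. Qed.

Lemma tail_powR p kap : 0 < p -> 0 < kap ->
  leb.-integrable `[kap, +oo[ (EFin \o (fun r => r `^ (- 1 - p))) /\
  \int[leb]_(r in `[kap, +oo[) r `^ (- 1 - p) = kap `^ (- p) / p.
Proof.
move=> p0 k0.
have d x : kap <= x -> is_derive x 1 (fun x => - p^-1 * x `^ (- p)) (x `^ (- 1 - p)).
  move=> kx; have x0 := lt_le_trans k0 kx.
  apply: is_derive_eq; first exact: (@is_deriveZ _ _ _ _ (- p^-1) _ _ _ (@is_derive1_powR _ (- p) x x0)).
  by rewrite /GRing.scale/= mulrA mulrNN mulVf ?gt_eqF// mul1r; congr (_ `^ _); ring.
have [] := @ftc_tail (fun r => r `^ (- 1 - p)) (fun x => - p^-1 * x `^ (- p)) kap (- p^-1 * 0) _ _ _ d.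
- by move=> x _; exact: powR_ge0.
- by move=> x kx; apply: continuous_powR_pos; exact: lt_le_trans k0 kx.
- by apply: cvgM; [exact: cvg_cst|exact: powR_cvg0y].
by move=> hi ->; split => //; rewrite mulr0 sub0r mulNr opprK mulrC.
Qed.

Lemma tail_expR c kap : 0 < c ->
  leb.-integrable `[kap, +oo[ (EFin \o (fun r => expR (- (c * r)))) /\
  \int[leb]_(r in `[kap, +oo[) expR (- (c * r)) = expR (- (c * kap)) / c.
Proof.
move=> c0.
have dl x : is_derive x 1 (fun x => expR (- (c * x))) (- (c * expR (- (c * x)))).
  apply: is_derive_eq; rewrite /GRing.scale/= mulr1 mulrN; congr (- _); ring.
have d x : is_derive x 1 (fun x => - c^-1 * expR (- (c * x))) (expR (- (c * x))).
  apply: is_derive_eq (@is_deriveZ _ _ _ _ (- c^-1) _ _ _ (dl x)) _.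
  by rewrite /GRing.scale/= mulrNN mulrA mulVf ?gt_eqF// mul1r.
have [] := @ftc_tail (fun r => expR (- (c * r))) (fun x => - c^-1 * expR (- (c * x))) kap (- c^-1 * 0) _ _ _ (fun x _ => d x).
- by move=> x _; exact: expR_ge0.
- by move=> x _; exact: is_derive_cont (dl x).
- apply: cvgM; first exact: cvg_cst.
  apply: (@cvg_comp _ _ _ (fun x => c * x) (fun x => expR (- x)) _ (pinfty_nbhs R)); last exact: cvgr_expR.
  by apply: gt0_cvgMry => //; exact: cvg_id.
by move=> hi ->; split => //; rewrite mulr0 sub0r mulNr opprK mulrC.
Qed.

(** The integrand is the derivative of - (rh / al) / (r^al + rh). The bound is
    uniform in rh, and this is what makes the kernels u_k bounded uniformly in
    k. *)
Lemma tail_sigmoid al rh kap : 0 < al -> 0 < rh -> 0 < kap ->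
  leb.-integrable `[kap, +oo[ (EFin \o (fun r => r `^ (al - 1) * rh / (r `^ al + rh) ^+ 2)) /\
  \int[leb]_(r in `[kap, +oo[) (r `^ (al - 1) * rh / (r `^ al + rh) ^+ 2) <= al^-1.
Proof.
move=> al0 rh0 k0.
have pos x : 0 < x `^ al + rh by rewrite ltr_wpDl ?powR_ge0.
have dpow x : kap <= x -> is_derive x 1 (fun x => x `^ al + rh) (al * x `^ (al - 1)).
  move=> kx; have x0 := lt_le_trans k0 kx.
  apply: is_derive_eq; first exact: (is_deriveD (@is_derive1_powR _ al x x0) (is_derive_cst rh x 1)).
  by rewrite addr0.
have dV x : kap <= x -> is_derive x 1 (fun x => (x `^ al + rh)^-1) (- (x `^ al + rh) ^- 2 * (al * x `^ (al - 1))).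
  by move=> kx; apply: is_deriveV; [rewrite gt_eqF|exact: dpow].
have d x : kap <= x -> is_derive x 1 (fun x => - (rh / al) * (x `^ al + rh)^-1)
   (x `^ (al - 1) * rh / (x `^ al + rh) ^+ 2).
  move=> kx; apply: is_derive_eq (@is_deriveZ _ _ _ _ (- (rh / al)) _ _ _ (dV x kx)) _.
  rewrite /GRing.scale/=; field; rewrite !gt_eqF//.
have [] := @ftc_tail (fun r => r `^ (al - 1) * rh / (r `^ al + rh) ^+ 2)
    (fun x => - (rh / al) * (x `^ al + rh)^-1) kap (- (rh / al) * 0) _ _ _ d.
- by move=> x _; rewrite !mulr_ge0 ?invr_ge0 ?sqr_ge0 ?powR_ge0// ltW.
- move=> x kx; have x0 := lt_le_trans k0 kx.
  apply: cvgM; first by apply: cvgM; [exact: continuous_powR_pos|exact: cvg_cst].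
  apply: cvgV; first by rewrite sqrf_eq0 gt_eqF.
  have c1 : (fun x => x `^ al + rh) @ x --> x `^ al + rh.
    by apply: cvgD; [exact: continuous_powR_pos|exact: cvg_cst].
  by apply: (cvgM c1 c1).
- apply: cvgM; first exact: cvg_cst.
  apply/cvgrPdist_le => eps e0.
  have /cvgrPdist_le/(_ _ e0) hlim := powR_cvg0y al0.
  near=> x.
  have x0 : 0 < x by near: x; exact: nbhs_pinfty_gt.
  rewrite sub0r normrN ger0_norm ?invr_ge0 ?(ltW (pos x))//.
  apply: (@le_trans _ _ (x `^ (- al))).
    by rewrite powRN lef_pV2 ?posrE ?powR_gt0// lerDl ltW.
  rewrite -[leLHS]ger0_norm ?powR_ge0// -normrN -sub0r.
  by near: x; exact: hlim.
move=> hi ->; split => //; rewrite mulr0 sub0r mulNr opprK.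
rewrite -[leRHS]mul1r mulrAC ler_wpM2r ?invr_ge0 ?(ltW al0)//.
by rewrite ler_pdivrMr// mul1r lerDr powR_ge0.
Unshelve. all: by end_near. Qed.

(** Monotone limit of the integrals over ]0, t - 1/n]. *)
Lemma singular_powR nu t : 0 <= nu < 1 -> 0 < t ->
  leb.-integrable `]0, t[ (EFin \o (fun r => (t - r) `^ (- nu))) /\
  \int[leb]_(r in `]0, t[) (t - r) `^ (- nu) <= t `^ (1 - nu) / (1 - nu).
Proof.
move=> /andP[nu0 nu1] t0; set K := t `^ (1 - nu) / (1 - nu).
have nu1' : 0 < 1 - nu by rewrite subr_gt0.
pose f r := (t - r) `^ (- nu).
have mf : measurable_fun setT f.
  by apply: (measurableT_comp (measurable_powR _)); exact: measurable_funB.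
pose F n := `]0, (t - n.+1%:R^-1)]%classic.
have sub n r : F n r -> 0 < r /\ r < t.
  rewrite /F /= in_itv/= => /andP[r0 rt]; split => //; apply: le_lt_trans rt _.
  by rewrite ltrBlDr ltrDl invr_gt0.
have bnd n : (\int[leb]_(r in F n) (f r)%:E <= K%:E)%E.
  have [a0|a0] := leP (t - n.+1%:R^-1) 0.
    rewrite /F set_itv_ge ?integral_set0 ?lee_fin ?divr_ge0 ?powR_ge0 ?(ltW nu1')//.
    by rewrite bnd_simp -leNgt.
  set b := t - n.+1%:R^-1.
  have bt : b < t by rewrite /b ltrBlDr ltrDl invr_gt0.
  have d x : x <= b -> is_derive x 1 (fun x => - (1 - nu)^-1 * (t - x) `^ (1 - nu)) (f x).
    move=> xb; have x0 : 0 < t - x by rewrite subr_gt0 (le_lt_trans xb).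
    have dd : is_derive x 1 (fun x => (t - x) `^ (1 - nu)) (- ((1 - nu) * (t - x) `^ (- nu))).
      have h0 : is_derive x 1 (fun x => t - x) (-1) by apply: is_derive_eq; rewrite ?add0r ?sub0r ?mulrN1 ?mul1r.
      have := @is_derive1_comp _ (fun y => y `^ (1 - nu)) (fun x => t - x) x _ _ (@is_derive1_powR _ (1 - nu) (t - x) x0) h0.
      move=> h; apply: is_derive_eq h _; rewrite mulrN1; congr (- (_ * _ `^ _)); ring.
    apply: is_derive_eq (@is_deriveZ _ _ _ _ (- (1 - nu)^-1) _ _ _ dd) _.
    by rewrite /GRing.scale/= mulrNN mulrA mulVf ?gt_eqF// mul1r.
  rewrite /F integral_itv_obnd_cbnd; last exact/measurable_EFinP/measurable_funTS.
  rewrite (@continuous_FTC2 _ _ (fun x => - (1 - nu)^-1 * (t - x) `^ (1 - nu)))//.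
  - rewrite -EFinB lee_fin subr0 -/b !mulNr opprK /K addrC [leRHS]mulrC gerBl.
    by rewrite mulr_ge0 ?powR_ge0// invr_ge0 ltW.
  - apply: continuous_in_subspaceT => x; rewrite inE/= in_itv/= => /andP[_ xb].
    have x0 : 0 < t - x by rewrite subr_gt0 (le_lt_trans xb).
    apply: (@continuous_comp _ _ _ (fun x => t - x) (fun y => y `^ (- nu))).
      by apply: cvgB; [exact: cvg_cst|exact: cvg_id].
    exact: continuous_powR_pos.
  - split.
    + by move=> x; rewrite in_itv/= => /andP[_ /ltW /d []].
    + by apply: cvg_at_right_filter; apply: is_derive_cont (d _ (ltW a0)).
    + by apply: cvg_at_left_filter; apply: is_derive_cont (d _ (lexx b)).
  - by move=> x; rewrite in_itv/= => /andP[_ /ltW /d h]; rewrite derive1E; exact: derive_val.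
have cup : \bigcup_n F n = `]0, t[%classic.
  apply/seteqP; split => [r [n _ /sub[r0 rt]]|r /=]; first by rewrite /= in_itv/= r0.
  rewrite in_itv/= => /andP[r0 rt].
  have tr0 : 0 < t - r by rewrite subr_gt0.
  exists (Num.truncn (t - r)^-1) => //; rewrite /F /= in_itv/= r0/= lerBrDl -lerBrDr.
  rewrite -[leRHS]invrK lef_pV2 ?posrE ?invr_gt0//.
  by rewrite ltW// truncnS_gt.
have cvg : (\int[leb]_(r in F n) (f r)%:E @[n --> \oo] --> \int[leb]_(r in `]0%R, t[) (f r)%:E)%E.
  rewrite -cup; apply: ge0_nondecreasing_set_cvg_integral => //.
  - move=> m n mn; apply/subsetPset => r; rewrite /F /= !in_itv/= => /andP[-> /= h].
    by apply: le_trans h _; rewrite lerD2l lerN2 lef_pV2 ?posrE// ler_nat.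
  - by move=> n; rewrite /F.
  - by move=> n; exact/measurable_EFinP/measurable_funTS.
  - by move=> n x _; rewrite lee_fin powR_ge0.
have le : (\int[leb]_(r in `]0%R, t[) (f r)%:E <= K%:E)%E.
  by apply: (cvge_to_le cvg); near=> n; exact: bnd.
have int : leb.-integrable `]0, t[ (EFin \o f).
  apply/integrableP; split; first exact/measurable_EFinP/measurable_funTS.
  under eq_integral do rewrite /= ger0_norm ?powR_ge0//.
  by apply: le_lt_trans le _; rewrite ltry.
split => //; rewrite -lee_fin /Rintegral fineK//.
exact: (integrable_fin_num _ int).
Unshelve. all: by end_near. Qed.

Lemma expR_le_powR x nu : 0 <= nu <= 1 -> 0 < x -> expR (- x) <= x `^ (- nu).
Proof.
move=> /andP[nu0 nu1] x0; rewrite expRN powRN lef_pV2 ?posrE ?expR_gt0 ?powR_gt0//.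
apply: le_trans (expR_ge1Dx x).
have [x1|x1] := leP 1 x.
  by apply: le_trans (ler1_powR x1 nu1) _; rewrite lerDr.
apply: (@le_trans _ _ 1); last by rewrite lerDl ltW.
have <- : (1 : R) `^ nu = 1 by rewrite powR1.
rewrite ge0_ler_powR ?nnegrE ?(ltW x0)//; exact: ltW.
Qed.

End improper.

(** * The symbol on the contour *)

Section polar_form.
Context {R : realType}.
Implicit Types r a b : R.

Lemma powRD_gt0 r a b : 0 < r -> r `^ (a + b) = r `^ a * r `^ b.
Proof. by move=> r0; have rn := lt0r_neq0 r0; rewrite powRD// rn implybT. Qed.

Lemma polarM r a r' b : polar r a * polar r' b = polar (r * r') (a + b).
Proof. by rewrite /polar cosD sinD; congr Complex; ring. Qed.

Lemma cmod_polar r a : 0 <= r -> cmod (polar r a) = r.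
Proof.
move=> r0; rewrite /cmod /= !exprMn -mulrDr cos2Dsin2 mulr1.
by rewrite sqrtr_sqr ger0_norm.
Qed.

Lemma carg_polar r a : 0 < r -> - pi < a <= pi -> carg (polar r a) = a.
Proof.
move=> r0 /andP[a1 a2]; rewrite /carg cmod_polar ?(ltW r0)//=.
have -> : r * cos a / r = cos a by rewrite mulrC mulKf ?gt_eqF.
have [a0|a0] := leP 0 a.
  rewrite mulr_ge0 ?(ltW r0)//; last by rewrite sin_ge0_pi// a0.
  by rewrite cosK// in_itv/= a0.
have : sin a < 0.
  by rewrite -oppr_gt0 -sinN sin_gt0_pi// oppr_gt0 a0/= ltrNl.
move=> sa; rewrite ifF; last by apply/negbTE; rewrite -ltNge pmulr_rlt0.
by rewrite cosKN ?opprK// (ltW a0) ltW.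
Qed.

Lemma cpow_polar r a p : 0 < r -> - pi < a <= pi ->
  cpow (polar r a) p = polar (r `^ p) (p * a).
Proof. by move=> r0 aI; rewrite /cpow cmod_polar ?(ltW r0)// carg_polar. Qed.

(** The factor 1 / (2 i pi) selects the imaginary part of the contour
    integral. *)
Lemma Re_inverse_laplace kap th (q : R[i] -> R[i]) t (phi := pi - th)
  (f := fun z : R[i] => cexp (Complex (complex.Re z * t) (complex.Im z * t)) * q z) :
  complex.Re (inverse_laplace kap th q t) = (2 * pi)^-1 *
   (- (\int[@lebesgue_measure R]_(r in `[kap, +oo[) complex.Im (f (polar r (- phi)) * polar 1 (- phi)))
    + \int[@lebesgue_measure R]_(psi in `[- phi, phi])
        complex.Im (f (polar kap psi) * (Complex 0 1 * polar kap psi))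
    + \int[@lebesgue_measure R]_(r in `[kap, +oo[) complex.Im (f (polar r phi) * polar 1 phi)).
Proof.
rewrite /inverse_laplace /contour_integral /cintegral -/phi -/(f _).
rewrite /= !expr0n/= add0r !mul0r sub0r mulNr opprK.
have p0 : (2 * pi : R) != 0 by rewrite gt_eqF// mulr_gt0// pi_gt0.
by rewrite expr2 invfM mulrA mulfV// mul1r.
Qed.

End polar_form.

Section oscillation.
Context {R : realType}.
Implicit Types a b A B M E x y : R.

Lemma expR_lip E u v : expR u <= E -> expR v <= E -> `|expR u - expR v| <= E * `|u - v|.
Proof.
wlog uv : u v / v <= u.
  move=> h uE vE; have [uv|/ltW uv] := leP v u; first exact: h.
  by rewrite distrC [`|u - v|]distrC; exact: h.
move=> uE _; rewrite !ger0_norm ?subr_ge0 ?ler_expR//.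
apply: (@le_trans _ _ (expR u * (u - v))); last by rewrite ler_wpM2r// subr_ge0.
have -> : expR v = expR u * expR (v - u) by rewrite -expRD addrC subrK.
have := expR_ge1Dx (v - u); have := expR_gt0 u; nra.
Qed.

(** At each point of the contour the inversion integrand has this form as a
    function of the time x: a + i b is the point z, and A, B come from the
    real and imaginary parts of the amplitude. *)
Definition osc a b A B x : R := expR (a * x) * (cos (b * x) * A + sin (b * x) * B).

Lemma osc_bound a b A B M E x : `|A| <= M -> `|B| <= M -> expR (a * x) <= E ->
  `|osc a b A B x| <= 2 * M * E.
Proof.
move=> AM BM hE; rewrite /osc normrM ger0_norm ?expR_ge0// mulrC.
have M0 : 0 <= M by exact: le_trans AM.
rewrite ler_pM ?expR_ge0//.
apply: le_trans (ler_normD _ _) _; rewrite !normrM mulr_natl mulr2n.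
have c1 := cos_max (b * x); have s1 := sin_max (b * x).
by apply: lerD; rewrite -[leRHS]mul1r ler_pM.
Qed.

Lemma osc_lip a b A B M E x y : `|A| <= M -> `|B| <= M ->
  expR (a * x) <= E -> expR (a * y) <= E ->
  `|osc a b A B x - osc a b A B y| <= 2 * M * E * (`|a| + `|b|) * `|x - y|.
Proof.
move=> AM BM hx hy.
have M0 : 0 <= M by exact: le_trans AM.
have E0 : 0 <= E by apply: le_trans hx; exact: expR_ge0.
pose Tr x := cos (b * x) * A + sin (b * x) * B.
have -> : osc a b A B x - osc a b A B y =
   expR (a * x) * (Tr x - Tr y) + (expR (a * x) - expR (a * y)) * Tr y.
  by rewrite /osc -/(Tr x) -/(Tr y); ring.
have TM : `|Tr y| <= 2 * M.
  apply: le_trans (ler_normD _ _) _; rewrite !normrM mulr_natl mulr2n.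
  have c1 := cos_max (b * y); have s1 := sin_max (b * y).
  by apply: lerD; rewrite -[leRHS]mul1r ler_pM.
have Tl : `|Tr x - Tr y| <= 2 * M * (`|b| * `|x - y|).
  have -> : Tr x - Tr y = (cos (b * x) - cos (b * y)) * A + (sin (b * x) - sin (b * y)) * B.
    by rewrite /Tr; ring.
  apply: le_trans (ler_normD _ _) _; rewrite !normrM -mulrA mulr_natl mulr2n.
  have c1 := cos_lip (b * x) (b * y); have s1 := sin_lip (b * x) (b * y).
  rewrite -mulrBr normrM in c1 s1.
  by apply: lerD; rewrite mulrC ler_pM.
apply: le_trans (ler_normD _ _) _; rewrite !normrM ger0_norm ?expR_ge0//.
have -> : 2 * M * E * (`|a| + `|b|) * `|x - y| =
  E * (2 * M * (`|b| * `|x - y|)) + (E * (`|a| * `|x - y|)) * (2 * M) by ring.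
have el := expR_lip hx hy; rewrite -mulrBr normrM in el.
by apply: lerD; rewrite ler_pM ?expR_ge0.
Qed.

End oscillation.

Section symbol_bounds.
Context {R : realType}.
Variables (al be mu la rs : R).
Hypotheses (hbe : 0 < be) (hbeal : be <= al) (hal : al < 1)
  (hmu : 0 < mu) (hla : 0 <= la) (hrs : 0 < rs).
Implicit Types r psi x y m nu kap phi : R.

(** The real and imaginary parts of h(z) + rs at z = r e^(i psi), where rs
    stands for rho^s. *)
Definition den_re r psi :=
  mu^-1 * (r `^ al * cos (al * psi) + la * r `^ (al - be) * cos ((al - be) * psi)) + rs.
Definition den_im r psi :=
  mu^-1 * (r `^ al * sin (al * psi) + la * r `^ (al - be) * sin ((al - be) * psi)).
Definition den_sq r psi := den_re r psi ^+ 2 + den_im r psi ^+ 2.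

(** The real and imaginary parts of e^(i al psi) / (h(z) + rs). *)
Definition res_re r psi :=
  (cos (al * psi) * den_re r psi + sin (al * psi) * den_im r psi) / den_sq r psi.
Definition res_im r psi :=
  (sin (al * psi) * den_re r psi - cos (al * psi) * den_im r psi) / den_sq r psi.

Definition amp r := mu^-1 * r `^ (al - 1).

Definition ray_osc psi x r :=
  osc (r * cos psi) (r * sin psi) (amp r * res_im r psi) (amp r * res_re r psi) x.
Definition arc_osc kap x psi :=
  osc (kap * cos psi) (kap * sin psi) (amp kap * kap * res_re kap psi)
    (- (amp kap * kap * res_im kap psi)) x.

Lemma symbol_polar r psi : 0 < r -> - pi < psi <= pi ->
  symbol al be mu la (polar r psi) + Complex rs 0 = Complex (den_re r psi) (den_im r psi).
Proof.
move=> r0 hpsi; rewrite /symbol !cpow_polar//.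
have -> : Complex mu^-1 0 * polar (r `^ al) (al * psi) *
    (1 + Complex la 0 * polar (r `^ (- be)) (- be * psi)) =
  Complex mu^-1 0 * (polar (r `^ al) (al * psi) +
    Complex la 0 * (polar (r `^ al) (al * psi) * polar (r `^ (- be)) (- be * psi))) by ring.
rewrite polarM -powRD_gt0//.
rewrite -mulrDl /den_re /den_im /polar.
by congr Complex; rewrite /=; ring.
Qed.

Lemma Im_ray_integrand (v x r psi : R) (q : R[i]) : 0 < r -> - pi < psi <= pi ->
  q = Complex v 0 * (symbol al be mu la (polar r psi) + Complex rs 0)^-1 ->
  complex.Im (cexp (Complex (complex.Re (polar r psi) * x) (complex.Im (polar r psi) * x)) *
    (Complex mu^-1 0 * cpow (polar r psi) (al - 1) * q) * polar 1 psi) = v * ray_osc psi x r.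
Proof.
move=> r0 hpsi ->; rewrite symbol_polar// cpow_polar//.
set D := (Complex _ _)^-1.
have -> : cexp (Complex (complex.Re (polar r psi) * x) (complex.Im (polar r psi) * x)) *
    (Complex mu^-1 0 * polar (r `^ (al - 1)) ((al - 1) * psi) * (Complex v 0 * D)) * polar 1 psi =
  Complex (v * mu^-1) 0 * cexp (Complex (complex.Re (polar r psi) * x) (complex.Im (polar r psi) * x))
   * (polar (r `^ (al - 1)) ((al - 1) * psi) * polar 1 psi) * D.
  have -> : Complex (v * mu^-1) 0 = Complex v 0 * Complex mu^-1 0.
    by congr Complex; rewrite /=; ring.
  by ring.
rewrite polarM mulr1 (_ : (al - 1) * psi + psi = al * psi); last by ring.
rewrite /D /cexp /polar /= /ray_osc /osc /res_im /res_re /amp -/(den_sq r psi).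
have -> : r * cos psi * x = r * x * cos psi by ring.
by ring.
Qed.

Lemma Im_arc_integrand (v x kap psi : R) (q : R[i]) : 0 < kap -> - pi < psi <= pi ->
  q = Complex v 0 * (symbol al be mu la (polar kap psi) + Complex rs 0)^-1 ->
  complex.Im (cexp (Complex (complex.Re (polar kap psi) * x) (complex.Im (polar kap psi) * x)) *
    (Complex mu^-1 0 * cpow (polar kap psi) (al - 1) * q) * (Complex 0 1 * polar kap psi))
   = v * arc_osc kap x psi.
Proof.
move=> r0 hpsi ->; rewrite symbol_polar// cpow_polar//.
set D := (Complex _ _)^-1.
have -> : cexp (Complex (complex.Re (polar kap psi) * x) (complex.Im (polar kap psi) * x)) *
    (Complex mu^-1 0 * polar (kap `^ (al - 1)) ((al - 1) * psi) * (Complex v 0 * D)) *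
     (Complex 0 1 * polar kap psi) =
  Complex (v * mu^-1) 0 * cexp (Complex (complex.Re (polar kap psi) * x) (complex.Im (polar kap psi) * x))
   * (polar (kap `^ (al - 1)) ((al - 1) * psi) * polar kap psi) * (Complex 0 1 * D).
  have -> : Complex (v * mu^-1) 0 = Complex v 0 * Complex mu^-1 0.
    by congr Complex; rewrite /=; ring.
  by ring.
rewrite polarM (_ : (al - 1) * psi + psi = al * psi); last by ring.
rewrite /D /cexp /polar /= /arc_osc /osc /res_im /res_re /amp -/(den_sq kap psi).
by ring.
Qed.

Section bounds.
Variable phi : R.
Hypotheses (hphi : 0 < phi < pi).

Let c0 := cos (al * phi / 2).
Let c1 := Num.min mu^-1 1.
Let K := (c0 * c1)^-1.

Lemma half_angle_gt0 : 0 < c0.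
Proof.
have [p0 p1] := andP hphi.
have al0 : 0 < al := lt_le_trans hbe hbeal.
apply: cos_gt0_pihalf; apply/andP; split; last first.
  rewrite ltr_pM2r ?invr_gt0//; apply: le_lt_trans p1.
  by rewrite ler_piMl// ltW.
apply: (@lt_trans _ _ 0); first by rewrite oppr_lt0 divr_gt0// pi_gt0.
by rewrite divr_gt0// mulr_gt0.
Qed.

Lemma sector_const_gt0 : 0 < K.
Proof. by rewrite invr_gt0 mulr_gt0 ?half_angle_gt0// lt_min invr_gt0 hmu ltr01. Qed.

(** All three terms z^al, z^(al - be) and rs have arguments between 0 and al
    psi. The projection on the bisector of this angle keeps at least the
    fraction cos (al phi / 2) of each modulus. *)
Lemma den_lower r psi : `|psi| <= phi ->
  c0 * (mu^-1 * r `^ al + mu^-1 * (la * r `^ (al - be)) + rs) <= Num.sqrt (den_sq r psi).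
Proof.
move=> hpsi; have c0p := half_angle_gt0.
have al0 : 0 < al := lt_le_trans hbe hbeal.
have mu0 : 0 < mu^-1 by rewrite invr_gt0.
have [p0 p1] := andP hphi.
have cosge a : `|a| <= al * phi / 2 -> c0 <= cos a.
  move=> ha.
  have -> : cos a = cos `|a| by have [a0|a0] := lerP 0 a; rewrite ?(ger0_norm a0)// (ltr0_norm a0) cosN.
  have b0 : 0 <= al * phi / 2 by rewrite divr_ge0// mulr_ge0// ltW.
  have bd : al * phi / 2 <= pi.
    have := ler_piMl (ltW p0) (ltW hal); have := p1; set y := al * phi; lra.
  by rewrite /c0 leNgt ltr_cos ?in_itv/= ?normr_ge0 ?(le_trans ha bd) ?b0 ?bd// -leNgt.
have npsi : `|al * psi / 2| <= al * phi / 2.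
  by rewrite !normrM (ger0_norm (ltW al0)) [X in _ * X]ger0_norm ?invr_ge0// ler_wpM2r ?invr_ge0// ler_wpM2l ?(ltW al0).
have npsi2 : `|(al - be) * psi - al * psi / 2| <= al * phi / 2.
  have -> : (al - be) * psi - al * psi / 2 = (al / 2 - be) * psi by field.
  rewrite normrM [al * phi / 2]mulrAC ler_pM// ler_norml.
  have := splitr al; move: hbe hbeal; set y := al / 2 => q1 q2 q3.
  by apply/andP; split; lra.
apply: (@le_trans _ _ (den_re r psi * cos (al * psi / 2) + den_im r psi * sin (al * psi / 2))).
  have -> : den_re r psi * cos (al * psi / 2) + den_im r psi * sin (al * psi / 2) =
    mu^-1 * r `^ al * cos (al * psi - al * psi / 2)
    + mu^-1 * (la * r `^ (al - be)) * cos ((al - be) * psi - al * psi / 2)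
    + rs * cos (al * psi / 2).
    by rewrite !cosB /den_re /den_im; ring.
  rewrite mulrC 2!(mulrDl _ _ c0); apply: lerD; first apply: lerD.
  - rewrite ler_wpM2l ?mulr_ge0 ?powR_ge0 ?(ltW mu0)// (_ : _ - _ = al * psi / 2) ?cosge//.
    by field.
  - by rewrite ler_wpM2l ?mulr_ge0 ?powR_ge0 ?(ltW mu0)// cosge.
  - by rewrite ler_wpM2l ?(ltW hrs)// cosge.
apply: le_trans (ler_norm _) _; rewrite -sqrtr_sqr ler_sqrt ?addr_ge0 ?sqr_ge0//.
have := cos2Dsin2 (al * psi / 2); set c := cos _; set s := sin _ => cs.
have -> : den_sq r psi = den_sq r psi * (c ^+ 2 + s ^+ 2) by rewrite cs mulr1.
have := sqr_ge0 (den_re r psi * s - den_im r psi * c).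
by rewrite /den_sq; nra.
Qed.

Lemma den_sq_ge r psi : `|psi| <= phi -> ((r `^ al + rs) / K) ^+ 2 <= den_sq r psi.
Proof.
move=> hpsi; have := den_lower r hpsi.
have c0p := half_angle_gt0.
have mu0 : 0 < mu^-1 by rewrite invr_gt0.
have d0 : 0 <= den_sq r psi by rewrite addr_ge0 ?sqr_ge0.
have a0 := powR_ge0 r al.
move=> h; rewrite -[leRHS]sqr_sqrtr// ler_sqr ?nnegrE ?sqrtr_ge0//; last first.
  by rewrite divr_ge0 ?addr_ge0 ?(ltW hrs)// ltW// sector_const_gt0.
apply: le_trans h; rewrite /K invrK mulrC -mulrA ler_wpM2l ?(ltW c0p)// mulrDr.
have b0 : 0 <= mu^-1 * (la * r `^ (al - be)) by rewrite !mulr_ge0 ?powR_ge0// ltW.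
have m1 : c1 <= mu^-1 by rewrite /c1 ge_min lexx.
have m2 : c1 <= 1 by rewrite /c1 ge_min lexx orbT.
have := ler_wpM2r a0 m1; have := ler_wpM2r (ltW hrs) m2; rewrite mul1r; lra.
Qed.

Lemma den_sq_gt0 r psi : `|psi| <= phi -> 0 < den_sq r psi.
Proof.
move=> hpsi; apply: lt_le_trans (den_sq_ge r hpsi).
by rewrite exprn_gt0// divr_gt0 ?sector_const_gt0// ltr_wpDl ?powR_ge0.
Qed.

Lemma res_bound r psi : `|psi| <= phi ->
  `|res_re r psi| <= K / (r `^ al + rs) /\ `|res_im r psi| <= K / (r `^ al + rs).
Proof.
move=> hpsi; have d0 := den_sq_gt0 r hpsi; have dge := den_sq_ge r hpsi.
have K0 := sector_const_gt0.
have S0 : 0 < r `^ al + rs by rewrite ltr_wpDl ?powR_ge0.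
have h (z : R) : z ^+ 2 <= den_sq r psi -> `|z / den_sq r psi| <= K / (r `^ al + rs).
  move=> zd; rewrite -(@ler_pXn2r _ 2) ?nnegrE ?normr_ge0 ?divr_ge0 ?(ltW K0) ?(ltW S0)//.
  rewrite real_normK ?num_real// exprMn.
  apply: (@le_trans _ _ (den_sq r psi)^-1).
    by rewrite exprVn ler_pdivrMr ?exprn_gt0// mulrC expr2 mulfK ?gt_eqF.
  rewrite -[leRHS]invrK lef_pV2 ?posrE ?invr_gt0 ?exprn_gt0 ?divr_gt0//.
  by rewrite -exprVn invf_div.
have := cos2Dsin2 (al * psi); rewrite /res_re /res_im; set c := cos _; set s := sin _ => cs.
split; apply: h; have -> : den_sq r psi = den_sq r psi * (c ^+ 2 + s ^+ 2) by rewrite cs mulr1.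
  by have := sqr_ge0 (den_re r psi * s - den_im r psi * c); rewrite /den_sq; nra.
by have := sqr_ge0 (den_re r psi * c + den_im r psi * s); rewrite /den_sq; nra.
Qed.

(** The powers r^al cancel in the imaginary part, which gains a factor (rs +
    r^(al - be)) / (r^al + rs) over [res_bound]. *)
Lemma res_im_bound r psi : `|psi| <= phi ->
  `|res_im r psi| <= K ^+ 2 * (rs + mu^-1 * la * r `^ (al - be)) / (r `^ al + rs) ^+ 2.
Proof.
move=> hpsi; have d0 := den_sq_gt0 r hpsi; have dge := den_sq_ge r hpsi.
have K0 := sector_const_gt0.
have mu0 : 0 < mu^-1 by rewrite invr_gt0.
have S0 : 0 < r `^ al + rs by rewrite ltr_wpDl ?powR_ge0.
have -> : res_im r psi = (rs * sin (al * psi) + mu^-1 * la * r `^ (al - be) * sin (be * psi)) / den_sq r psi.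
  congr (_ / _); rewrite /den_re /den_im.
  have -> : be * psi = al * psi - (al - be) * psi by ring.
  by rewrite sinB; ring.
rewrite normrM [X in _ * X]ger0_norm ?invr_ge0 ?(ltW d0)//.
have N0 : 0 <= mu^-1 * la * r `^ (al - be) by rewrite !mulr_ge0 ?powR_ge0// ltW.
apply: (@le_trans _ _ ((rs + mu^-1 * la * r `^ (al - be)) / den_sq r psi)).
  rewrite ler_wpM2r ?invr_ge0 ?(ltW d0)//.
  apply: le_trans (ler_normD _ _) _; rewrite !normrM (ger0_norm (ltW hrs)).
  rewrite -!normrM normrM (ger0_norm N0).
  by apply: lerD; rewrite ler_piMr ?sin_max// ltW.
rewrite (mulrC (K ^+ 2)) -[leRHS]mulrA ler_wpM2l ?addr_ge0 ?(ltW hrs)//.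
rewrite -[leRHS]invrK lef_pV2 ?posrE ?invr_gt0 ?divr_gt0 ?exprn_gt0//.
- by rewrite invf_div -expr_div_n.
- by rewrite -invr_gt0.
Qed.

(** Because a + b = (a + b)^(1 - m) (a + b)^m. *)
Lemma sum_ge_geometric m a b : 0 <= m <= 1 -> 0 < a -> 0 < b ->
  (a + b)^-1 <= a `^ (m - 1) * b `^ (- m).
Proof.
move=> /andP[m0 m1] a0 b0.
rewrite -(opprB 1 m) !powRN -invfM lef_pV2 ?posrE ?mulr_gt0 ?powR_gt0 ?addr_gt0//.
have -> : a + b = (a + b) `^ (1 - m) * (a + b) `^ m.
  rewrite -powRD_gt0 ?addr_gt0//.
  by rewrite subrK powRr1// ltW// addr_gt0.
have ab : 0 <= a + b by rewrite addr_ge0 ?ltW.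
by rewrite ler_pM ?powR_ge0// ge0_ler_powR ?nnegrE ?subr_ge0 ?(ltW a0) ?(ltW b0) ?lerDl ?lerDr ?(ltW a0) ?(ltW b0).
Qed.

(** Interpolation between the bounds 1 / r (for m = 0) and r^(al - 1) / rs
    (for m = 1). *)
Lemma amp_res_bound r psi m : 0 <= m <= 1 -> 0 < r -> `|psi| <= phi ->
  `|amp r * res_re r psi| <= mu^-1 * K * rs `^ (- m) * r `^ (al * m - 1) /\
  `|amp r * res_im r psi| <= mu^-1 * K * rs `^ (- m) * r `^ (al * m - 1).
Proof.
move=> hm r0 hpsi; have [h1 h2] := res_bound r hpsi.
have K0 := sector_const_gt0.
have mu0 : 0 < mu^-1 by rewrite invr_gt0.
have a0 : 0 <= amp r by rewrite mulr_ge0 ?powR_ge0 ?(ltW mu0).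
have h : amp r * (K / (r `^ al + rs)) <= mu^-1 * K * rs `^ (- m) * r `^ (al * m - 1).
  have g := sum_ge_geometric hm (powR_gt0 al r0) hrs.
  apply: le_trans (ler_wpM2l a0 (ler_wpM2l (ltW K0) g)) _.
  rewrite -powRrM /amp.
  have -> : al * m - 1 = (al - 1) + al * (m - 1) by ring.
  rewrite [r `^ (al - 1 + _)]powRD_gt0//.
  by rewrite le_eqVlt; apply/orP; left; apply/eqP; ring.
by split; rewrite normrM (ger0_norm a0); apply: le_trans h; rewrite ler_wpM2l.
Qed.

End bounds.
End symbol_bounds.

(** * Bounds on the scalar kernels u_k *)

Ltac nonneg := repeat (first [ done | by apply: ltW | exact: powR_ge0 | exact: expR_ge0
  | exact: sqr_ge0 | exact: pi_ge0 | rewrite invr_ge0 | rewrite subr_ge0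
  | apply: addr_ge0 | apply: mulr_ge0 | apply: fine_ge0 ]).

Section measurability.
Context d (T : measurableType d) (R : realType).
Implicit Types f g : T -> R.

Lemma measurable_cosf f : measurable_fun setT f -> measurable_fun setT (fun t => cos (f t)).
Proof.
move=> mf; apply: (measurableT_comp (f := @cos R)) => //.
by apply: continuous_measurable_fun; exact: continuous_cos.
Qed.

Lemma measurable_sinf f : measurable_fun setT f -> measurable_fun setT (fun t => sin (f t)).
Proof.
move=> mf; apply: (measurableT_comp (f := @sin R)) => //.
by apply: continuous_measurable_fun; exact: continuous_sin.
Qed.

Lemma measurable_powf p f : measurable_fun setT f -> measurable_fun setT (fun t => f t `^ p).
Proof. by move=> mf; apply: (measurableT_comp (measurable_powR p)). Qed.

Lemma measurable_expf f : measurable_fun setT f -> measurable_fun setT (fun t => expR (f t)).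
Proof. by move=> mf; apply: (measurableT_comp (@measurable_expR R)). Qed.

Lemma measurable_divf f g : measurable_fun setT f -> measurable_fun setT g ->
  (forall t, 0 <= g t) -> measurable_fun setT (fun t => f t / g t).
Proof.
move=> mf mg g0; apply: measurable_funM => //.
have -> : (fun t => (g t)^-1) = (fun t => g t `^ (-1)).
  by apply/funext => t; rewrite powR_inv1.
exact: measurable_powf.
Qed.

Section contour_functions.
Variables (al be mu la rs : R) (r psi : T -> R).
Hypotheses (mr : measurable_fun setT r) (mpsi : measurable_fun setT psi).

Let mcst (c : R) : measurable_fun setT (fun _ : T => c). Proof. exact: measurable_cst. Qed.

Lemma measurable_den_re : measurable_fun setT (fun t => den_re al be mu la rs (r t) (psi t)).
Proof.
apply: measurable_funD => //; apply: measurable_funM => //.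
apply: measurable_funD; apply: measurable_funM; try exact: measurable_powf;
 try (by apply: measurable_cosf; apply: measurable_funM).
by apply: measurable_funM => //; exact: measurable_powf.
Qed.

Lemma measurable_den_im : measurable_fun setT (fun t => den_im al be mu la (r t) (psi t)).
Proof.
apply: measurable_funM => //.
apply: measurable_funD; apply: measurable_funM; try exact: measurable_powf;
 try (by apply: measurable_sinf; apply: measurable_funM).
by apply: measurable_funM => //; exact: measurable_powf.
Qed.

Lemma measurable_res : measurable_fun setT (fun t => res_re al be mu la rs (r t) (psi t)) /\
  measurable_fun setT (fun t => res_im al be mu la rs (r t) (psi t)).
Proof.
have mc : measurable_fun setT (fun t => cos (al * psi t)).
  by apply: measurable_cosf; apply: measurable_funM.
have ms : measurable_fun setT (fun t => sin (al * psi t)).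
  by apply: measurable_sinf; apply: measurable_funM.
have md : measurable_fun setT (fun t => den_sq al be mu la rs (r t) (psi t)).
  apply: measurable_funD; apply: measurable_funX;
    [exact: measurable_den_re|exact: measurable_den_im].
have d0 t : 0 <= den_sq al be mu la rs (r t) (psi t) by rewrite addr_ge0 ?sqr_ge0.
split; apply: measurable_divf => //.
  by apply: measurable_funD; apply: measurable_funM => //;
    [exact: measurable_den_re|exact: measurable_den_im].
by apply: measurable_funB; apply: measurable_funM => //;
    [exact: measurable_den_re|exact: measurable_den_im].
Qed.

Lemma measurable_osc (a b A B : T -> R) x : measurable_fun setT a -> measurable_fun setT b ->
  measurable_fun setT A -> measurable_fun setT B ->
  measurable_fun setT (fun t => osc (a t) (b t) (A t) (B t) x).
Proof.
move=> ma mb mA mB; apply: measurable_funM.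
  by apply: measurable_expf; exact: measurable_funM.
apply: measurable_funD; apply: measurable_funM => //.
  by apply: measurable_cosf; exact: measurable_funM.
by apply: measurable_sinf; exact: measurable_funM.
Qed.

End contour_functions.
End measurability.

Section u_bounds.
Context {R : realType}.
Local Notation leb := (@lebesgue_measure R).
Variables (al be mu la kap phi T : R).
Hypotheses (hbe : 0 < be) (hbeal : be <= al) (hal : al < 1)
  (hmu : 0 < mu) (hla : 0 <= la) (hkap : 0 < kap) (hphi : pi / 2 < phi < pi) (hT : 0 < T).
Implicit Types r psi x y m nu rs v : R.

Local Notation ray := (ray_osc al be mu la).
Local Notation arc := (arc_osc al be mu la).

(** The contour integral for u_k in real form, rs standing for rho_k^s. *)
Definition ukernel rs x : R := (2 * pi)^-1 *
  (- (\int[leb]_(r in `[kap, +oo[) ray rs (- phi) x r)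
   + \int[leb]_(psi in `[- phi, phi]) arc rs kap x psi
   + \int[leb]_(r in `[kap, +oo[) ray rs phi x r).

Let al0 : 0 < al. Proof. exact: lt_le_trans hbe hbeal. Qed.

Lemma phi_pos : 0 < phi < pi.
Proof.
have [h1 h2] := andP hphi; rewrite h2 andbT; apply: lt_trans h1.
by rewrite divr_gt0// pi_gt0.
Qed.

Lemma measurable_ray rs psi x : measurable_fun setT (ray rs psi x).
Proof.
have mi : measurable_fun setT (fun r : R => r) by exact: measurable_id.
have mc (c : R) : measurable_fun setT (fun _ : R => c) by exact: measurable_cst.
have [h1 h2] := @measurable_res _ R R al be mu la rs id (fun=> psi) mi (mc psi).
apply: measurable_osc; try exact: measurable_funM.
- by apply: measurable_funM => //; apply: measurable_funM => //; exact: measurable_powR.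
- by apply: measurable_funM => //; apply: measurable_funM => //; exact: measurable_powR.
Qed.

Lemma measurable_arc rs x : measurable_fun setT (arc rs kap x).
Proof.
have mi : measurable_fun setT (fun r : R => r) by exact: measurable_id.
have mc (c : R) : measurable_fun setT (fun _ : R => c) by exact: measurable_cst.
have [h1 h2] := @measurable_res _ R R al be mu la rs (fun=> kap) id (mc kap) mi.
apply: measurable_osc.
- by apply: measurable_funM => //; exact: measurable_cosf.
- by apply: measurable_funM => //; exact: measurable_sinf.
- by apply: measurable_funM.
- by apply: measurableT_comp => //; apply: measurable_funM.
Qed.

Definition sector_const : R := (cos (al * phi / 2) * Num.min mu^-1 1)^-1.
Definition decay_rate : R := - cos phi.
Definition amp_const : R := mu^-1 * sector_const.

Lemma decay_rate_gt0 : 0 < decay_rate.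
Proof.
have [h1 h2] := andP hphi; rewrite /decay_rate oppr_gt0 -cos_pihalf.
have p0 := @pi_gt0 R.
have q0 : 0 < pi / 2 :> R by rewrite divr_gt0.
have q1 : 0 <= phi := ltW (lt_trans q0 h1).
have q2 : pi / 2 <= pi :> R := ltW (lt_trans h1 h2).
by rewrite ltr_cos ?in_itv/= ?q1 ?q2 ?(ltW q0) ?(ltW h2).
Qed.

Lemma amp_const_gt0 : 0 < amp_const.
Proof.
apply: mulr_gt0; first by rewrite invr_gt0.
exact: (sector_const_gt0 hbe hbeal hal hmu phi_pos).
Qed.

Lemma expR_ray psi x r : `|psi| = phi ->
  expR (r * cos psi * x) = expR (- (decay_rate * (r * x))).
Proof.
move=> hpsi; congr expR; rewrite /decay_rate.
have -> : cos phi = cos psi.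
  by rewrite -hpsi; have [p0|p0] := lerP 0 psi; rewrite ?(ger0_norm p0)// (ltr0_norm p0) cosN.
by ring.
Qed.

Lemma ray_bound rs psi x r m : 0 < rs -> 0 <= m <= 1 -> 0 < r -> `|psi| = phi ->
  `|ray rs psi x r| <= 2 * (amp_const * rs `^ (- m) * r `^ (al * m - 1)) *
     expR (- (decay_rate * (r * x))).
Proof.
move=> rs0 hm r0 hpsi; have ple : `|psi| <= phi by rewrite hpsi.
have [h1 h2] := amp_res_bound hbe hbeal hal hmu hla rs0 phi_pos hm r0 ple.
by apply: osc_bound => //; rewrite expR_ray.
Qed.

Lemma ray_lip rs psi x y r m : 0 < rs -> 0 <= m <= 1 -> 0 < r -> `|psi| = phi -> x <= y ->
  `|ray rs psi x r - ray rs psi y r| <=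
    2 * (amp_const * rs `^ (- m) * r `^ (al * m - 1)) * expR (- (decay_rate * (r * x))) *
      (2 * r) * `|x - y|.
Proof.
move=> rs0 hm r0 hpsi xy; have ple : `|psi| <= phi by rewrite hpsi.
have [h1 h2] := amp_res_bound hbe hbeal hal hmu hla rs0 phi_pos hm r0 ple.
have hy : expR (r * cos psi * y) <= expR (- (decay_rate * (r * x))).
  by rewrite expR_ray// ler_expR lerN2 ler_wpM2l ?(ltW decay_rate_gt0)// ler_wpM2l// ltW.
apply: le_trans (osc_lip _ h2 h1 _ hy) _; first by rewrite expR_ray.
rewrite ler_wpM2r// ler_wpM2l//; first by have ac := amp_const_gt0; nonneg.
rewrite !normrM (gtr0_norm r0) -mulrDr mulrC ler_wpM2r ?(ltW r0)//.
have := cos_max psi; have := sin_max psi; lra.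
Qed.

Lemma tail_dominated (f : R -> R) C dl : measurable_fun setT f -> 0 < dl ->
  (forall r, kap <= r -> `|f r| <= C * r `^ (- 1 - dl)) ->
  leb.-integrable `[kap, +oo[ (EFin \o f) /\
  `|\int[leb]_(r in `[kap, +oo[) f r| <= C * (kap `^ (- dl) / dl).
Proof.
move=> mf dl0 hf; have [ti tE] := tail_powR dl0 hkap.
have mD : measurable (`[kap, +oo[%classic : set (measurableTypeR R)) by [].
have hf' x : [set` `[kap, +oo[] x -> `|f x| <= C * x `^ (- 1 - dl).
  by rewrite /= in_itv/= andbT; exact: hf.
have iC := integrableRZ mD C ti.
have intf : leb.-integrable `[kap, +oo[ (EFin \o f).
  exact: (le_integrableR mD (measurable_funTS mf) iC hf').
split => //; apply: le_trans (le_normr_Rintegral mD intf) _.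
rewrite -tE -RintegralZl//; apply: le_Rintegral => //; exact: integrable_norm.
Qed.

(** By e^(-y) <= y^(-nu) the exponential on the ray is traded for the power
    x^(-nu) of the time, leaving the power r^(al m - 1 - nu), which is
    integrable because al m < nu. *)
Lemma ray_decay rs psi x m nu : 0 < rs -> 0 <= m <= 1 -> al * m < nu <= 1 -> 0 < x ->
  `|psi| = phi ->
  leb.-integrable `[kap, +oo[ (EFin \o ray rs psi x) /\
  `|\int[leb]_(r in `[kap, +oo[) ray rs psi x r| <=
    2 * amp_const * decay_rate `^ (- nu) * (kap `^ (- (nu - al * m)) / (nu - al * m)) *
     (rs `^ (- m) * x `^ (- nu)).
Proof.
move=> rs0 hm /andP[mnu nu1] x0 hpsi; have [m0 m1] := andP hm.
have nu0 : 0 <= nu by apply: le_trans (ltW mnu); rewrite mulr_ge0// ltW.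
have p0 := decay_rate_gt0.
have [|||hi hb] := @tail_dominated (ray rs psi x)
   (2 * amp_const * decay_rate `^ (- nu) * (rs `^ (- m) * x `^ (- nu))) (nu - al * m).
- exact: measurable_ray.
- by rewrite subr_gt0.
- move=> r kr; have r0 := lt_le_trans hkap kr.
  apply: le_trans (ray_bound _ rs0 hm r0 hpsi) _.
  have prx0 : 0 < decay_rate * (r * x) by rewrite !mulr_gt0.
  have nuI : 0 <= nu <= 1 by rewrite nu0.
  have A0 : 0 <= 2 * (amp_const * rs `^ (- m) * r `^ (al * m - 1)).
    by have ac := amp_const_gt0; nonneg.
  apply: le_trans (ler_wpM2l A0 (expR_le_powR nuI prx0)) _.
  rewrite !powRM ?mulr_ge0 ?(ltW p0) ?(ltW r0) ?(ltW x0)//.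
  have -> : - 1 - (nu - al * m) = (al * m - 1) + - nu by ring.
  rewrite (powRD_gt0 (al * m - 1) (- nu) r0).
  by rewrite le_eqVlt; apply/orP; left; apply/eqP; ring.
split => //; apply: le_trans hb _.
by rewrite le_eqVlt; apply/orP; left; apply/eqP; ring.
Qed.

(** For m = 0 the bound 1 / r of [amp_res_bound] is not integrable on the ray.
    The cosine component carries the imaginary part, where [res_im_bound]
    gives a leading term treated by [tail_sigmoid] and an integrable power.
    The sine component gains a factor r x, which the exponential absorbs after
    integration. *)
Lemma ray_uniform rs psi x : 0 < rs -> 0 < x -> `|psi| = phi ->
  `|\int[leb]_(r in `[kap, +oo[) ray rs psi x r| <=
    mu^-1 * sector_const ^+ 2 * (al^-1 + mu^-1 * la * (kap `^ (- be) / be))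
    + amp_const / decay_rate.
Proof.
move=> rs0 x0 hpsi; have p0 := decay_rate_gt0.
have ple : `|psi| <= phi by rewrite hpsi.
have m0 : 0 <= (0 : R) <= 1 by rewrite lexx ler01.
have mnu : al * 0 < 1 <= (1 : R) by rewrite mulr0 ltr01 lexx.
have [hi _] := ray_decay rs0 m0 mnu x0 hpsi.
have mD : measurable (`[kap, +oo[%classic : set (measurableTypeR R)) by [].
have [i1 b1] := tail_sigmoid al0 rs0 hkap.
have [i2 e2] := tail_powR hbe hkap.
have px0 : 0 < decay_rate * x by rewrite mulr_gt0.
have [i3 e3] := tail_expR kap px0.
have mu0 : 0 < mu^-1 by rewrite invr_gt0.
have K2 : 0 <= mu^-1 * sector_const ^+ 2 by rewrite mulr_ge0 ?sqr_ge0 ?(ltW mu0).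
have Nla : 0 <= mu^-1 * la by rewrite mulr_ge0 ?(ltW mu0).
pose D r := mu^-1 * sector_const ^+ 2 * (r `^ (al - 1) * rs / (r `^ al + rs) ^+ 2
   + mu^-1 * la * r `^ (- 1 - be)) + amp_const * x * expR (- (decay_rate * x * r)).
have iD12 := integrableRZ mD (mu^-1 * sector_const ^+ 2) (integrableRD mD i1 (integrableRZ mD (mu^-1 * la) i2)).
have iD3 := integrableRZ mD (amp_const * x) i3.
have iD : leb.-integrable `[kap, +oo[ (EFin \o D) := integrableRD mD iD12 iD3.
apply: le_trans (le_normr_Rintegral mD hi) _.
apply: (@le_trans _ _ (\int[leb]_(r in `[kap, +oo[) D r)).
  apply: le_Rintegral => //; first exact: integrable_norm.
  move=> r; rewrite /= in_itv/= andbT => kr; have r0 := lt_le_trans hkap kr.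
  have [h1 h2] := amp_res_bound hbe hbeal hal hmu hla rs0 phi_pos m0 r0 ple.
  have h3 := res_im_bound hbe hbeal hal hmu hla rs0 phi_pos r ple.
  have a0 : 0 <= amp al mu r by rewrite mulr_ge0 ?powR_ge0 ?(ltW mu0).
  have S0 : 0 < r `^ al + rs by rewrite ltr_wpDl ?powR_ge0.
  have E0 := expR_ge0 (- (decay_rate * x * r)).
  have Ee : expR (r * cos psi * x) = expR (- (decay_rate * x * r)).
    by rewrite expR_ray//; congr expR; ring.
  have E1 : expR (- (decay_rate * x * r)) <= 1.
    by rewrite -expR0 ler_expR oppr_le0 mulr_ge0 ?(ltW px0) ?(ltW r0).
  rewrite /ray /osc Ee mulrDr; apply: le_trans (ler_normD _ _) _; apply: lerD.
    rewrite normrM (ger0_norm E0) (normrM (cos _)) (normrM (amp al mu r) (res_im _ _ _ _ _ _ _)) (ger0_norm a0).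
    apply: (@le_trans _ _ (amp al mu r * `|res_im al be mu la rs r psi|)).
      have q0 : 0 <= amp al mu r * `|res_im al be mu la rs r psi|.
        by apply: mulr_ge0 => //; exact: normr_ge0.
      apply: (@le_trans _ _ (`|cos (r * sin psi * x)| * (amp al mu r * `|res_im al be mu la rs r psi|))).
        by rewrite ler_piMl// mulr_ge0// normr_ge0.
      by rewrite ler_piMl// cos_max.
    apply: le_trans (ler_wpM2l a0 h3) _.
    rewrite -/sector_const /amp.
    have -> : mu^-1 * r `^ (al - 1) * (sector_const ^+ 2 * (rs + mu^-1 * la * r `^ (al - be)) / (r `^ al + rs) ^+ 2)
      = mu^-1 * sector_const ^+ 2 * (r `^ (al - 1) * rs / (r `^ al + rs) ^+ 2 +
        mu^-1 * la * (r `^ (al - 1) * r `^ (al - be) / (r `^ al + rs) ^+ 2)) by ring.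
    rewrite ler_wpM2l// lerD2l ler_wpM2l// ler_pdivrMr ?exprn_gt0//.
    rewrite -powRD_gt0// (_ : al - 1 + (al - be) = (- 1 - be) + (al + al)); last by ring.
    rewrite powRD_gt0// ler_wpM2l ?powR_ge0// powRD_gt0// -expr2.
    by rewrite ler_sqr ?nnegrE ?powR_ge0 ?(ltW S0)// lerDl ltW.
  rewrite normrM (ger0_norm E0) mulrC ler_wpM2r// normrM.
  have -> : amp_const * x = (r * x) * (amp_const * r^-1) by field; rewrite gt_eqF.
  apply: ler_pM => //.
    apply: (@le_trans _ _ `|r * sin psi * x - 0|).
      by have := sin_lip (r * sin psi * x) 0; rewrite sin0 (subr0 (sin _)).
    rewrite subr0 !normrM (gtr0_norm r0) (gtr0_norm x0) ler_wpM2r ?(ltW x0)//.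
    by rewrite ler_piMr ?sin_max// ltW.
  by move: h1; rewrite oppr0 powRr0 mulr1 mulr0 sub0r powR_inv1 ?(ltW r0).
rewrite /D RintegralD// !RintegralZl//; last exact: (integrableRD mD i1 (integrableRZ mD (mu^-1 * la) i2)).
rewrite RintegralD//; last exact: (integrableRZ mD (mu^-1 * la) i2).
rewrite RintegralZl// e2 e3; apply: lerD.
  by rewrite ler_wpM2l// lerD2r.
have -> : amp_const * x * (expR (- (decay_rate * x * kap)) / (decay_rate * x)) =
  amp_const / decay_rate * expR (- (decay_rate * x * kap)).
  by field; rewrite !gt_eqF.
have ac := amp_const_gt0.
have q0 : 0 <= amp_const / decay_rate by nonneg.
rewrite ler_piMr//.
by rewrite -expR0 ler_expR oppr_le0 mulr_ge0 ?(ltW px0) ?(ltW hkap).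
Qed.

(** Interpolation between the Lipschitz bound [ray_lip] and the bound
    [ray_bound], followed by e^(-y) <= y^(-3/4). *)
Lemma ray_holder rs psi x y : 0 < rs -> 0 < x <= y -> `|psi| = phi ->
  `|\int[leb]_(r in `[kap, +oo[) ray rs psi x r - \int[leb]_(r in `[kap, +oo[) ray rs psi y r| <=
   4 * amp_const * decay_rate `^ (- (3 / 4)) * (kap `^ (- 4^-1) / 4^-1) *
    ((y - x) `^ 2^-1 * x `^ (- (3 / 4))).
Proof.
move=> rs0 /andP[x0 xy] hpsi; have p0 := decay_rate_gt0.
have y0 : 0 < y := lt_le_trans x0 xy.
have m0 : 0 <= (0 : R) <= 1 by rewrite lexx ler01.
have mnu : al * 0 < 1 <= (1 : R) by rewrite mulr0 ltr01 lexx.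
have mD : measurable (`[kap, +oo[%classic : set (measurableTypeR R)) by [].
have [ix _] := ray_decay rs0 m0 mnu x0 hpsi.
have [iy _] := ray_decay rs0 m0 mnu y0 hpsi.
rewrite -RintegralB//.
have d0 : 0 <= y - x by rewrite subr_ge0.
have [|||_ hb] := @tail_dominated (fun r => ray rs psi x r - ray rs psi y r)
   (4 * amp_const * decay_rate `^ (- (3 / 4)) * ((y - x) `^ 2^-1 * x `^ (- (3 / 4)))) 4^-1.
- by apply: measurable_funB; exact: measurable_ray.
- by rewrite invr_gt0.
- move=> r kr; have r0 := lt_le_trans hkap kr.
  have E0 := expR_ge0 (- (decay_rate * (r * x))).
  have b1 : `|ray rs psi x r - ray rs psi y r| <=
      4 * amp_const * r^-1 * expR (- (decay_rate * (r * x))) * (r * (y - x)).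
    apply: le_trans (ray_lip rs0 m0 r0 hpsi xy) _; rewrite distrC ger0_norm//.
    rewrite oppr0 powRr0 mulr1 mulr0 sub0r powR_inv1 ?(ltW r0)//.
    by rewrite le_eqVlt; apply/orP; left; apply/eqP; ring.
  have b2 : `|ray rs psi x r - ray rs psi y r| <=
      4 * amp_const * r^-1 * expR (- (decay_rate * (r * x))).
    apply: le_trans (ler_normB _ _) _.
    have := ray_bound x rs0 m0 r0 hpsi; have := ray_bound y rs0 m0 r0 hpsi.
    rewrite oppr0 powRr0 mulr1 mulr0 sub0r powR_inv1 ?(ltW r0)// => hy hx.
    have hyx : expR (- (decay_rate * (r * y))) <= expR (- (decay_rate * (r * x))).
      by rewrite ler_expR lerN2 ler_wpM2l ?(ltW p0)// ler_wpM2l// ltW.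
    have A0 : 0 <= 2 * (amp_const * r^-1) by have ac := amp_const_gt0; nonneg.
    by have := ler_wpM2l A0 hyx; lra.
  set B := 4 * amp_const * r^-1 * _ in b1 b2.
  have B0 : 0 <= B by have ac := amp_const_gt0; nonneg.
  have rd0 : 0 <= r * (y - x) by rewrite mulr_ge0 ?(ltW r0).
  apply: (@le_trans _ _ (B * (r * (y - x)) `^ 2^-1)).
    have [rd1|rd1] := leP (r * (y - x)) 1.
      apply: le_trans b1 _; rewrite ler_wpM2l//.
      move: rd0; rewrite le_eqVlt => /orP[/eqP <-|rd0]; first by rewrite powR_ge0.
      by rewrite ger1_powR ?rd0// invf_le1// ler1n.
    apply: le_trans b2 _; rewrite ler_peMr//.
    apply: (@le_trans _ _ ((1 : R) `^ 2^-1)); first by rewrite powR1.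
    by apply: ge0_ler_powR; rewrite ?nnegrE ?invr_ge0//; exact: ltW.
  have h34 : 0 <= 3 / 4 :> R by lra.
  have h341 : 3 / 4 <= 1 :> R by lra.
  have nuI := introT andP (conj h34 h341).
  have prx0 : 0 < decay_rate * (r * x) by rewrite !mulr_gt0.
  have hE := expR_le_powR nuI prx0.
  have A0 : 0 <= 4 * amp_const * r^-1 by have ac := amp_const_gt0; nonneg.
  have := ler_wpM2r (powR_ge0 (r * (y - x)) 2^-1) (ler_wpM2l A0 hE).
  move=> h; apply: le_trans h _.
  rewrite !powRM ?mulr_ge0 ?(ltW p0) ?(ltW r0) ?(ltW x0)//.
  have -> : - 1 - 4^-1 = - 1 + (- (3 / 4) + 2^-1) :> R by field.
  rewrite !(powRD_gt0 _ _ r0) powR_inv1 ?(ltW r0)//.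
  by rewrite le_eqVlt; apply/orP; left; apply/eqP; ring.
apply: le_trans hb _; rewrite le_eqVlt; apply/orP; left; apply/eqP; ring.
Qed.

Lemma arc_bound rs x psi m : 0 < rs -> 0 <= m <= 1 -> 0 <= x <= T -> `|psi| <= phi ->
  `|arc rs kap x psi| <= 2 * (amp_const * rs `^ (- m) * kap `^ (al * m)) * expR (kap * T).
Proof.
move=> rs0 hm /andP[x0 xT] hpsi.
have [h1 h2] := amp_res_bound hbe hbeal hal hmu hla rs0 phi_pos hm hkap hpsi.
have kk : kap `^ (al * m - 1) * kap = kap `^ (al * m).
  by rewrite -{2}(powRr1 (ltW hkap)) -powRD_gt0// subrK.
apply: osc_bound.
- rewrite mulrAC normrM (gtr0_norm hkap) -kk mulrA; exact: ler_wpM2r (ltW hkap) _ _ h1.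
- rewrite normrN mulrAC normrM (gtr0_norm hkap) -kk mulrA; exact: ler_wpM2r (ltW hkap) _ _ h2.
- rewrite ler_expR; apply: (@le_trans _ _ (kap * x)); last by rewrite ler_wpM2l// ltW.
  rewrite ler_wpM2r// ler_piMr ?(ltW hkap)//; exact: le_trans (ler_norm _) (cos_max _).
Qed.

Lemma arc_lip rs x y psi m : 0 < rs -> 0 <= m <= 1 -> 0 <= x <= T -> 0 <= y <= T ->
  `|psi| <= phi ->
  `|arc rs kap x psi - arc rs kap y psi| <=
     2 * (amp_const * rs `^ (- m) * kap `^ (al * m)) * expR (kap * T) * (2 * kap) * `|x - y|.
Proof.
move=> rs0 hm /andP[x0 xT] /andP[y0 yT] hpsi.
have [h1 h2] := amp_res_bound hbe hbeal hal hmu hla rs0 phi_pos hm hkap hpsi.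
have kk : kap `^ (al * m - 1) * kap = kap `^ (al * m).
  by rewrite -{2}(powRr1 (ltW hkap)) -powRD_gt0// subrK.
have A1 : `|amp al mu kap * kap * res_re al be mu la rs kap psi| <=
    amp_const * rs `^ (- m) * kap `^ (al * m).
  by rewrite mulrAC normrM (gtr0_norm hkap) -kk mulrA; exact: ler_wpM2r (ltW hkap) _ _ h1.
have A2 : `|- (amp al mu kap * kap * res_im al be mu la rs kap psi)| <=
    amp_const * rs `^ (- m) * kap `^ (al * m).
  by rewrite normrN mulrAC normrM (gtr0_norm hkap) -kk mulrA; exact: ler_wpM2r (ltW hkap) _ _ h2.
have E z : 0 <= z <= T -> expR (kap * cos psi * z) <= expR (kap * T).
  move=> /andP[z0 zT]; rewrite ler_expR; apply: (@le_trans _ _ (kap * z)); last by rewrite ler_wpM2l// ltW.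
  rewrite ler_wpM2r// ler_piMr ?(ltW hkap)//; exact: le_trans (ler_norm _) (cos_max _).
apply: le_trans (osc_lip _ A1 A2 (E x _) (E y _)) _; rewrite ?x0 ?y0//.
rewrite ler_wpM2r// ler_wpM2l//; first by have ac := amp_const_gt0; nonneg.
rewrite !normrM (gtr0_norm hkap) -mulrDr mulrC ler_wpM2r ?(ltW hkap)//.
have := cos_max psi; have := sin_max psi; lra.
Qed.

Let mA : measurable (`[- phi, phi]%classic : set (measurableTypeR R)). Proof. by []. Qed.

Lemma arc_int rs x m : 0 < rs -> 0 <= m <= 1 -> 0 <= x <= T ->
  leb.-integrable `[- phi, phi] (EFin \o arc rs kap x) /\
  `|\int[leb]_(psi in `[- phi, phi]) arc rs kap x psi| <=
    2 * (amp_const * rs `^ (- m) * kap `^ (al * m)) * expR (kap * T) *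
     fine (leb `[- phi, phi]%classic).
Proof.
move=> rs0 hm hx.
have hb psi : [set` `[- phi, phi]] psi -> `|arc rs kap x psi| <=
    2 * (amp_const * rs `^ (- m) * kap `^ (al * m)) * expR (kap * T).
  by rewrite /= in_itv/= -ler_norml; exact: arc_bound.
have mf := measurable_funTS (measurable_arc rs x) : measurable_fun `[- phi, phi] _.
split; [exact: (bounded_integrableR mA (lebesgue_itv_lty _ _ _ _) mf hb)|
  exact: (Rintegral_le_cst mA (lebesgue_itv_lty _ _ _ _) mf hb)].
Qed.

Lemma norm_phi : `|phi| = phi /\ `|- phi| = phi.
Proof. by rewrite normrN; have /andP[/ltW p0 _] := phi_pos; rewrite ger0_norm. Qed.

Lemma ukernel_le (a b c A B C : R) : `|a| <= A -> `|b| <= B -> `|c| <= C ->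
  `|(2 * pi)^-1 * (- a + b + c)| <= (2 * pi)^-1 * (A + B + C).
Proof.
move=> ha hb hc; rewrite normrM ger0_norm; last by rewrite invr_ge0 mulr_ge0// pi_ge0.
rewrite ler_wpM2l ?invr_ge0 ?mulr_ge0 ?pi_ge0//.
apply: le_trans (ler_normD _ _) _; apply: lerD => //.
by apply: le_trans (ler_normD _ _) _; rewrite normrN; apply: lerD.
Qed.

Lemma powR_ge_inv x nu : 0 <= nu -> 0 < x <= T -> 1 <= T `^ nu * x `^ (- nu).
Proof.
move=> nu0 /andP[x0 xT]; rewrite powRN -ler_pdivrMr ?invr_gt0 ?powR_gt0// invrK mul1r.
by rewrite ge0_ler_powR ?nnegrE ?(ltW x0)// (le_trans (ltW x0)).
Qed.

(** The arc is a bounded piece of the contour, where the factor x^(-nu) costs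
    nothing since x <= T. *)
Lemma ukernel_decay m nu : 0 <= m <= 1 -> al * m < nu <= 1 ->
  exists2 C : R, 0 <= C & forall rs x, 0 < rs -> 0 < x <= T ->
    `|ukernel rs x| <= C * (rs `^ (- m) * x `^ (- nu)).
Proof.
move=> hm hnu; have [n1 n2] := norm_phi.
have [/andP[m0 m1] /andP[mnu nu1]] := (hm, hnu).
have nu0 : 0 <= nu by apply: le_trans (ltW mnu); rewrite mulr_ge0// ltW.
have p0 := decay_rate_gt0; have ac := amp_const_gt0.
set A := 2 * amp_const * decay_rate `^ (- nu) * (kap `^ (- (nu - al * m)) / (nu - al * m)).
set B := 2 * (amp_const * kap `^ (al * m)) * expR (kap * T) * fine (leb `[- phi, phi]%classic) * T `^ nu.
have A0 : 0 <= A by rewrite /A; nonneg.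
have B0 : 0 <= B by rewrite /B; nonneg.
exists ((2 * pi)^-1 * (A + B + A)).
  by nonneg.
move=> rs x rs0 hx; have [x0 xT] := andP hx.
have -> : (2 * pi)^-1 * (A + B + A) * (rs `^ (- m) * x `^ (- nu)) = (2 * pi)^-1 *
  (A * (rs `^ (- m) * x `^ (- nu)) + B * (rs `^ (- m) * x `^ (- nu)) + A * (rs `^ (- m) * x `^ (- nu))).
  by ring.
apply: ukernel_le.
- exact: (ray_decay rs0 hm hnu x0 n2).2.
- apply: le_trans (arc_int rs0 hm _).2 _; first by rewrite (ltW x0).
  have -> : B * (rs `^ (- m) * x `^ (- nu)) =
    2 * (amp_const * rs `^ (- m) * kap `^ (al * m)) * expR (kap * T) *
     fine (leb `[- phi, phi]%classic) * (T `^ nu * x `^ (- nu)) by rewrite /B; ring.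
  rewrite ler_peMr ?powR_ge_inv//.
  by nonneg.
- exact: (ray_decay rs0 hm hnu x0 n1).2.
Qed.

Lemma ukernel_bounded : exists2 C : R, 0 <= C & forall rs x, 0 < rs -> 0 < x <= T ->
  `|ukernel rs x| <= C.
Proof.
have [n1 n2] := norm_phi.
have m0 : 0 <= (0 : R) <= 1 by rewrite lexx ler01.
have ac := amp_const_gt0.
set A := mu^-1 * sector_const ^+ 2 * (al^-1 + mu^-1 * la * (kap `^ (- be) / be))
    + amp_const / decay_rate.
set B := 2 * amp_const * expR (kap * T) * fine (leb `[- phi, phi]%classic).
have mu0 : 0 < mu^-1 by rewrite invr_gt0.
have dr := decay_rate_gt0.
have A0 : 0 <= A by rewrite /A; nonneg.
have B0 : 0 <= B by rewrite /B; nonneg.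
exists ((2 * pi)^-1 * (A + B + A)).
  by nonneg.
move=> rs x rs0 hx; have [x0 xT] := andP hx.
apply: ukernel_le; [exact: ray_uniform| |exact: ray_uniform].
have := (arc_int rs0 m0 (x := x) _).2; rewrite (ltW x0) xT => /(_ isT).
by rewrite oppr0 powRr0 mulr1 mulr0 powRr0 mulr1.
Qed.

Lemma ukernel_holder : exists2 C : R, 0 <= C & forall rs x y, 0 < rs -> 0 < x <= y -> y <= T ->
  `|ukernel rs x - ukernel rs y| <= C * ((y - x) `^ 2^-1 * x `^ (- (3 / 4))).
Proof.
have [n1 n2] := norm_phi; have ac := amp_const_gt0.
have m0 : 0 <= (0 : R) <= 1 by rewrite lexx ler01.
set A := 4 * amp_const * decay_rate `^ (- (3 / 4)) * (kap `^ (- 4^-1) / 4^-1).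
set B := 4 * amp_const * kap * expR (kap * T) * fine (leb `[- phi, phi]%classic) *
   (T `^ 2^-1 * T `^ (3 / 4)).
have dr := decay_rate_gt0.
have A0 : 0 <= A by rewrite /A; nonneg.
have B0 : 0 <= B by rewrite /B; nonneg.
exists ((2 * pi)^-1 * (A + B + A)).
  by nonneg.
move=> rs x y rs0 hxy yT; have [x0 xy] := andP hxy.
have y0 : 0 < y := lt_le_trans x0 xy.
have xT := le_trans xy yT.
have xI : 0 <= x <= T by rewrite (ltW x0).
have yI : 0 <= y <= T by rewrite (ltW y0).
have -> : ukernel rs x - ukernel rs y = (2 * pi)^-1 *
  (- (\int[leb]_(r in `[kap, +oo[) ray rs (- phi) x r - \int[leb]_(r in `[kap, +oo[) ray rs (- phi) y r)
   + (\int[leb]_(psi in `[- phi, phi]) arc rs kap x psi - \int[leb]_(psi in `[- phi, phi]) arc rs kap y psi)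
   + (\int[leb]_(r in `[kap, +oo[) ray rs phi x r - \int[leb]_(r in `[kap, +oo[) ray rs phi y r)).
  by rewrite /ukernel; ring.
set X := (y - x) `^ 2^-1 * _.
have -> : (2 * pi)^-1 * (A + B + A) * X = (2 * pi)^-1 * (A * X + B * X + A * X) by ring.
apply: ukernel_le; [exact: ray_holder| |exact: ray_holder]; rewrite /X.
rewrite -RintegralB//; [|exact: (arc_int rs0 m0 xI).1|exact: (arc_int rs0 m0 yI).1].
have d0 : 0 <= y - x by rewrite subr_ge0.
have hb psi : [set` `[- phi, phi]] psi -> `|arc rs kap x psi - arc rs kap y psi| <=
    4 * amp_const * kap * expR (kap * T) * (y - x).
  rewrite /= in_itv/= -ler_norml => hpsi.
  have := arc_lip rs0 m0 xI yI hpsi.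
  rewrite oppr0 powRr0 mulr1 mulr0 powRr0 mulr1 distrC (distrC x y) (ger0_norm d0) distrC => h.
  by apply: le_trans h _; rewrite le_eqVlt; apply/orP; left; apply/eqP; ring.
apply: le_trans (Rintegral_le_cst mA (lebesgue_itv_lty _ _ _ _) _ hb) _.
  by apply: measurable_funTS; apply: measurable_funB; exact: measurable_arc.
have -> : B * ((y - x) `^ 2^-1 * x `^ (- (3 / 4))) =
   4 * amp_const * kap * expR (kap * T) * (T `^ 2^-1 * (y - x) `^ 2^-1) * fine (leb `[- phi, phi]%classic) *
   (T `^ (3 / 4) * x `^ (- (3 / 4))) by rewrite /B; ring.
have h34 : 0 <= 3 / 4 :> R by lra.
have hp := powR_ge_inv h34 (_ : 0 < x <= T); rewrite x0 xT in hp.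
have c0 : 0 <= 4 * amp_const * kap * expR (kap * T).
  by nonneg.
apply: (@le_trans _ _ (4 * amp_const * kap * expR (kap * T) * (T `^ 2^-1 * (y - x) `^ 2^-1) * fine (leb `[- phi, phi]%classic))).
  rewrite ler_wpM2r ?fine_ge0// ler_wpM2l//.
  have {1}-> : y - x = (y - x) `^ 2^-1 * (y - x) `^ 2^-1.
    by rewrite powR12_sqrt// -expr2 sqr_sqrtr.
  rewrite ler_wpM2r ?powR_ge0// ge0_ler_powR ?nnegrE ?invr_ge0 ?(ltW hT)//.
  by rewrite lerBlDr (le_trans yT)// lerDl ltW.
by rewrite ler_peMr ?hp//; nonneg.
Qed.

End u_bounds.

(** * Coordinates of the solution operator *)

Lemma polar_cmod_carg (R : realType) (z : R[i]) : 0 < cmod z ->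
  z = polar (cmod z) (carg z).
Proof.
case: z => x y; set z := Complex x y => z0.
have zE : cmod z ^+ 2 = x ^+ 2 + y ^+ 2 by rewrite /cmod sqr_sqrtr// addr_ge0 ?sqr_ge0.
have cI : -1 <= x / cmod z <= 1.
  rewrite -ler_norml normrM [X in _ * X]ger0_norm ?invr_ge0 ?(ltW z0)// ler_pdivrMr// mul1r.
  rewrite -sqrtr_sqr /cmod/= ler_sqrt ?addr_ge0 ?sqr_ge0// lerDl sqr_ge0 //.
have cosE : cos (carg z) = x / cmod z.
  by rewrite /carg; case: ifP => _; rewrite ?cosN acosK// in_itv.
have sinE : sin (acos (x / cmod z)) = `|y| / cmod z.
  rewrite sin_acos//; have -> : 1 - (x / cmod z) ^+ 2 = (y / cmod z) ^+ 2.
    by rewrite !exprMn exprVn zE; field; rewrite -zE expf_neq0// gt_eqF.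
  by rewrite sqrtr_sqr normrM [X in _ * X]ger0_norm// invr_ge0 ltW.
have sE : sin (carg z) = y / cmod z.
  rewrite /carg /=; case: (leP 0 y) => y0; first by rewrite sinE ger0_norm.
  by rewrite sinN sinE ltr0_norm// mulNr opprK.
by rewrite /polar cosE sE; congr Complex; rewrite mulrC divfK// gt_eqF.
Qed.

Section solution_coordinates.
Context {R : realType}.
Local Notation leb := (@lebesgue_measure R).
Variables (al be s mu la kap th : R).
Hypotheses (hbe : 0 < be) (hbeal : be <= al) (hal : al < 1)
  (hmu : 0 < mu) (hla : 0 <= la) (hkap : 0 < kap) (hth : 0 < th < pi / 2).
Let phi := pi - th.

Lemma contour_angle : pi / 2 < phi < pi.
Proof.
have [t0 t1] := andP hth; rewrite /phi; have := splitr (pi : R).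
by move: t0 t1; set y := pi / 2 => *; apply/andP; split; lra.
Qed.

(** The contour integral of the resolvent coordinate splits into the two rays
    and the arc, on which [Im_ray_integrand] and [Im_arc_integrand] give the
    real integrands. *)
Lemma Re_laplace_ukernel rs v x (q : R[i] -> R[i]) : 0 < rs -> 0 < x ->
  (forall z, z \in contour kap th ->
     q z = Complex v 0 * (symbol al be mu la z + Complex rs 0)^-1) ->
  complex.Re (inverse_laplace kap th
     (fun z => Complex mu^-1 0 * cpow z (al - 1) * q z) x) =
  v * ukernel al be mu la kap phi rs x.
Proof.
move=> rs0 x0 hq; have ca := contour_angle; have [f1 f2] := andP ca.
have pp := @pi_gt0 R.
have f0 : 0 < phi by apply: lt_trans f1; rewrite divr_gt0.
have [n1 n2] := norm_phi ca.
have m0 : 0 <= (0 : R) <= 1 by rewrite lexx ler01.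
have mnu : al * 0 < 1 <= (1 : R) by rewrite mulr0 ltr01 lexx.
have rayI psi : `|psi| = phi -> - pi < psi <= pi.
  move=> h; have : `|psi| < pi by rewrite h.
  by rewrite ltr_norml => /andP[-> /ltW ->].
have rayE psi : `|psi| = phi -> \int[leb]_(r in `[kap, +oo[)
   complex.Im (cexp (Complex (complex.Re (polar r psi) * x) (complex.Im (polar r psi) * x)) *
    (Complex mu^-1 0 * cpow (polar r psi) (al - 1) * q (polar r psi)) * polar 1 psi)
   = v * \int[leb]_(r in `[kap, +oo[) ray_osc al be mu la rs psi x r.
  move=> hpsi; rewrite -RintegralZl//; last first.
    exact: (ray_decay hbe hbeal hal hmu hla hkap ca rs0 m0 mnu x0 hpsi).1.
  apply: eq_Rintegral => r; rewrite inE/= in_itv/= andbT => kr.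
  have r0 := lt_le_trans hkap kr.
  apply: Im_ray_integrand => //; first exact: rayI.
  apply: hq; rewrite inE; left; rewrite /= cmod_polar ?(ltW r0)//.
  by rewrite carg_polar ?rayI// hpsi.
rewrite Re_inverse_laplace -/phi !rayE//.
have xx : 0 <= x <= x by rewrite (ltW x0) lexx.
rewrite (_ : \int[leb]_(psi in `[- phi, phi]) _ =
   v * \int[leb]_(psi in `[- phi, phi]) arc_osc al be mu la rs kap x psi); last first.
  rewrite -RintegralZl//; last first.
    exact: (arc_int hbe hbeal hal hmu hla hkap ca rs0 m0 xx).1.
  apply: eq_Rintegral => psi; rewrite inE/= in_itv/= => /andP[p1 p2].
  have pI : - pi < psi <= pi.
    by apply/andP; split; [apply: lt_le_trans p1; rewrite ltrN2|apply: le_trans p2 _; exact: ltW].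
  apply: Im_arc_integrand => //.
  apply: hq; rewrite inE; right; rewrite /= cmod_polar ?(ltW hkap)//.
  by rewrite carg_polar// ler_norml p1 p2.
by rewrite /ukernel; ring.
Qed.

Lemma ufunE rk x : 0 < rk `^ s -> 0 < x ->
  ufun al be s mu la kap th rk x = ukernel al be mu la kap phi (rk `^ s) x.
Proof.
move=> rs0 x0; rewrite /ufun.
rewrite (@Re_laplace_ukernel (rk `^ s) 1 x
  (fun z => (symbol al be mu la z + Complex (rk `^ s) 0)^-1)) ?mul1r// => z _.
by rewrite (_ : Complex 1 0 = 1) ?mul1r.
Qed.

Section in_basis.
Variables (l : R) (rho : nat -> R) (e : nat -> L2 l).
Hypothesis hA : dirichlet_eigenbasis rho e.

(** The coordinates of the partial sums are eventually constant. *)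
Lemma hsum_coord c w k : hsum e c w -> inner w (e k) = c k.
Proof.
move=> hw; have ho := eigenfunction_orthonormal hA.
have hk : hnorm (e k) = 1 by rewrite /hnorm ho eqxx sqrtr1.
have E n : (k < n)%N -> inner (\sum_(j < n) c j *: e j - w) (e k) = c k - inner w (e k).
  move=> kn; rewrite innerBl inner_suml (bigD1 (Ordinal kn))//= innerZl ho eqxx mulr1.
  rewrite big1 ?addr0// => i ik; rewrite innerZl ho.
  by have /negbTE -> : (i : nat) != k by []; rewrite mulr0.
have cst : (fun _ : nat => `|c k - inner w (e k)|) @ \oo --> `|c k - inner w (e k)| by exact: cvg_cst.
apply/eqP; rewrite eq_sym -subr_eq0 -normr_eq0; apply/eqP/le_anti; rewrite normr_ge0 andbT.
apply: (ler_cvg_to cst hw); exists k.+1 => // n /= kn.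
by rewrite -(E n kn) (le_trans (inner_le _ _))// hk mulr1.
Qed.

Lemma resolvent_coord zeta v w k : zeta + Complex (rho k `^ s) 0 != 0 ->
  is_resolvent rho e s zeta v w ->
  Complex (inner w.1 (e k)) (inner w.2 (e k)) =
    Complex (inner v (e k)) 0 * (zeta + Complex (rho k `^ s) 0)^-1.
Proof.
move=> z0 [a [/hsum_coord h1 /hsum_coord h2 e1 e2]].
have := heq_inner (e k) e1; have := heq_inner (e k) e2.
rewrite inner0l (innerDl _ a.1) innerBl !innerDl !innerZl h1 h2 => q2 q1.
apply: (canRL (mulfK z0)); case: zeta z0 q1 q2 {e1 e2} => x y _ /= q1 q2.
transitivity (Complex (x * inner w.1 (e k) - y * inner w.2 (e k) + rho k `^ s * inner w.1 (e k))
  (y * inner w.1 (e k) + x * inner w.2 (e k) + rho k `^ s * inner w.2 (e k))).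
  by congr Complex; rewrite /=; ring.
by rewrite q1 q2.
Qed.

(** On the contour h(z) stays away from the negative axis, which is quantified
    by [den_sq_gt0]. *)
Lemma contour_symbol_neq0 z rs : 0 < rs -> z \in contour kap th ->
  symbol al be mu la z + Complex rs 0 != 0.
Proof.
move=> rs0; rewrite inE => hz.
have ca := contour_angle; have pp := phi_pos ca.
have [za zr] : `|carg z| <= phi /\ 0 < cmod z.
  by case: hz => -[h1 h2]; [rewrite h2; split => //; exact: lt_le_trans h1|rewrite h1].
rewrite (polar_cmod_carg zr) symbol_polar//; last first.
  have := le_lt_trans za (andP pp).2; rewrite ltr_norml => /andP[-> /ltW ->] //.
have := den_sq_gt0 hbe hbeal hal hmu hla rs0 pp (cmod z) za.
apply: contraTneq => -[d1 d2]; rewrite /den_sq d1 d2 !expr0n/= addr0 ltxx //.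
Qed.

Lemma solution_coord S t v k : solution_operator rho e al be s mu la kap th S -> 0 < t ->
  inner (S t v) (e k) = ukernel al be mu la kap phi (rho k `^ s) t * inner v (e k).
Proof.
move=> [_ [Rs hR hS]] t0; have rs0 : 0 < rho k `^ s by rewrite powR_gt0// (eigenvalue_gt0 hA).
have := congr1 (@complex.Re R) (hS t v (e k) t0); rewrite [LHS]/= => ->.
rewrite mulrC; apply: (@Re_laplace_ukernel _ _ _
   (fun z => Complex (inner (Rs z v).1 (e k)) (inner (Rs z v).2 (e k)))) => // z zc.
by apply: resolvent_coord; [exact: contour_symbol_neq0|exact: hR].
Qed.

Lemma solution_coord0 S v w : solution_operator rho e al be s mu la kap th S ->
  inner (S 0 v) w = inner v w.
Proof. by move=> [h0 _]; exact: heq_inner. Qed.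

End in_basis.
End solution_coordinates.

(** * Elementary integrands on a grid *)

Section psd_form.
Context {R : realType}.
Variables (N : nat) (c : nat -> nat -> R).
Hypothesis cC : forall i j, c i j = c j i.
Implicit Types (v w : nat -> R) (x y : R).

Definition bil v w : R := \sum_(0 <= i < N) \sum_(0 <= j < N) v i * w j * c i j.

Hypothesis psd : forall v, 0 <= bil v v.

Lemma bilC v w : bil v w = bil w v.
Proof.
rewrite /bil exchange_big/=; apply: eq_bigr => i _; apply: eq_bigr => j _.
by rewrite cC; ring.
Qed.

Lemma bil_lin x y v1 v2 w : bil (fun i => x * v1 i + y * v2 i) w = x * bil v1 w + y * bil v2 w.
Proof.
rewrite /bil !mulr_sumr -big_split/=; apply: eq_bigr => i _.
by rewrite !mulr_sumr -big_split/=; apply: eq_bigr => j _; ring.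
Qed.

Lemma bil_quad x y v w : bil (fun i => x * v i + y * w i) (fun i => x * v i + y * w i) =
  x ^+ 2 * bil v v + 2 * x * y * bil v w + y ^+ 2 * bil w w.
Proof.
rewrite bil_lin (bilC v) (bilC w) !bil_lin (bilC w v); ring.
Qed.

Lemma bil_cs v w : bil v w ^+ 2 <= bil v v * bil w w.
Proof.
have := psd w; rewrite le_eqVlt => /orP[/eqP w0|w0].
  have h x : 0 <= bil v v + 2 * x * bil v w.
    by have := psd (fun i => 1 * v i + x * w i); rewrite bil_quad -w0; lra.
  suff -> : bil v w = 0 by rewrite expr0n/= -w0 mulr0.
  apply/eqP/negPn/negP => b0.
  have := h (- (bil v v + 1) / bil v w).
  have -> : 2 * (- (bil v v + 1) / bil v w) * bil v w = - 2 * (bil v v + 1) by field.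
  have := psd v; lra.
have := psd (fun i => bil w w * v i + (- bil v w) * w i); rewrite bil_quad.
have -> : bil w w ^+ 2 * bil v v + 2 * bil w w * - bil v w * bil v w + (- bil v w) ^+ 2 * bil w w
  = bil w w * (bil v v * bil w w - bil v w ^+ 2) by ring.
by rewrite pmulr_rge0// subr_ge0.
Qed.

Lemma bil_sum3 v1 v2 v3 x :
  bil (fun i => x * (- v1 i + v2 i + v3 i)) (fun i => x * (- v1 i + v2 i + v3 i)) <=
    x ^+ 2 * (3 * bil v1 v1 + 3 * bil v2 v2 + 3 * bil v3 v3).
Proof.
have E v : (fun i => x * v i) = (fun i => x * v i + 0 * v i) by apply/funext => i; ring.
rewrite (E (fun i => - v1 i + v2 i + v3 i)) bil_quad.
rewrite mulr0 !mul0r addr0 expr0n/= mul0r addr0 ler_wpM2l ?sqr_ge0//.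
have -> : (fun i => - v1 i + v2 i + v3 i) = (fun i => 1 * (- 1 * v1 i + 1 * v2 i) + 1 * v3 i).
  by apply/funext => i; ring.
rewrite bil_quad !bil_quad bil_lin.
have := psd (fun i => 1 * v1 i + 1 * v2 i); have := psd (fun i => 1 * v1 i + 1 * v3 i).
have := psd (fun i => 1 * v2 i + (-1) * v3 i); rewrite !bil_quad; lra.
Qed.

(** Minkowski's integral inequality for the seminorm of the form. As bil v v
    is the integral of bil (w r) v, the Cauchy-Schwarz inequality bounds it by
    sqrt (bil v v) times the integral of G. *)
Lemma bil_minkowski (D : set (measurableTypeR R)) (w : nat -> R -> R) (G : R -> R) :
  let mu := @lebesgue_measure R in
  measurable D ->
  (forall i, (i < N)%N -> mu.-integrable D (EFin \o w i)) -> mu.-integrable D (EFin \o G) ->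
  (forall r, D r -> bil (fun i => w i r) (fun i => w i r) <= G r ^+ 2) ->
  (forall r, D r -> 0 <= G r) ->
  bil (fun i => \int[mu]_(r in D) w i r) (fun i => \int[mu]_(r in D) w i r) <=
    (\int[mu]_(r in D) G r) ^+ 2.
Proof.
move=> mu mD iw iG hG G0; set v := (fun i => \int[mu]_(r in D) w i r).
pose a i := \sum_(0 <= j < N) v j * c i j.
have vE r : bil (fun i => w i r) v = \sum_(0 <= i < N) a i * w i r.
  apply: eq_bigr => i _; rewrite mulr_suml; apply: eq_bigr => j _; ring.
have int_sum n : (n <= N)%N -> mu.-integrable D (EFin \o (fun r => \sum_(0 <= i < n) a i * w i r)) /\
    \int[mu]_(r in D) (\sum_(0 <= i < n) a i * w i r) = \sum_(0 <= i < n) a i * v i.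
  elim: n => [_|n ih nN].
    rewrite big_nil; have -> : (fun r => \sum_(0 <= i < 0) a i * w i r) = (fun=> 0).
      by apply/funext => r; rewrite big_nil.
    split; first exact: integrable0.
    by rewrite /Rintegral integral0_eq.
  have -> : (fun r => \sum_(0 <= i < n.+1) a i * w i r) =
     (fun r => \sum_(0 <= i < n) a i * w i r + a n * w n r).
    by apply/funext => r; rewrite big_nat_recr.
  have [ih1 ih2] := ih (ltnW nN).
  have iz := integrableRZ mD (a n) (iw n nN).
  split; first exact: (integrableRD mD ih1 iz).
  by rewrite RintegralD// ih2 big_nat_recr//= RintegralZl// iw.
have [i1 e1] := int_sum N (leqnn N).
have Qv : bil v v = \int[mu]_(r in D) (\sum_(0 <= i < N) a i * w i r).
  rewrite e1; apply: eq_bigr => i _; rewrite mulr_suml; apply: eq_bigr => j _; ring.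
have IG0 : 0 <= \int[mu]_(r in D) G r by apply: Rintegral_ge0.
have := psd v; rewrite le_eqVlt => /orP[/eqP <-|v0]; first exact: sqr_ge0.
have s0 : 0 < Num.sqrt (bil v v) by rewrite sqrtr_gt0.
have : bil v v <= Num.sqrt (bil v v) * \int[mu]_(r in D) G r.
  rewrite {1}Qv -RintegralZl//; apply: le_Rintegral => //; first exact: (integrableRZ mD _ iG).
  move=> r Dr; rewrite -vE; apply: le_trans (ler_norm _) _.
  rewrite -(@ler_pXn2r _ 2) ?nnegrE ?mulr_ge0 ?sqrtr_ge0 ?G0//.
  rewrite real_normK ?num_real// exprMn sqr_sqrtr ?psd// mulrC.
  by apply: le_trans (bil_cs _ _) _; rewrite ler_wpM2r ?psd// hG.
rewrite -{1}(sqr_sqrtr (ltW v0)) expr2 ler_pM2l// => h.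
rewrite -(sqr_sqrtr (ltW v0)) ler_pXn2r ?nnegrE ?sqrtr_ge0//.
Qed.

End psd_form.

Section grid.
Context {R : realType} {d : measure_display} {Omega : measurableType d}.
Variable P : probability Omega R.
Variables (l T H1 H2 : R) (W : R -> R -> Omega -> R).
Hypothesis hW : fractional_brownian_sheet P l T H1 H2 W.
Hypothesis HH1 : 0 < H1 <= 1 / 2.
Hypothesis HH2 : 0 < H2 <= 1 / 2.
Variables (t : R) (e0 : L2 l).
Hypotheses (hl : 0 < l) (t0 : 0 < t <= T) (e01 : inner e0 e0 = 1).
Implicit Types (a b : nat -> R) (n i j : nat).

(** The step approximation, on an n by n grid, of the integrand b(y) a(tau)
    e0. *)
Definition grid_terms n b a : seq (rect_term l) :=
  [seq RectTerm ((b i * a j) *: e0) (i%:R * (l / n%:R)) (i.+1%:R * (l / n%:R))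
     (j%:R * (t / n%:R)) (j.+1%:R * (t / n%:R)) | i <- index_iota 0 n, j <- index_iota 0 n].

Lemma sum_grid n b a (f : rect_term l -> R) : \sum_(q <- grid_terms n b a) f q =
  \sum_(0 <= i < n) \sum_(0 <= j < n)
    f (RectTerm ((b i * a j) *: e0) (i%:R * (l / n%:R)) (i.+1%:R * (l / n%:R))
     (j%:R * (t / n%:R)) (j.+1%:R * (t / n%:R))).
Proof. by rewrite /grid_terms big_allpairs_dep. Qed.

Lemma grid_mem n i (L : R) : 0 < L -> (i < n)%N ->
  [/\ 0 <= i%:R * (L / n%:R), i%:R * (L / n%:R) <= i.+1%:R * (L / n%:R) &
      i.+1%:R * (L / n%:R) <= L].
Proof.
move=> L0 ilt; have n0 : 0 < n%:R :> R by rewrite ltr0n; exact: leq_ltn_trans ilt.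
have h0 : 0 <= L / n%:R by rewrite divr_ge0 ?ltW.
split; first by rewrite mulr_ge0.
- by rewrite ler_wpM2r// ler_nat.
- by rewrite mulrCA ler_piMr ?(ltW L0)// ler_pdivrMr// mul1r ler_nat.
Qed.

Lemma grid_rect n b a : all (rect_in t) (grid_terms n b a).
Proof.
apply/all_allpairsP => i j iI jI.
rewrite !mem_index_iota in iI jI; have [_ hi] := andP iI; have [_ hj] := andP jI.
have [a1 a2 a3] := grid_mem hl hi; have [b1 b2 b3] := grid_mem (andP t0).1 hj.
by rewrite /rect_in /= a1 a2 a3 b1 b2 b3.
Qed.

Lemma pairing_grid n b a N1 N2 : pairing e0 N1 N2 (grid_terms n b a) =
  (\sum_(0 <= i < n) b i * (N1 (i.+1%:R * (l / n%:R)) - N1 (i%:R * (l / n%:R)))) *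
  (\sum_(0 <= j < n) a j * (N2 (j.+1%:R * (t / n%:R)) - N2 (j%:R * (t / n%:R)))).
Proof.
rewrite /pairing sum_grid mulr_suml; apply: eq_bigr => i _.
rewrite mulr_sumr; apply: eq_bigr => j _ /=; rewrite innerZl e01; ring.
Qed.

Lemma tT : t \in `[0, T]. Proof. by have [a1 a2] := andP t0; rewrite in_itv/= a2 ltW. Qed.

(** The covariance of the sheet is a tensor product, so the variance of a
    separable integrand factors into a spatial form and a temporal form. *)
Lemma variance_grid n b a :
  dot P (scalar_integral W e0 (grid_terms n b a)) (scalar_integral W e0 (grid_terms n b a)) =
   fbm_form H1 (l / n%:R) n b * fbm_form H2 (t / n%:R) n a.
Proof.
have gr := grid_rect n b a.
have rin (q : rect_term l) : rect_in t q -> in_rect l T (yl q) (yr q) (tl q) (tr q).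
  exact: (rect_in_rect tT).
rewrite (scalar_integral_dotl hW tT)//; last exact: (scalar_integral_sqi hW tT).
pose G q q' := inner (coef q) e0 * (inner (coef q') e0 *
   (fbm_inc H1 (yl q') (yr q') (yl q) (yr q) * fbm_inc H2 (tl q') (tr q') (tl q) (tr q))).
transitivity (\sum_(q <- grid_terms n b a) \sum_(q' <- grid_terms n b a) G q q').
  apply: (all_sum_in gr) => q rq; rewrite dotC (scalar_integral_dotl hW tT)//; last first.
    exact: (sheet_inc_sqi hW (rin _ rq)).
  rewrite mulr_sumr; apply: (all_sum_in gr) => q' rq'.
  by rewrite (sheet_inc_dot hW (rin _ rq') (rin _ rq)).
rewrite sum_grid /fbm_form mulr_suml; apply: eq_bigr => i _.
under eq_bigr do rewrite sum_grid.
rewrite exchange_big/= mulr_suml; apply: eq_bigr => i' _.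
rewrite mulr_sumr; apply: eq_bigr => j _; rewrite mulr_sumr; apply: eq_bigr => j' _.
rewrite /G/= !innerZl e01 (fbm_incC H1) (fbm_incC H2); ring.
Qed.

(** The form is a variance up to a positive factor: it appears in
    [variance_grid] when the spatial profile is supported in a single cell. *)
Lemma fbm_form_psd n a : 0 <= fbm_form H2 (t / n%:R) n a.
Proof.
case: n => [|n]; first by rewrite /fbm_form big_nil.
pose b i : R := (i == 0)%:R.
have := dot_ge0 P (scalar_integral W e0 (grid_terms n.+1 b a)); rewrite variance_grid.
have -> : fbm_form H1 (l / n.+1%:R) n.+1 b = (l / n.+1%:R) `^ (2 * H1).
  rewrite /fbm_form big_ltn// [X in _ + X]big_nat_cond [X in _ + X]big1 ?addr0; last first.
    move=> i /andP[/andP[i0 _] _]; rewrite big1// => j _.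
    by rewrite /b (gtn_eqF i0) !mul0r.
  rewrite big_ltn// [X in _ + X]big_nat_cond [X in _ + X]big1 ?addr0; last first.
    by move=> i /andP[/andP[i0 _] _]; rewrite /b (gtn_eqF i0) mulr0 mul0r.
  by rewrite fbm_inc_diag ?(andP HH1).1 ?divr_ge0 ?ltW// /b eqxx !mul1r.
rewrite pmulr_rge0//; apply: powR_gt0; exact: divr_gt0.
Qed.

End grid.

(** * Fractional seminorms of sampled eigenfunctions and kernels *)

Section discrete_sums.
Context {R : realType}.
Implicit Types (h c r x y L K : R) (N i j k : nat).

Lemma sum_cst_le h L N K (v : nat -> R) : 0 <= h -> N%:R * h <= L -> 0 <= K ->
  (forall i, (i < N)%N -> v i <= K) -> h * \sum_(0 <= i < N) v i <= L * K.
Proof.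
move=> h0 hN K0 hv; apply: (@le_trans _ _ (h * (N%:R * K))).
  rewrite ler_wpM2l//; apply: le_trans (ler_sum_nat _) _; first by move=> i /andP[_ iN]; exact: hv iN.
  by rewrite sumr_const_nat subn0 mulr_natl.
by rewrite mulrA (mulrC h) ler_wpM2r.
Qed.

(** A Riemann sum of the decreasing function exp (- c y) at right end points
    is below its integral. *)
Lemma sum_expR_le h c N k : 0 < c -> 0 <= h -> (k <= N)%N ->
  h * \sum_(0 <= i < N - k) expR (- (c * ((N - (i + k))%:R * h))) <= c^-1.
Proof.
move=> c0 h0 kN.
have tele i : h * expR (- (c * (i.+1%:R * h))) <=
   c^-1 * (expR (- (c * (i%:R * h))) - expR (- (c * (i.+1%:R * h)))).
  have -> : expR (- (c * (i%:R * h))) = expR (- (c * (i.+1%:R * h))) * expR (c * h).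
    by rewrite -expRD; congr expR; rewrite -natr1; ring.
  have := expR_ge1Dx (c * h); set E := expR (- _); have E0 : 0 <= E := expR_ge0 _.
  move=> hx; have -> : c^-1 * (E * expR (c * h) - E) = E * (c^-1 * (expR (c * h) - 1)) by ring.
  rewrite mulrC ler_wpM2l// ler_pdivlMl//; lra.
apply: (@le_trans _ _ (\sum_(0 <= i < N - k) c^-1 *
    (expR (- (c * ((N - k - i.+1)%:R * h))) - expR (- (c * ((N - k - i)%:R * h)))))).
  rewrite mulr_sumr; apply: ler_sum_nat => i /andP[_ iN].
  have -> : (N - (i + k) = (N - k - i.+1).+1)%N by lia.
  by apply: le_trans (tele _) _; rewrite (_ : (N - k - i = (N - k - i.+1).+1)%N)//; lia.
rewrite -mulr_sumr telescope_sumr//= subnn mul0r mulr0 oppr0 expR0 subn0.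
by rewrite ler_piMr ?invr_ge0 ?(ltW c0)// gerBl expR_ge0.
Qed.

End discrete_sums.

Section sine_form.
Context {R : realType}.
Implicit Types (a w l H : R).

(** In [fbm_form_bound] the length scale dl = 1 / w makes the terms balance:
    the sup norm and the L^2 norm of the eigenfunction are bounded and its
    derivative has size w. *)
Lemma sine_form_bound H a w l N : 0 < H <= 1 / 2 -> 0 < l -> pi / l <= w -> a ^+ 2 = 2 / l ->
  (0 < N)%N ->
  fbm_form H (l / N%:R) N (fun i => a * sin (w * (i%:R * (l / N%:R)))) <= 7 * w `^ (1 - 2 * H).
Proof.
move=> hH l0 wl a2 N0; set h := l / N%:R.
have h0 : 0 < h by rewrite divr_gt0 ?ltr0n.
have w0 : 0 < w by apply: lt_le_trans wl; rewrite divr_gt0 ?pi_gt0.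
have hN : N%:R * h = l by rewrite /h mulrC divfK// pnatr_eq0 -lt0n.
have i0 : 0 < w^-1 by rewrite invr_gt0.
have vA (i : nat) : (i < N)%N -> `|a * sin (w * (i%:R * h))| <= `|a|.
  by move=> _; rewrite normrM ler_piMr// sin_max.
have V : h * \sum_(0 <= i < N) (a * sin (w * (i%:R * h))) ^+ 2 <= l * a ^+ 2.
  apply: sum_cst_le; rewrite ?hN ?sqr_ge0 ?(ltW h0)// => i iN.
  rewrite -[leRHS]real_normK ?num_real// -[leLHS]real_normK ?num_real//.
  by rewrite ler_pXn2r ?nnegrE// vA.
have K0 : 0 <= a ^+ 2 * w ^+ 2 := mulr_ge0 (sqr_ge0 _) (sqr_ge0 _).
have L k : h * \sum_(0 <= i < N - k) (a * sin (w * ((i + k)%:R * h)) - a * sin (w * (i%:R * h))) ^+ 2 <=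
    (k%:R * h) ^+ 2 * (l * (a ^+ 2 * w ^+ 2)).
  rewrite mulrCA; apply: sum_cst_le; rewrite ?(ltW h0) ?(mulr_ge0 (sqr_ge0 _) K0)//.
    by rewrite -hN ler_wpM2r ?(ltW h0)// ler_nat leq_subr.
  move=> i _; rewrite -mulrBr exprMn [leRHS]mulrCA ler_wpM2l ?sqr_ge0//.
  rewrite -exprMn -[leRHS]real_normK ?num_real// -[leLHS]real_normK ?num_real//.
  rewrite ler_pXn2r ?nnegrE//; apply: le_trans (sin_lip _ _) _.
  by rewrite -mulrBr -mulrBl natrD addrAC subrr add0r mulrC.
have L0 : 0 <= l * (a ^+ 2 * w ^+ 2) := mulr_ge0 (ltW l0) K0.
apply: le_trans (fbm_form_bound hH h0 i0 L0 vA V L) _.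
have pw p q : w^-1 `^ p * w ^+ q = w `^ (q%:R - p).
  rewrite -powR_inv1 ?(ltW w0)// -powRrM -powR_mulrn ?(ltW w0)// -powRD_gt0//.
  by congr (_ `^ _); ring.
have pw0 p : w^-1 `^ p = w `^ (- p) by rewrite -[LHS]mulr1 -(expr0 w) pw sub0r.
rewrite real_normK ?num_real// a2.
have -> : l * (2 / l) = 2 by field; rewrite gt_eqF.
have -> : w^-1 `^ (2 * H) * w^-1 * (l * (2 / l * w ^+ 2)) / 2 = w^-1 `^ (2 * H) * w ^+ 1.
  by field; rewrite !gt_eqF.
rewrite pw pw0 (_ : - (2 * H - 1) = 1 - 2 * H); last by ring.
have b3 : w^-1 `^ (2 * H) * (2 / l) <= w `^ (1 - 2 * H) * 1.
  have -> : w^-1 `^ (2 * H) = w `^ (1 - 2 * H) * w^-1.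
    have wi : w^-1 = w `^ (- 1) by rewrite powR_inv1// ltW.
    by rewrite pw0 wi -powRD_gt0//; congr (_ `^ _); ring.
  rewrite -mulrA ler_wpM2l ?powR_ge0// mulrC ler_pdivrMr// mul1r.
  by apply: le_trans wl; rewrite ler_wpM2r ?invr_ge0 ?(ltW l0)// pi_ge2.
have := powR_ge0 w (1 - 2 * H); move: b3; set X := w `^ (1 - 2 * H); lra.
Qed.

End sine_form.

Section sampled_kernel.
Context {R : realType}.
Local Notation leb := (@lebesgue_measure R).
Variables (T G0 GL : R) (gam : R -> R).
Hypotheses (hG : forall x, 0 <= x <= T -> `|gam x| <= G0)
  (hGL : forall x y, 0 <= x <= T -> 0 <= y <= T -> `|gam x - gam y| <= GL * `|x - y|).
Implicit Types (H t c K La dl x y r : R) (N i j k : nat).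

(** [fbm_form_bound] for gam times a time-reversed function with exponential
    decay at rate c: the factor 1 / c is the size of its squared L^2 norm. *)
Lemma sampled_form_bound H t N c K La dl (f : R -> R) : 0 < H <= 1 / 2 -> (0 < N)%N ->
  0 < t <= T -> 0 < c -> 0 <= K -> 0 <= La -> 0 < dl -> 0 <= GL ->
  (forall x, 0 < x <= T -> `|f x| <= K * expR (- (c * x))) ->
  (forall x y, 0 < x <= y -> y <= T -> `|f x - f y| <= K * expR (- (c * x)) * La * (y - x)) ->
  fbm_form H (t / N%:R) N (fun j => gam (j%:R * (t / N%:R)) * f (t - j%:R * (t / N%:R))) <=
  K ^+ 2 * (2 * dl `^ (2 * H - 1) * G0 ^+ 2 / c + dl `^ (2 * H) * G0 ^+ 2
     + dl `^ (2 * H) * dl * (GL + G0 * La) ^+ 2 / c).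
Proof.
move=> hH N0 /andP[t0 tT] c0 K0 La0 dl0 GL0 fb fl; set h := t / N%:R.
have h0 : 0 < h by rewrite divr_gt0 ?ltr0n.
have hN : N%:R * h = t by rewrite /h mulrC divfK// pnatr_eq0 -lt0n.
have T0 : 0 <= T by apply: le_trans tT; exact: ltW.
have G00 : 0 <= G0 by apply: le_trans (hG (_ : 0 <= 0 <= T)); rewrite ?normr_ge0 ?lexx.
have tj j : (j <= N)%N -> t - j%:R * h = (N - j)%:R * h.
  by move=> jN; rewrite natrB// mulrBl hN.
have jT j : (j <= N)%N -> 0 <= j%:R * h <= T.
  move=> jN; rewrite mulr_ge0 ?(ltW h0)//=; apply: le_trans tT.
  by rewrite -hN ler_wpM2r ?(ltW h0)// ler_nat.
have jT' j : (j < N)%N -> 0 < (N - j)%:R * h <= T.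
  move=> jN; rewrite mulr_gt0 ?ltr0n ?subn_gt0//=; apply: le_trans tT.
  by rewrite -hN ler_wpM2r ?(ltW h0)// ler_nat leq_subr.
have E1 x : 0 <= x -> expR (- (c * x)) ^+ 2 <= expR (- (c * x)).
  move=> x0; rewrite expr2 ler_piMr ?expR_ge0//.
  by rewrite -expR0 ler_expR oppr_le0 mulr_ge0 ?(ltW c0).
have E2 x : 0 <= x -> expR (- (c * x)) <= 1.
  by move=> x0; rewrite -expR0 ler_expR oppr_le0 mulr_ge0 ?(ltW c0).
have vA (j : nat) : (j < N)%N -> `|gam (j%:R * h) * f (t - j%:R * h)| <= G0 * K * expR (- (c * ((N - j)%:R * h))).
  move=> jN; rewrite normrM (tj _ (ltnW jN)) -mulrA; apply: ler_pM => //.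
    by apply: hG; apply: jT; exact: ltnW.
  by apply: fb; exact: jT'.
have A (j : nat) : (j < N)%N -> `|gam (j%:R * h) * f (t - j%:R * h)| <= G0 * K.
  move=> jN; apply: le_trans (vA _ jN) _; rewrite ler_piMr ?mulr_ge0// E2// mulr_ge0 ?(ltW h0)//.
have sqle (z b x : R) : 0 <= b -> 0 <= x -> `|z| <= b * expR (- (c * x)) -> z ^+ 2 <= b ^+ 2 * expR (- (c * x)).
  move=> b0 x0 hz; rewrite -[leLHS]real_normK ?num_real//.
  apply: (@le_trans _ _ ((b * expR (- (c * x))) ^+ 2)).
    by rewrite ler_pXn2r ?nnegrE ?mulr_ge0 ?expR_ge0.
  by rewrite exprMn ler_wpM2l ?sqr_ge0// E1.
have V : h * \sum_(0 <= i < N) (gam (i%:R * h) * f (t - i%:R * h)) ^+ 2 <= (G0 * K) ^+ 2 / c.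
  apply: (@le_trans _ _ ((G0 * K) ^+ 2 * (h * \sum_(0 <= i < N - 0) expR (- (c * ((N - (i + 0))%:R * h)))))).
    rewrite mulrCA ler_wpM2l ?(ltW h0)// mulr_sumr subn0; apply: ler_sum_nat => i /andP[_ iN].
    rewrite addn0; apply: (sqle _ _ _ _ _ (vA _ iN)); first exact: mulr_ge0.
    by apply: mulr_ge0 => //; exact: ltW.
  by rewrite ler_wpM2l ?sqr_ge0// sum_expR_le// ltW.
have B0 : 0 <= K * (GL + G0 * La) by rewrite mulr_ge0// addr_ge0// mulr_ge0.
have L k : h * \sum_(0 <= i < N - k) (gam ((i + k)%:R * h) * f (t - (i + k)%:R * h) - gam (i%:R * h) * f (t - i%:R * h)) ^+ 2 <=
    (k%:R * h) ^+ 2 * ((K * (GL + G0 * La)) ^+ 2 / c).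
  have [Nk|kN] := ltnP N k.
    have -> : (N - k = 0)%N by apply/eqP; rewrite subn_eq0 ltnW.
    by rewrite big_nil mulr0 mulr_ge0 ?sqr_ge0// divr_ge0 ?sqr_ge0 ?(ltW c0).
  have kh0 : 0 <= k%:R * h by rewrite mulr_ge0 ?(ltW h0).
  apply: (@le_trans _ _ ((k%:R * h * (K * (GL + G0 * La))) ^+ 2 *
     (h * \sum_(0 <= i < N - k) expR (- (c * ((N - (i + k))%:R * h)))))).
    rewrite mulrCA ler_wpM2l ?(ltW h0)// mulr_sumr; apply: ler_sum_nat => i /andP[_ iN].
    have iN1 : (i < N)%N := leq_trans iN (leq_subr _ _).
    have ikN : (i + k < N)%N by rewrite addnC -ltn_subRL.
    apply: sqle; rewrite ?(mulr_ge0 kh0)//; first by rewrite mulr_ge0 ?(ltW h0).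
    rewrite (tj _ (ltnW ikN)) (tj _ (ltnW iN1)).
    set x := (N - (i + k))%:R * h; set y := (N - i)%:R * h.
    have yx : y - x = k%:R * h.
      by rewrite /x /y -mulrBl -natrB; [congr (_%:R * _); clear -ikN; lia|clear -ikN; lia].
    have -> : gam ((i + k)%:R * h) * f x - gam (i%:R * h) * f y =
       (gam ((i + k)%:R * h) - gam (i%:R * h)) * f x + gam (i%:R * h) * (f x - f y) by ring.
    have -> : k%:R * h * (K * (GL + G0 * La)) * expR (- (c * x)) =
      GL * (k%:R * h) * (K * expR (- (c * x))) + G0 * (K * expR (- (c * x)) * La * (y - x)).
      by rewrite yx; ring.
    apply: le_trans (ler_normD _ _) _; rewrite !normrM; apply: lerD; apply: ler_pM => //.
    - apply: le_trans (hGL (jT _ (ltnW ikN)) (jT _ (ltnW iN1))) _.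
      by rewrite -mulrBl natrD addrAC subrr add0r ger0_norm.
    - by apply: fb; exact: jT'.
    - by apply: hG; apply: jT; exact: ltnW.
    - apply: fl; last by have /andP[] := jT' _ iN1.
      by have /andP[-> _] := jT' _ ikN; rewrite -subr_ge0 yx.
  have -> : (k%:R * h * (K * (GL + G0 * La))) ^+ 2 = (k%:R * h) ^+ 2 * (K * (GL + G0 * La)) ^+ 2.
    by rewrite exprMn.
  rewrite -[leLHS]mulrA; apply: ler_wpM2l; first exact: sqr_ge0.
  apply: ler_wpM2l; first exact: sqr_ge0.
  by rewrite sum_expR_le// ltW.
have L0 : 0 <= (K * (GL + G0 * La)) ^+ 2 / c by rewrite divr_ge0 ?sqr_ge0 ?(ltW c0).
have v0 := fbm_form_bound hH h0 dl0 L0 A V L.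
apply: le_trans v0 _.
rewrite !exprMn.
set g2 := G0 ^+ 2; set k2 := K ^+ 2; set b2 := (GL + G0 * La) ^+ 2.
have D : dl `^ (2 * H) * dl * (k2 * b2 / c) / 2 <= dl `^ (2 * H) * dl * (k2 * b2 / c).
  rewrite ler_pdivrMr// ler_peMr ?ler1n//.
  have k20 : 0 <= k2 := sqr_ge0 _; have b20 : 0 <= b2 := sqr_ge0 _.
  apply: mulr_ge0; first by rewrite mulr_ge0 ?powR_ge0 ?(ltW dl0).
  by rewrite divr_ge0 ?(ltW c0)// mulr_ge0.
apply: le_trans (lerD (lexx _) D) _.
by rewrite le_eqVlt; apply/orP; left; apply/eqP; ring.
Qed.

Section kernel.
Variables (al be mu la kap phi : R).
Hypotheses (hbe : 0 < be) (hbeal : be <= al) (hal : al < 1)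
  (hmu : 0 < mu) (hla : 0 <= la) (hkap : 0 < kap) (hphi : pi / 2 < phi < pi) (hT : 0 < T)
  (GL0 : 0 <= GL).
Implicit Types (psi rs m : R).

Local Notation ray := (ray_osc al be mu la).
Local Notation arc := (arc_osc al be mu la).
Local Notation ac := (amp_const al mu phi).
Local Notation p := (decay_rate phi).

Definition ray_form_const : R := 2 * ac * Num.sqrt
  (2 * G0 ^+ 2 / p + G0 ^+ 2 + (GL / kap + 2 * G0) ^+ 2 / p).

(** With the length scale dl = 1 / r in [sampled_form_bound], all terms scale
    like r^(- 2 H). *)
Lemma ray_form H rs psi m t N r : 0 < H <= 1 / 2 -> 0 < rs -> 0 <= m <= 1 -> `|psi| = phi ->
  (0 < N)%N -> 0 < t <= T -> kap <= r ->
  fbm_form H (t / N%:R) N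
    (fun j => gam (j%:R * (t / N%:R)) * ray rs psi (t - j%:R * (t / N%:R)) r) <=
  (ray_form_const * (rs `^ (- m) * r `^ (- 1 - (H - al * m)))) ^+ 2.
Proof.
move=> hH rs0 hm hpsi N0 tI kr; have r0 := lt_le_trans hkap kr.
have p0 : 0 < p := decay_rate_gt0 hphi.
have a0 := amp_const_gt0 hbe hbeal hal hmu hphi.
pose K := 2 * (ac * rs `^ (- m) * r `^ (al * m - 1)).
have c0 : 0 < p * r by rewrite mulr_gt0.
have K0 : 0 <= K by rewrite /K; nonneg.
have La0 : 0 <= 2 * r by rewrite mulr_ge0 ?(ltW r0).
have dl0 : 0 < r^-1 by rewrite invr_gt0.
have fb x : 0 < x <= T -> `|ray rs psi x r| <= K * expR (- (p * r * x)).
  by move=> _; rewrite -mulrA; exact: ray_bound.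
have fl x y : 0 < x <= y -> y <= T ->
   `|ray rs psi x r - ray rs psi y r| <= K * expR (- (p * r * x)) * (2 * r) * (y - x).
  move=> /andP[_ xy] _; have := ray_lip hbe hbeal hal hmu hla hphi rs0 hm r0 hpsi xy.
  by rewrite [`|x - y|]distrC (ger0_norm (_ : 0 <= y - x)) ?subr_ge0// -[p * r * x]mulrA.
apply: le_trans (sampled_form_bound hH N0 tI c0 K0 La0 dl0 GL0 fb fl) _.
have pr q : r^-1 `^ q = r `^ (- q) by rewrite -powR_inv1 ?(ltW r0)// -powRrM mulN1r.
have ri : r^-1 = r `^ (- 1) by rewrite powR_inv1// ltW.
have -> : r `^ (- 1 - (H - al * m)) = r `^ (al * m - 1) * r `^ (- H).
  by rewrite -powRD_gt0//; congr (_ `^ _); ring.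
have r2H : (r `^ (- H)) ^+ 2 = r `^ (- (2 * H)).
  by rewrite -powR_mulrn ?powR_ge0// -powRrM; congr (_ `^ _); ring.
have S0 : 0 <= 2 * G0 ^+ 2 / p + G0 ^+ 2 + (GL / kap + 2 * G0) ^+ 2 / p.
  exact: (addr_ge0 (addr_ge0 (divr_ge0 (mulr_ge0 (ler0n _ 2) (sqr_ge0 _)) (ltW p0)) (sqr_ge0 _)) (divr_ge0 (sqr_ge0 _) (ltW p0))).
have -> : (ray_form_const * (rs `^ (- m) * (r `^ (al * m - 1) * r `^ (- H)))) ^+ 2 =
   K ^+ 2 * (r `^ (- (2 * H)) * (2 * G0 ^+ 2 / p + G0 ^+ 2 + (GL / kap + 2 * G0) ^+ 2 / p)).
  rewrite -r2H -[X in _ = _ * (_ * X)](sqr_sqrtr S0) /K /ray_form_const; ring.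
rewrite ler_wpM2l ?sqr_ge0// !pr.
have -> : r `^ (- (2 * H - 1)) = r `^ (- (2 * H)) * r.
  by rewrite -{3}(powRr1 (ltW r0)) -powRD_gt0//; congr (_ `^ _); ring.
set X := r `^ (- (2 * H)); have X0 : 0 <= X := powR_ge0 _ _.
have -> : 2 * (X * r) * G0 ^+ 2 / (p * r) + X * G0 ^+ 2 + X * r^-1 * (GL + G0 * (2 * r)) ^+ 2 / (p * r)
  = X * (2 * G0 ^+ 2 / p + G0 ^+ 2 + (GL / r + 2 * G0) ^+ 2 / p).
  by field; rewrite !gt_eqF.
rewrite ler_wpM2l// lerD2l ler_wpM2r ?invr_ge0 ?(ltW p0)//.
have G00 : 0 <= G0 by apply: le_trans (hG (_ : 0 <= 0 <= T)); rewrite ?normr_ge0 ?lexx ?(ltW hT).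
rewrite ler_pXn2r ?nnegrE ?addr_ge0 ?mulr_ge0 ?invr_ge0 ?(ltW r0) ?(ltW hkap)//.
by rewrite lerD2r ler_wpM2l// lef_pV2.
Qed.

Definition arc_form_const m : R := 2 * (ac * kap `^ (al * m)) * expR (kap * T) * expR T *
  Num.sqrt (2 * G0 ^+ 2 + G0 ^+ 2 + (GL + G0 * (2 * kap)) ^+ 2).

(** On the arc the integrand does not decay in time. Since x <= T, the factor
    exp (- x) can be inserted at the price of exp T, so that
    [sampled_form_bound] applies with c = 1. *)
Lemma arc_form H rs psi m t N : 0 < H <= 1 / 2 -> 0 < rs -> 0 <= m <= 1 -> `|psi| <= phi ->
  (0 < N)%N -> 0 < t <= T ->
  fbm_form H (t / N%:R) N
    (fun j => gam (j%:R * (t / N%:R)) * arc rs kap (t - j%:R * (t / N%:R)) psi) <=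
  (arc_form_const m * rs `^ (- m)) ^+ 2.
Proof.
move=> hH rs0 hm hpsi N0 tI.
have a0 := amp_const_gt0 hbe hbeal hal hmu hphi.
pose K0 := 2 * (ac * rs `^ (- m) * kap `^ (al * m)) * expR (kap * T).
have K00 : 0 <= K0 by rewrite /K0; nonneg.
pose K := K0 * expR T.
have K0' : 0 <= K by rewrite mulr_ge0 ?expR_ge0.
have La0 : 0 <= 2 * kap by rewrite mulr_ge0 ?(ltW hkap).
have eT x : x <= T -> 1 <= expR T * expR (- (1 * x)).
  by move=> xT; rewrite mul1r -expRD -expR0 ler_expR subr_ge0.
have KE x : x <= T -> K0 <= K * expR (- (1 * x)).
  by move=> xT; rewrite /K -mulrA ler_peMr ?eT.
have fb x : 0 < x <= T -> `|arc rs kap x psi| <= K * expR (- (1 * x)).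
  move=> /andP[x0 xT]; apply: le_trans (KE _ xT).
  by apply: arc_bound => //; rewrite (ltW x0).
have fl x y : 0 < x <= y -> y <= T ->
   `|arc rs kap x psi - arc rs kap y psi| <= K * expR (- (1 * x)) * (2 * kap) * (y - x).
  move=> /andP[x0 xy] yT; have xT := le_trans xy yT.
  have yx0 : 0 <= y - x by rewrite subr_ge0.
  have xI : 0 <= x <= T by rewrite (ltW x0).
  have yI : 0 <= y <= T by rewrite (ltW (lt_le_trans x0 xy)).
  apply: le_trans (arc_lip hbe hbeal hal hmu hla hkap hphi rs0 hm xI yI hpsi) _.
  rewrite [`|x - y|]distrC (ger0_norm yx0) ler_wpM2r// ler_wpM2r//.
  exact: KE.
apply: le_trans (sampled_form_bound hH N0 tI ltr01 K0' La0 ltr01 GL0 fb fl) _.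
rewrite !powR1 !divr1 !mulr1 !mul1r.
have S0 : 0 <= 2 * G0 ^+ 2 + G0 ^+ 2 + (GL + G0 * (2 * kap)) ^+ 2.
  exact: (addr_ge0 (addr_ge0 (mulr_ge0 (ler0n _ 2) (sqr_ge0 _)) (sqr_ge0 _)) (sqr_ge0 _)).
rewrite -[X in _ * X](sqr_sqrtr S0) /K /K0 /arc_form_const.
by rewrite le_eqVlt; apply/orP; left; apply/eqP; ring.
Qed.

Definition kernel_form_const H m : R := (2 * pi)^-1 ^+ 2 * (3 * (ray_form_const * (kap `^ (- (H - al * m)) / (H - al * m))) ^+ 2
   + 3 * (arc_form_const m * fine (leb `[- phi, phi]%classic)) ^+ 2
   + 3 * (ray_form_const * (kap `^ (- (H - al * m)) / (H - al * m))) ^+ 2).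

(** Minkowski's inequality along the contour: r^(- H) is the size of the
    fractional seminorm of exp (- r x), and the remaining power r^(al m - 1 -
    H) is integrable on the rays because al m < H. The bound keeps the decay
    rs^(- m) and is uniform in the grid. *)
Lemma kernel_form H rs m t N : 0 < H <= 1 / 2 -> 0 < rs -> 0 <= m <= 1 -> al * m < H ->
  (0 < N)%N -> 0 < t <= T -> (forall v, 0 <= fbm_form H (t / N%:R) N v) ->
  fbm_form H (t / N%:R) N (fun j => gam (j%:R * (t / N%:R)) *
     ukernel al be mu la kap phi rs (t - j%:R * (t / N%:R))) <=
  kernel_form_const H m * (rs `^ (- m)) ^+ 2.
Proof.
move=> hH rs0 hm amH N0 tI psd; set h := t / N%:R.
have [t0 tT] := andP tI.
have h0 : 0 < h by rewrite divr_gt0 ?ltr0n.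
have hN : N%:R * h = t by rewrite /h mulrC divfK// pnatr_eq0 -lt0n.
have xI j : (j < N)%N -> 0 < t - j%:R * h <= T.
  move=> jN; rewrite -{1}hN -mulrBl mulr_gt0 ?subr_gt0 ?ltr_nat//=.
  by apply: le_trans tT; rewrite gerBl mulr_ge0// ltW.
have [n1 n2] := norm_phi hphi.
pose c i j := fbm_inc H (i%:R * h) (i.+1%:R * h) (j%:R * h) (j.+1%:R * h).
have cC i j : c i j = c j i by exact: fbm_incC.
have formE v : fbm_form H h N v = bil N c v v by [].
have psd' v : 0 <= bil N c v v by rewrite -formE.
pose I psi j := \int[leb]_(r in `[kap, +oo[) (gam (j%:R * h) * ray rs psi (t - j%:R * h) r).
pose J j := \int[leb]_(psi in `[- phi, phi]) (gam (j%:R * h) * arc rs kap (t - j%:R * h) psi).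
have m0 : 0 <= (0 : R) <= 1 by rewrite lexx ler01.
have mnu : al * 0 < 1 <= (1 : R) by rewrite mulr0 ltr01 lexx.
have mDr : measurable (`[kap, +oo[%classic : set (measurableTypeR R)) by [].
have mDa : measurable (`[- phi, phi]%classic : set (measurableTypeR R)) by [].
have iray psi j : `|psi| = phi -> (j < N)%N ->
    leb.-integrable `[kap, +oo[ (EFin \o ray rs psi (t - j%:R * h)).
  move=> hpsi /xI /andP[x0 _].
  exact: (ray_decay hbe hbeal hal hmu hla hkap hphi rs0 m0 mnu x0 hpsi).1.
have iarc j : (j < N)%N -> leb.-integrable `[- phi, phi] (EFin \o arc rs kap (t - j%:R * h)).
  move=> /xI /andP[x0 xT].
  by apply: (arc_int hbe hbeal hal hmu hla hkap hphi rs0 m0 (T := T) _).1; rewrite (ltW x0).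
have -> : fbm_form H h N (fun j => gam (j%:R * h) * ukernel al be mu la kap phi rs (t - j%:R * h)) =
   bil N c (fun j => (2 * pi)^-1 * (- I (- phi) j + J j + I phi j))
           (fun j => (2 * pi)^-1 * (- I (- phi) j + J j + I phi j)).
  have E j : (j < N)%N -> gam (j%:R * h) * ukernel al be mu la kap phi rs (t - j%:R * h) =
      (2 * pi)^-1 * (- I (- phi) j + J j + I phi j).
    move=> jN; rewrite /I /J !RintegralZl//; try exact: iarc; try exact: iray.
    by rewrite /ukernel; ring.
  by apply: eq_big_nat => i /andP[_ iN]; apply: eq_big_nat => j /andP[_ jN]; rewrite !E.
apply: le_trans (bil_sum3 cC psd' _ _ _ _) _.
rewrite /kernel_form_const -[leRHS]mulrA ler_wpM2l ?sqr_ge0//.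
have Hm0 : 0 < H - al * m by rewrite subr_gt0.
have [ti te] := tail_powR Hm0 hkap.
have rc0 : 0 <= ray_form_const.
  have a0 := amp_const_gt0 hbe hbeal hal hmu hphi.
  by rewrite /ray_form_const mulr_ge0 ?sqrtr_ge0// mulr_ge0// ltW.
have ac0 : 0 <= arc_form_const m.
  have a0 := amp_const_gt0 hbe hbeal hal hmu hphi.
  rewrite /arc_form_const; apply: mulr_ge0; last exact: sqrtr_ge0; by nonneg.
have rayQ psi : `|psi| = phi -> bil N c (I psi) (I psi) <=
    (ray_form_const * (kap `^ (- (H - al * m)) / (H - al * m))) ^+ 2 * rs `^ (- m) ^+ 2.
  move=> hpsi.
  pose G r := ray_form_const * rs `^ (- m) * r `^ (- 1 - (H - al * m)).
  have iG : leb.-integrable `[kap, +oo[ (EFin \o G) by exact: integrableRZ.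
  apply: le_trans (bil_minkowski cC psd' mDr (w := fun j r => gam (j%:R * h) * ray rs psi (t - j%:R * h) r) (G := G) _ iG _ _) _.
  - by move=> j jN; apply: integrableRZ => //; exact: iray.
  - move=> r; rewrite /= in_itv/= andbT => kr; rewrite -formE /G -mulrA.
    exact: ray_form.
  - by move=> r _; exact: (mulr_ge0 (mulr_ge0 rc0 (powR_ge0 _ _)) (powR_ge0 _ _)).
  - by rewrite /G RintegralZl// te; rewrite le_eqVlt; apply/orP; left; apply/eqP; ring.
have arcQ : bil N c J J <= (arc_form_const m * fine (leb `[- phi, phi]%classic)) ^+ 2 * rs `^ (- m) ^+ 2.
  pose G (psi : R) := arc_form_const m * rs `^ (- m).
  have G00 : 0 <= arc_form_const m * rs `^ (- m) by rewrite mulr_ge0 ?powR_ge0.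
  have mG : measurable_fun `[- phi, phi] (G : measurableTypeR R -> R) by exact: measurable_cst.
  have bG psi : [set` `[- phi, phi]] psi -> `|G psi| <= arc_form_const m * rs `^ (- m).
    by move=> _; rewrite ger0_norm.
  have iG := bounded_integrableR mDa (lebesgue_itv_lty _ _ _ _) mG bG.
  have leG := Rintegral_le_cst mDa (lebesgue_itv_lty _ _ _ _) mG bG.
  apply: le_trans (bil_minkowski cC psd' mDa (w := fun j r => gam (j%:R * h) * arc rs kap (t - j%:R * h) r) (G := G) _ iG _ _) _.
  - by move=> j jN; apply: integrableRZ => //; exact: iarc.
  - move=> psi; rewrite /= in_itv/= => /andP[p1 p2]; rewrite -formE.
    by apply: arc_form => //; rewrite ler_norml p1.
  - by move=> r _.
  - rewrite -[leLHS]real_normK ?num_real// -exprMn.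
    have f0 : 0 <= fine (leb `[- phi, phi]%classic) by rewrite fine_ge0.
    apply: lerXn2r; rewrite ?nnegrE ?normr_ge0//.
      exact: (mulr_ge0 (mulr_ge0 ac0 f0) (powR_ge0 _ _)).
    by apply: le_trans leG _; rewrite le_eqVlt; apply/orP; left; apply/eqP; ring.
have := rayQ _ n1; have := rayQ _ n2; move: arcQ.
set a1 := bil N c J J; set a2 := bil N c _ _; set a3 := bil N c _ _; lra.
Qed.

End kernel.
End sampled_kernel.

(** * Riemann sums *)

Section interval.
Context {R : realType}.
Local Notation leb := (@lebesgue_measure R).
Implicit Types (L a b x y h C M : R) (f g n N : R -> R).

Lemma continuous_bounded n L : 0 < L -> continuous n ->
  exists2 M : R, 0 <= M & forall x, x \in `[0, L] -> `|n x| <= M.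
Proof.
move=> L0 cn.
have cn' : {within `[0, L], continuous (fun x => `|n x|)}.
  apply: continuous_subspaceT => x; apply: (@continuous_comp _ _ _ n); first exact: cn.
  exact: norm_continuous.
have [c _ hc] := EVT_max (ltW L0) cn'.
by exists `|n c|.
Qed.

Lemma integrable_lebD L f : measurable_fun setT f -> leb.-integrable `]0, L[ (EFin \o f) ->
  (lebD L).-integrable setT (EFin \o f).
Proof.
move=> mf /integrableP[_ h]; apply/integrableP; split; first exact/measurable_EFinP.
by rewrite /lebD integral_mrestr.
Qed.

Lemma integrable_lebD_itv L f : (lebD L).-integrable setT (EFin \o f) ->
  leb.-integrable `]0, L[ (EFin \o f).
Proof.
move=> /integrableP[mf h]; apply/integrableP; split; first exact: measurable_funTS.
by move: h; rewrite /lebD integral_mrestr.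
Qed.

Lemma dot_lebD L f g : dot (lebD L) f g = \int[leb]_(x in `]0, L[) (f x * g x).
Proof. by rewrite /dot /Rintegral /lebD integral_mrestr. Qed.

Lemma sqi_bounded L f C : measurable_fun setT f ->
  (forall x, x \in `]0, L[ -> `|f x| <= C) -> sqi (lebD L) f.
Proof.
move=> mf hf; split => //; apply: integrable_lebD; first exact: measurable_funX.
apply: (@bounded_integrableR _ _ _ leb _ _ (C ^+ 2)) => //.
- exact: lebesgue_itv_lty.
- by apply: measurable_funTS; exact: measurable_funX.
- by move=> x Dx; rewrite normrX lerXn2r ?nnegrE ?(le_trans (normr_ge0 _) (hf x Dx))// hf.
Qed.

Lemma sqi_continuous L n : 0 < L -> continuous n -> sqi (lebD L) n.
Proof.
move=> L0 cn; have [M _ hM] := continuous_bounded L0 cn.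
apply: (sqi_bounded (C := M)); first exact: continuous_measurable_fun.
by move=> x; rewrite in_itv/= => /andP[x0 xL]; apply: hM; rewrite in_itv/= !ltW.
Qed.

Lemma sqi_itv L a b : sqi (lebD L) (\1_(`]a, b]) : R -> R).
Proof.
apply: (sqi_bounded (C := 1)); first exact: measurable_indic.
by move=> x _; rewrite indicE; case: (_ \in _); rewrite ?normr1 ?normr0.
Qed.

Lemma dot_itv L a b n N : 0 <= a -> a <= b -> b <= L -> continuous n ->
  (forall x, is_derive x 1 N (n x)) ->
  dot (lebD L) (\1_(`]a, b])) n = N b - N a.
Proof.
move=> a0 ab bL cn dN; rewrite dot_lebD.
have -> : \int[leb]_(x in `]0, L[) (\1_(`]a, b]) x * n x) =
    \int[leb]_(x in `]0, L[ `&` `]a, b]) n x.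
  rewrite Rintegral_mkcondr; apply: eq_Rintegral => x _.
  by rewrite patchE indicE; case: ifP => _; rewrite ?mul1r ?mul0r.
have mn D : measurable_fun D n by apply: measurable_funTS; exact: continuous_measurable_fun.
move: ab; rewrite le_eqVlt => /orP[/eqP ->|ab].
  by rewrite subrr set_itvoc0 ?setI0 ?Rintegral_set0// ltxx.
have -> : \int[leb]_(x in `]0, L[ `&` `]a, b]) n x = \int[leb]_(x in `[a, b]) n x.
  rewrite /Rintegral; congr fine.
  have [->|bL'] := eqVneq b L.
    have -> : `]0, L[ `&` `]a, L] = `]a, L[%classic.
      apply/seteqP; split => x /=; rewrite !in_itv/=.
        by move=> [/andP[_ ->] /andP[-> _]].
      by move=> /andP[ax xL]; rewrite (le_lt_trans a0 ax) xL ax ltW.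
    by rewrite [RHS]integral_itv_bndoo//; exact/measurable_EFinP.
  have -> : `]0, L[ `&` `]a, b] = `]a, b]%classic.
    apply/seteqP; split => x /=; rewrite !in_itv/=; first by move=> [].
    move=> /andP[ax xb]; rewrite (le_lt_trans a0 ax) ax xb; split => //.
    by rewrite (le_lt_trans xb)// lt_neqAle bL'.
  have B (i j : bool) := @integral_itv_bndoo R a b (EFin \o n) i j ((measurable_EFinP _ _).2 (mn _)).
  exact: etrans (B false false) (esym (B true false)).
rewrite /Rintegral (@continuous_FTC2 _ n N)//.
- exact: continuous_subspaceT.
- split; first by move=> x _; exact: (@ex_derive _ _ _ _ _ _ _ (dN x)).
  + by apply: cvg_at_right_filter; exact: is_derive_cont (dN a).
  + by apply: cvg_at_left_filter; exact: is_derive_cont (dN b).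
- by move=> x _; rewrite derive1E; have [_ ->] := dN x.
Qed.

Lemma grid_step h k y : 0 < h -> 0 < y <= k%:R * h -> exists2 j, (j < k)%N &
  j%:R * h < y <= j.+1%:R * h /\
  forall f, \sum_(0 <= i < k) f i%:R * \1_(`](i%:R * h), (i.+1%:R * h)]) y = f j%:R.
Proof.
move=> h0 /andP[y0 yk].
have ex : exists m, y <= m%:R * h by exists k.
case: (ex_minnP ex) => m ym mmin.
have m0 : (0 < m)%N.
  by case: m ym {mmin} => // ; rewrite mul0r leNgt y0.
exists m.-1; first by rewrite prednK//; exact: mmin.
have lo : m.-1%:R * h < y.
  by rewrite ltNge; apply/negP => /mmin; rewrite -ltnS prednK// ltnn.
rewrite prednK//; split; first by rewrite lo.
move=> f; have mk : (m.-1 < k)%N by rewrite prednK//; exact: mmin.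
rewrite (bigD1_seq m.-1)/= ?mem_index_iota ?iota_uniq//.
rewrite indicE mem_set/= ?in_itv/= ?prednK ?lo// mulr1 big1 ?addr0// => i im.
rewrite indicE memNset ?mulr0//= in_itv/= => /andP[h1 h2].
have i1 : (m <= i.+1)%N by apply: mmin.
have i2 : (i < m)%N.
  by rewrite -(ltr_nat R) -(ltr_pM2r h0); exact: lt_le_trans h1 ym.
move: im; rewrite (_ : i = m.-1) ?eqxx//; lia.
Qed.

(** The sum is exactly the integral of n against a step function. Its distance
    to f is at most C h^(1/2) (L - x)^(- 3/4) for the mesh h, and the
    singularity at L is integrable. *)
Lemma riemann_holder L C A f : 0 < L -> 0 <= C -> measurable_fun setT f ->
  (forall x, 0 <= x < L -> `|f x| <= A) ->
  (forall x y, 0 <= x <= y -> y < L ->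
     `|f x - f y| <= C * ((y - x) `^ 2^-1 * (L - y) `^ (- (3 / 4)))) ->
  forall n N, continuous n -> (forall x, is_derive x 1 N (n x)) ->
  (fun k => \sum_(0 <= i < k.+1) f (i%:R * (L / k.+1%:R)) *
     (N (i.+1%:R * (L / k.+1%:R)) - N (i%:R * (L / k.+1%:R)))) @ \oo --> dot (lebD L) f n.
Proof.
move=> L0 C0 mf fA fH n N cn dN.
have [M M0 hM] := continuous_bounded L0 cn.
have oo x : x \in `]0, L[ -> 0 <= x < L by rewrite in_itv/= => /andP[/ltW -> ->].
have sn := sqi_continuous L0 cn.
have sf : sqi (lebD L) f.
  by apply: (sqi_bounded (C := A)) => // x /oo; exact: fA.
have nu : 0 <= (3 / 4 : R) < 1 by apply/andP; split; lra.
have [si sb] := singular_powR nu L0.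
set K := L `^ (1 - 3 / 4) / (1 - 3 / 4) in sb.
have mD : measurable (`]0, L[%classic : set (measurableTypeR R)) by [].
pose h k : R := L / k.+1%:R.
pose st k y := \sum_(0 <= i < k.+1) f (i%:R * h k) * \1_(`](i%:R * h k), (i.+1%:R * h k)]) y.
have h0 k : 0 < h k by rewrite divr_gt0.
have hk k : k.+1%:R * h k = L by rewrite /h mulrC divfK.
have sst k : sqi (lebD L) (st k).
  by apply: sqi_sum => i; apply: sqiZ; exact: sqi_itv.
have E k : \sum_(0 <= i < k.+1) f (i%:R * (L / k.+1%:R)) *
     (N (i.+1%:R * (L / k.+1%:R)) - N (i%:R * (L / k.+1%:R))) = dot (lebD L) (st k) n.
  rewrite /st dot_suml//; last by move=> i; apply: sqiZ; exact: sqi_itv.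
  apply: eq_big_nat => i /andP[_ ik]; rewrite dotZl//; last exact: sqi_itv.
  have [a1 a2 a3] := grid_mem L0 ik.
  by rewrite (dot_itv _ _ _ cn dN).
under eq_cvg do rewrite E.
have bnd k : `|dot (lebD L) f n - dot (lebD L) (st k) n| <= C * h k `^ 2^-1 * M * K.
  have sfst := sqiB sf (sst k).
  rewrite -dotBl// dot_lebD.
  have ifst : leb.-integrable `]0, L[ (EFin \o (fun x => (f x - st k x) * n x)).
    exact: integrable_lebD_itv (sqi_mul sfst sn).
  apply: le_trans (le_normr_Rintegral mD ifst) _.
  have iG := integrableRZ mD (C * h k `^ 2^-1 * M) si.
  apply: (@le_trans _ _ (\int[leb]_(x in `]0, L[) (C * h k `^ 2^-1 * M * (L - x) `^ (- (3 / 4))))).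
    apply: le_Rintegral => //; first exact: integrable_norm.
    move=> y yI; have /andP[y0 yL] := oo _ yI.
    have y0' : 0 < y <= k.+1%:R * h k by move: yI; rewrite hk /= in_itv/= => /andP[-> /ltW].
    have [j jk [/andP[h1 h2] hs]] := grid_step (h0 k) y0'.
    rewrite /st (hs (fun x => f (x * h k))) normrM.
    have -> : C * h k `^ 2^-1 * M * (L - y) `^ (- (3 / 4)) =
      C * (h k `^ 2^-1 * (L - y) `^ (- (3 / 4))) * M by ring.
    apply: ler_pM => //; last by apply: hM; rewrite in_itv/= y0 ltW.
    have j0 : 0 <= j%:R * h k by rewrite mulr_ge0// ltW.
    rewrite distrC; apply: le_trans (fH _ _ _ yL) _; first by rewrite j0 ltW.
    rewrite ler_wpM2l// ler_wpM2r ?powR_ge0// ge0_ler_powR ?nnegrE ?invr_ge0 ?subr_ge0 ?(ltW h1) ?(ltW (h0 k))//.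
    by move: h2; rewrite -natr1 mulrDl mul1r lerBlDl.
  by rewrite RintegralZl// ler_wpM2l// !mulr_ge0 ?powR_ge0.
apply/cvgrPdist_le => eps eps0.
have lim0 : (fun k => C * h k `^ 2^-1 * M * K) @ \oo --> (C * 0 * M * K).
  apply: cvgM; last exact: cvg_cst.
  apply: cvgM; last exact: cvg_cst.
  apply: cvgM; first exact: cvg_cst.
  have -> : (fun k => h k `^ 2^-1) = (fun k => Num.sqrt (h k)).
    by apply/funext => k; rewrite powR12_sqrt// ltW.
  rewrite -(@sqrtr0 R); apply: continuous_cvg; first exact: sqrt_continuous.
  rewrite -(mulr0 L); apply: cvgM; first exact: cvg_cst.
  exact: cvg_harmonic.
have : \forall k \near \oo, `|C * h k `^ 2^-1 * M * K| <= eps.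
  have /cvgrPdist_le /(_ _ eps0) := lim0; rewrite mulr0 !mul0r.
  by apply: filterS => k; rewrite sub0r normrN.
apply: filterS => k hk'; apply: le_trans (bnd k) _.
by apply: le_trans (ler_norm _) hk'.
Qed.

End interval.

(** * Weak limits of elementary integrands *)

Section square.
Context {R : realType}.
Local Notation leb := (@lebesgue_measure R).
Local Notation MR := (measurableTypeR R).
Variable l : R.
Implicit Types (f g h : R -> R -> R).

(** The squared norm of L^2(D x D), possibly infinite. *)
Definition sqnorm2 f : \bar R :=
  (\int[lebD l]_x \int[lebD l]_y ((f x y) ^+ 2)%:E)%E.

Definition jmeas f := measurable_fun setT (fun p : MR * MR => f p.1 p.2).

Let D : set MR := `]0, l[%classic.
Let mD : measurable D. Proof. exact: measurable_itv. Qed.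
Let slice f x : \bar R := (\int[leb]_(y in D) ((f x y) ^+ 2)%:E)%E.

Lemma sqnorm2E f : sqnorm2 f = (\int[leb]_(x in D) slice f x)%E.
Proof.
rewrite /sqnorm2 /lebD integral_mrestr; apply: eq_integral => x _.
by rewrite integral_mrestr.
Qed.

Lemma sqnorm2_eq f g : (forall x y, x \in `]0, l[ -> y \in `]0, l[ -> f x y = g x y) ->
  sqnorm2 f = sqnorm2 g.
Proof.
move=> fg; rewrite !sqnorm2E; apply: eq_integral => x; rewrite inE => xD.
by apply: eq_integral => y; rewrite inE => yD; rewrite fg.
Qed.

Lemma slice_ge0 f x : (0 <= slice f x)%E.
Proof. by apply: integral_ge0 => y _; rewrite lee_fin sqr_ge0. Qed.

Lemma jmeas_section f x : jmeas f -> measurable_fun setT (f x : MR -> R).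
Proof. by move=> mf; exact: (measurable_fun_pair2 x mf). Qed.

Lemma measurable_slice f : jmeas f -> measurable_fun setT (slice f).
Proof.
move=> mf.
pose F (p : MR * MR) : \bar R := ((f p.1 p.2) ^+ 2 * \1_D p.2)%:E.
have mF : measurable_fun setT F.
  apply/measurable_EFinP; apply: measurable_funM; first exact: measurable_funX.
  by apply: (measurableT_comp (f := \1_D : MR -> R)); [exact: measurable_indic|exact: measurable_snd].
have F0 p : (0 <= F p)%E by rewrite lee_fin mulr_ge0 ?sqr_ge0// indicE ler0n.
have := @measurable_fun_fubini_tonelli_F _ _ _ _ R leb _ mF F0.
rewrite /fubini_F (_ : (fun x => _) = slice f)//.
apply/funext => x; rewrite /slice [RHS]integral_mkcond; apply: eq_integral => y _.
by rewrite /F patchE indicE/=; case: ifP => _; rewrite ?mulr1 ?mulr0.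
Qed.

Lemma sqnorm2_le f g h : jmeas f -> jmeas g ->
  (forall x y, x \in `]0, l[ -> y \in `]0, l[ -> h x y = f x y + g x y) ->
  (sqnorm2 h <= 2%:E * sqnorm2 f + 2%:E * sqnorm2 g)%E.
Proof.
move=> mf mg hfg; rewrite !sqnorm2E.
have sl x : [set` `]0, l[] x -> (slice h x <= 2%:E * slice f x + 2%:E * slice g x)%E.
  move=> xD; have mfx := jmeas_section x mf; have mgx := jmeas_section x mg.
  have m2 (k : R -> R) : measurable_fun setT (k : MR -> R) ->
      measurable_fun D (fun y : MR => ((k y) ^+ 2)%:E).
    by move=> mk; apply/measurable_EFinP/measurable_funTS; exact: measurable_funX.
  rewrite /slice -!ge0_integralZl_EFin//; try exact: m2; try by move=> y _; rewrite lee_fin sqr_ge0.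
  rewrite -ge0_integralD//; first last.
  - by apply: emeasurable_funM => //; exact: m2.
  - by move=> y _; rewrite -EFinM lee_fin mulr_ge0 ?sqr_ge0.
  - by apply: emeasurable_funM => //; exact: m2.
  - by move=> y _; rewrite -EFinM lee_fin mulr_ge0 ?sqr_ge0.
  apply: ge0_le_integral_nomeas => y yD; first by rewrite lee_fin sqr_ge0.
  rewrite -!EFinM -EFinD lee_fin hfg//.
  have := sqr_ge0 (f x y - g x y); nra.
apply: (@le_trans _ _ (\int[leb]_(x in D) (2%:E * slice f x + 2%:E * slice g x))%E).
  by apply: ge0_le_integral_nomeas => // x _; exact: slice_ge0.
have ms k : jmeas k -> measurable_fun D (slice k).
  by move=> mk; apply: measurable_funTS; exact: measurable_slice.
rewrite ge0_integralD//; first last.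
- by apply: emeasurable_funM => //; exact: ms.
- by move=> x _; rewrite mule_ge0 ?slice_ge0.
- by apply: emeasurable_funM => //; exact: ms.
- by move=> x _; rewrite mule_ge0 ?slice_ge0.
rewrite !ge0_integralZl_EFin//; try exact: ms; by move=> x _; exact: slice_ge0.
Qed.

Lemma sqnorm2Z c f : jmeas f -> sqnorm2 (fun x y => c * f x y) = ((c ^+ 2)%:E * sqnorm2 f)%E.
Proof.
move=> mf; rewrite !sqnorm2E -ge0_integralZl_EFin ?sqr_ge0//; first last.
- by apply: measurable_funTS; exact: measurable_slice.
- by move=> x _; exact: slice_ge0.
apply: eq_integral => x _; rewrite /slice -ge0_integralZl_EFin ?sqr_ge0//.
- by apply: eq_integral => y _; rewrite exprMn EFinM.
- by move=> y _; rewrite lee_fin sqr_ge0.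
- apply/measurable_EFinP/measurable_funTS; apply: measurable_funX.
  exact: jmeas_section.
Qed.

(** Cauchy-Schwarz in the second variable, against n, and then in the first
    one, against e0. *)
Lemma sqnorm2_proj (f : R -> R -> R) (n e0 : MR -> R) : jmeas f -> sqi (lebD l) n -> sqi (lebD l) e0 ->
  (forall x, sqi (lebD l) (f x)) -> sqi (lebD l) (fun x => dot (lebD l) (f x) n) ->
  (((dot (lebD l) (fun x => dot (lebD l) (f x) n) e0) ^+ 2)%:E <=
     (dot (lebD l) e0 e0 * dot (lebD l) n n)%:E * sqnorm2 f)%E.
Proof.
move=> mf sn se sf; set phi := (fun x => _) => sphi.
have h1 := cauchy_schwarz sphi se.
have dotE (k : MR -> R) : sqi (lebD l) k ->
    (dot (lebD l) k k)%:E = (\int[leb]_(x in D) ((k x) ^+ 2)%:E)%E.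
  move=> [_ ik]; rewrite /dot /Rintegral fineK; last exact: integrable_fin_num ik.
  by rewrite /lebD integral_mrestr; apply: eq_integral => x _; rewrite expr2.
rewrite [X in (_ <= X * _)%E]EFinM -muleA; apply: (@le_trans _ _ ((dot (lebD l) e0 e0)%:E * (dot (lebD l) phi phi)%:E)%E).
  by rewrite -EFinM lee_fin mulrC.
apply: lee_wpmul2l; first by rewrite lee_fin dot_ge0.
have ms : measurable_fun D (slice f) by apply: measurable_funTS; exact: measurable_slice.
rewrite dotE// sqnorm2E -ge0_integralZl_EFin ?dot_ge0//; last by move=> x _; exact: slice_ge0.
apply: ge0_le_integral_nomeas => // x _; first by rewrite lee_fin sqr_ge0.
by rewrite /slice -dotE// -EFinM lee_fin mulrC; exact: cauchy_schwarz.
Qed.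

End square.

Lemma L2_sumE (R : realType) (l : R) I (r : seq I) (f : I -> L2 l) x :
  (\sum_(i <- r) f i) x = \sum_(i <- r) f i x.
Proof. by elim/big_rec2: _ => // i y1 y2 _ <-. Qed.

Lemma cvge0_le (R : realType) (u : nat -> \bar R) (eps : R) : (u n @[n --> \oo] --> 0)%E ->
  0 < eps -> \forall n \near \oo, (u n <= eps%:E)%E.
Proof.
move=> /fine_cvgP[ufin /cvgrPdist_le h] eps0; near=> n.
have un : u n \is a fin_num by near: n.
rewrite -(fineK un) lee_fin; apply: le_trans (ler_norm _) _.
rewrite -normrN -sub0r; near: n; exact: h.
Unshelve. all: by end_near. Qed.

Section weak_limit.
Context {R : realType}.
Local Notation leb := (@lebesgue_measure R).
Local Notation MR := (measurableTypeR R).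
Variables (l : R) (hl : 0 < l).
Variables (rho : nat -> R) (e : nat -> L2 l).
Hypothesis hA : dirichlet_eigenbasis rho e.
Implicit Types (p : seq (rect_term l)) (tau t c : R) (k : nat).

(** The elementary integrand as a function of time, after taking its component
    along e_k in the variable x and integrating it in y against N1'. *)
Definition elem_slice p k (N1 : R -> R) : MR -> R :=
  fun tau => \sum_(q <- p) (inner (coef q) (e k) * (N1 (yr q) - N1 (yl q))) * \1_(`]tl q, tr q]) tau.

Lemma sqi_elem_slice p k (N1 : R -> R) t : sqi (lebD t) (elem_slice p k N1).
Proof. by apply: sqi_sum => q; apply: sqiZ; exact: sqi_itv. Qed.

Lemma pairing_slice p k t (n2 N1 N2 : R -> R) : 0 < t -> all (rect_in t) p -> continuous n2 ->
  (forall x : R, is_derive x 1 N2 (n2 x)) ->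
  pairing (e k) N1 N2 p = dot (lebD t) (elem_slice p k N1) n2.
Proof.
move=> t0 rp cn dN; have sn := sqi_continuous t0 cn.
rewrite /elem_slice dot_suml//; last by move=> q; apply: sqiZ; exact: sqi_itv.
apply: (all_sum_in rp) => q /and5P[_ _ _ t00 /andP[tt trt]].
by rewrite dotZl ?(dot_itv _ _ _ cn dN)//; exact: sqi_itv.
Qed.

(** The kernel G is only known as the limit of its separable partial sums. The
    component and the pairing of a partial sum are explicit by orthonormality,
    and [sqnorm2_proj] is applied to the difference with the elementary
    integrand; the truncation error then tends to 0. *)
Lemma slice_estimate p k t (n1 N1 : R -> R) tau (v : nat -> R) (G : R -> R -> R) c :
  all (rect_in t) p -> continuous n1 -> (forall x : R, is_derive x 1 N1 (n1 x)) ->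
  jmeas G ->
  (fun m => sqnorm2 l (fun x y => G x y - \sum_(j < m) v j * e j x * e j y)) @ \oo --> 0%E ->
  (((elem_slice p k N1 tau - c * v k * dot (lebD l) (e k) n1) ^+ 2)%:E <=
     (2 * dot (lebD l) n1 n1)%:E * sqnorm2 l (fun x y => (elem_fun p tau x y - G x y * c)%R))%E.
Proof.
move=> rp cn dN mG cvG; have sn := sqi_continuous hl cn.
have ho := eigenfunction_orthonormal hA.
have me j : measurable_fun setT (e j : MR -> R) by have [] := L2_sqi (e j).
pose E x y := elem_fun p tau x y.
pose S m x y := \sum_(j < m) v j * e j x * e j y.
have mfst (f : MR -> R) : measurable_fun setT f -> jmeas (fun x y => f x).
  by move=> mf; apply: (measurableT_comp mf); exact: measurable_fst.
have msnd (f : MR -> R) : measurable_fun setT f -> jmeas (fun x y => f y).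
  by move=> mf; apply: (measurableT_comp mf); exact: measurable_snd.
have mE : jmeas E.
  rewrite /jmeas /E /elem_fun; apply: measurable_sum => q.
  apply: measurable_funM; last exact: measurable_cst.
  apply: measurable_funM; first by apply: mfst; have [] := L2_sqi (coef q).
  by apply: msnd; exact: measurable_indic.
have mS m : jmeas (S m).
  rewrite /jmeas /S; apply: measurable_sum => j.
  apply: measurable_funM; last exact: msnd.
  by apply: measurable_funM; [exact: measurable_cst|exact: mfst].
have mEG : jmeas (fun x y => (E x y - G x y * c)%R).
  by apply: measurable_funB => //; apply: measurable_funM.
have mGS m : jmeas (fun x y => (G x y - S m x y)%R).
  by apply: measurable_funB; [exact: mG|exact: mS].
pose h m x y := E x y - c * S m x y.
have mh m : jmeas (h m).
  apply: measurable_funB; [exact: mE|apply: measurable_funM; [exact: measurable_cst|exact: mS]].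
have ubnd m : (sqnorm2 l (h m) <= 2%:E * sqnorm2 l (fun x y => (E x y - G x y * c)%R) +
     2%:E * ((c ^+ 2)%:E * sqnorm2 l (fun x y => (G x y - S m x y)%R)))%E.
  rewrite -sqnorm2Z//; apply: sqnorm2_le => //.
    by apply: measurable_funM; [exact: measurable_cst|exact: mGS].
  by move=> x y _ _; rewrite /h; ring.
have secE x : E x = (fun y => \sum_(q <- p) (coef q x * \1_(`]tl q, tr q]) tau) * \1_(`]yl q, yr q]) y).
  by apply/funext => y; apply: eq_bigr => q _; ring.
have secS m x : (fun y => c * S m x y) = (fun y => \sum_(j < m) (c * v j * e j x) * e j y).
  by apply/funext => y; rewrite /S mulr_sumr; apply: eq_bigr => j _; ring.
have sE x : sqi (lebD l) (E x).
  by rewrite secE; apply: sqi_sum => q; apply: sqiZ; exact: sqi_itv.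
have sS m x : sqi (lebD l) (fun y => c * S m x y).
  by rewrite secS; apply: sqi_sum => j; apply: sqiZ; exact: L2_sqi.
have sh m x : sqi (lebD l) (h m x) by apply: sqiB.
have phiE m x : dot (lebD l) (h m x) n1 =
    (\sum_(q <- p) (\1_(`]tl q, tr q]) tau * (N1 (yr q) - N1 (yl q))) *: coef q
     - \sum_(j < m) (c * v j * dot (lebD l) (e j) n1) *: e j) x.
  rewrite dotBl// secE secS !dot_suml//; last first.
  - by move=> q; apply: sqiZ; exact: sqi_itv.
  - by move=> j; apply: sqiZ; exact: L2_sqi.
  rewrite L2_addE L2_oppE !L2_sumE; congr (_ - _).
    apply: (all_sum_in rp) => q /and5P[y0 yy yl0 _ _].
    by rewrite dotZl ?(dot_itv _ _ _ cn dN)//; [rewrite L2_scaleE; ring|exact: sqi_itv].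
  apply: eq_bigr => j _; rewrite dotZl//; last exact: L2_sqi.
  rewrite L2_scaleE; ring.
pose V m : L2 l := \sum_(q <- p) (\1_(`]tl q, tr q]) tau * (N1 (yr q) - N1 (yl q))) *: coef q
     - \sum_(j < m) (c * v j * dot (lebD l) (e j) n1) *: e j.
have pE m : (fun x : MR => dot (lebD l) (h m x) n1) = (V m : MR -> R).
  by apply/funext => x; exact: phiE.
have sphi m : sqi (lebD l) (fun x => dot (lebD l) (h m x) n1).
  by rewrite pE; exact: L2_sqi.
have lbnd m : (k < m)%N ->
  (((elem_slice p k N1 tau - c * v k * dot (lebD l) (e k) n1) ^+ 2)%:E <=
    (dot (lebD l) n1 n1)%:E * sqnorm2 l (h m))%E.
  move=> km; have := sqnorm2_proj (mh m) sn (L2_sqi (e k)) (sh m) (sphi m).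
  rewrite -innerE ho eqxx mul1r.
  suff -> : dot (lebD l) (fun x => dot (lebD l) (h m x) n1) (e k) =
     elem_slice p k N1 tau - c * v k * dot (lebD l) (e k) n1 by [].
  rewrite pE.
  rewrite -innerE innerBl !inner_suml; congr (_ - _).
    by apply: eq_bigr => q _; rewrite innerZl; ring.
  rewrite (bigD1 (Ordinal km))//= innerZl ho eqxx mulr1 big1 ?addr0// => i ik.
  by rewrite innerZl ho; have /negbTE -> : (i : nat) != k by []; rewrite mulr0.
set C := dot (lebD l) n1 n1 in lbnd *; have C0 : 0 <= C := dot_ge0 _ _.
set J := sqnorm2 _ _; have J0 : (0 <= J)%E.
  by apply: integral_ge0 => x _; apply: integral_ge0 => y _; rewrite lee_fin sqr_ge0.
apply/lee_addgt0Pr => eps eps0.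
pose del := eps / (2 * C * c ^+ 2 + 1).
have den0 : 0 < 2 * C * c ^+ 2 + 1 by rewrite ltr_wpDl// mulr_ge0 ?sqr_ge0// mulr_ge0.
have del0 : 0 < del by rewrite divr_gt0.
have : \forall m \near \oo, (sqnorm2 l (fun x y => (G x y - S m x y)%R) <= del%:E)%E.
  exact: cvge0_le.
move=> [M _ hM]; pose m := maxn M k.+1.
have km : (k < m)%N by rewrite /m leq_max leqnn orbT.
have hm : (sqnorm2 l (fun x y => (G x y - S m x y)%R) <= del%:E)%E by apply: hM; rewrite /= /m leq_max leqnn.
apply: le_trans (lbnd _ km) _.
apply: (@le_trans _ _ (C%:E * (2%:E * J + 2%:E * ((c ^+ 2)%:E * del%:E)))%E).
  apply: lee_wpmul2l; first by rewrite lee_fin.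
  apply: le_trans (ubnd m) _; rewrite leeD2l// lee_wpmul2l// lee_wpmul2l// lee_fin sqr_ge0.
  done.
rewrite ge0_muleDr ?mule_ge0 ?lee_fin ?sqr_ge0 ?(ltW del0)//.
rewrite muleA -EFinM (mulrC C 2) leeD2l// -!EFinM lee_fin.
have -> : C * (2 * (c ^+ 2 * del)) = (2 * C * c ^+ 2) * del by ring.
by rewrite /del mulrCA ler_piMr ?(ltW eps0)// ler_pdivrMr// mul1r lerDl.
Qed.

Section kernel_limit.
Variables (F : R -> R -> R -> R) (U : nat -> R -> R) (gam : R -> R).
Hypothesis mF : measurable_fun [set z : MR * (MR * MR) |
      [/\ 0 < z.1, z.2.1 \in `]0, l[ & z.2.2 \in `]0, l[]]
    (fun z => F z.1 z.2.1 z.2.2).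
Hypothesis cvF : forall t : R, 0 < t ->
  (fun n => sqnorm2 l (fun x y => F t x y - \sum_(k < n) U k t * e k x * e k y)%R)
    @ \oo --> 0%E.

(** By [slice_estimate] the squared error at time tau is at most a constant
    times the inner double integral in the definition of the Wiener integral,
    so the slices converge in L^2(]0, t[). *)
Lemma pairing_cvg (p : nat -> seq (rect_term l)) (t : R) k (w : MR -> R) A (n1 n2 N1 N2 : R -> R) :
  0 < t -> (forall n, all (rect_in t) (p n)) ->
  (fun n => \int[leb]_(tau in `]0%R, t[) sqnorm2 l
     (fun x y => elem_fun (p n) tau x y - F (t - tau) x y * gam tau)%R)%E @ \oo --> 0%E ->
  measurable_fun setT w -> (forall tau, tau \in `]0, t[ -> `|w tau| <= A) ->
  (forall tau, tau \in `]0, t[ -> w tau = gam tau * U k (t - tau)) ->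
  continuous n1 -> (forall x : R, is_derive x 1 N1 (n1 x)) ->
  continuous n2 -> (forall x : R, is_derive x 1 N2 (n2 x)) ->
  (fun n => pairing (e k) N1 N2 (p n)) @ \oo -->
     dot (lebD l) (e k) n1 * dot (lebD t) w n2.
Proof.
move=> t0 rp cvp mw wA wE cn1 dN1 cn2 dN2.
have sn1 := sqi_continuous hl cn1; have sn2 := sqi_continuous t0 cn2.
have sw : sqi (lebD t) w by exact: sqi_bounded wA.
set C := dot (lebD l) n1 n1; have C0 : 0 <= C := dot_ge0 _ _.
set b := dot (lebD l) (e k) n1.
pose De n (tau : MR) := elem_slice (p n) k N1 tau - b * w tau.
have sD n : sqi (lebD t) (De n).
  by apply: sqiB; [exact: sqi_elem_slice|exact: sqiZ].
pose c := 2 * C + 1; have c0 : 0 < c by rewrite ltr_wpDl// mulr_ge0.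
pose J n tau := sqnorm2 l (fun x y => elem_fun (p n) tau x y - F (t - tau) x y * gam tau)%R.
have J0 n tau : (0 <= J n tau)%E.
  by apply: integral_ge0 => x _; apply: integral_ge0 => y _; rewrite lee_fin sqr_ge0.
pose sq : set (MR * MR) := (`]0, l[%classic : set MR) `*` (`]0, l[%classic : set MR).
have msq : measurable sq by apply: measurableX; exact: measurable_itv.
pose Fp s x y := if (x \in `]0, l[) && (y \in `]0, l[) then F s x y else 0.
have FpE s x y : x \in `]0, l[ -> y \in `]0, l[ -> Fp s x y = F s x y.
  by rewrite /Fp => -> ->.
have mFp s : 0 < s -> jmeas (Fp s).
  move=> s0; have : measurable_fun sq (fun z : MR * MR => F s z.1 z.2).
    pose j (z : MR * MR) : MR * (MR * MR) := (s, z).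
    pose G (z : MR * (MR * MR)) := F z.1 z.2.1 z.2.2.
    apply: (@measurable_comp _ _ _ _ _ _ [set z : MR * (MR * MR) |
      [/\ 0 < z.1, z.2.1 \in `]0, l[ & z.2.2 \in `]0, l[]] G sq j) => //.
    - rewrite (_ : [set _ | _] = (`]0, +oo[%classic : set MR) `*` sq).
        by apply: measurableX => //; exact: measurable_itv.
      apply/seteqP; split => -[a [x y]] /=; rewrite /sq/= !in_itv/= andbT.
        by move=> [].
      by move=> [? []].
    - by move=> _ [[x y] [/= xD yD] <-]; split.
    - by apply: measurable_funTS; apply: measurable_fun_pair => //; exact: measurable_cst.
  move=> /(measurable_restrictT _ msq).1; apply: eq_measurable_fun => -[x y] _ /=.
  rewrite patchE /Fp; case: ifPn => [|h]; first by rewrite inE => -[/= -> ->].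
  case: ifPn => // /andP[xD yD]; exfalso; move/negP: h; apply; rewrite inE; split => //.
have est n tau : tau \in `]0, t[ -> (((De n tau) ^+ 2 / c)%:E <= J n tau)%E.
  move=> tauI; have s0 : 0 < t - tau by move: tauI; rewrite in_itv/= subr_gt0 => /andP[].
  have JE : J n tau = sqnorm2 l (fun x y => elem_fun (p n) tau x y - Fp (t - tau) x y * gam tau)%R.
    by apply: sqnorm2_eq => x y xD yD; rewrite FpE.
  have cvS : (fun m => sqnorm2 l (fun x y => Fp (t - tau) x y - \sum_(j < m) U j (t - tau) * e j x * e j y)%R) @ \oo --> 0%E.
    have eF m : sqnorm2 l (fun x y => Fp (t - tau) x y - \sum_(j < m) U j (t - tau) * e j x * e j y)%R =
      sqnorm2 l (fun x y => F (t - tau) x y - \sum_(j < m) U j (t - tau) * e j x * e j y)%R.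
      by apply: sqnorm2_eq => x y xD yD; rewrite FpE.
    by rewrite (eq_cvg _ _ eF); exact: cvF.
  have := @slice_estimate (p n) k t n1 N1 tau (fun j => U j (t - tau)) (Fp (t - tau)) (gam tau) (rp n) cn1 dN1 (mFp _ s0) cvS.
  rewrite -JE -/C.
  have -> : elem_slice (p n) k N1 tau - gam tau * U k (t - tau) * dot (lebD l) (e k) n1 = De n tau.
    by rewrite /De wE// -/b; ring.
  move=> h; rewrite EFinM muleC lee_pdivrMl//; apply: le_trans h _.
  by apply: lee_wpmul2r => //; rewrite lee_fin /c lerDl.
have bnd n eps : (\int[leb]_(tau in `]0%R, t[) J n tau <= eps%:E)%E -> dot (lebD t) (De n) (De n) <= c * eps.
  move=> hJ; have [mDn iDn] := sD n.
  have h2 : (dot (lebD t) (De n) (De n))%:E = (\int[leb]_(tau in `]0%R, t[) ((De n tau) ^+ 2)%:E)%E.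
    rewrite /dot /Rintegral fineK; last exact: integrable_fin_num iDn.
    by rewrite /lebD integral_mrestr; apply: eq_integral => x _; rewrite expr2.
  rewrite -lee_fin h2 EFinM -lee_pdivrMl//; apply: le_trans hJ.
  rewrite -ge0_integralZl_EFin ?invr_ge0 ?(ltW c0)//; last first.
  - by apply/measurable_EFinP/measurable_funTS; exact: measurable_funX.
  - by move=> x _; rewrite lee_fin sqr_ge0.
  apply: ge0_le_integral_nomeas => //.
  - by move=> x _; rewrite -EFinM lee_fin mulr_ge0 ?sqr_ge0 ?invr_ge0 ?(ltW c0).
  - by move=> x xI; rewrite -EFinM mulrC; exact: est.
have E n : pairing (e k) N1 N2 (p n) - b * dot (lebD t) w n2 = dot (lebD t) (De n) n2.
  rewrite (pairing_slice k N1 t0 (rp n) cn2 dN2) dotBl ?dotZl//; first exact: sqi_elem_slice.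
  exact: sqiZ.
apply/cvgrPdist_le => eps eps0.
pose K := dot (lebD t) n2 n2 + 1.
have K0 : 0 < K by rewrite ltr_wpDl// dot_ge0.
have d0 : 0 < eps ^+ 2 / (c * K) by rewrite divr_gt0 ?exprn_gt0// mulr_gt0.
apply: filterS (cvge0_le cvp d0) => n hn.
rewrite distrC E -(@ler_pXn2r _ 2) ?nnegrE ?(ltW eps0)//.
rewrite real_normK ?num_real//; apply: le_trans (cauchy_schwarz (sD n) sn2) _.
apply: (@le_trans _ _ (c * (eps ^+ 2 / (c * K)) * K)).
  by apply: ler_pM; rewrite ?dot_ge0 ?bnd// lerDl.
by rewrite le_eqVlt; apply/orP; left; apply/eqP; field; rewrite !gt_eqF.
Qed.

End kernel_limit.
End weak_limit.

(** * Coordinates of random variables with values in H *)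

Section coordinates.
Context {R : realType} {d : measure_display} {Omega : measurableType d}.
Variable P : probability Omega R.
Variable l : R.
Implicit Types (X Z : Omega -> L2 l) (v : L2 l).

(** Half-spaces of H are open. *)
Lemma L2Omega_inner_measurable X v : (forall U, hopen U -> measurable (X @^-1` U)) ->
  measurable_fun setT (fun w => inner (X w) v).
Proof.
move=> mX mT; apply: (measurability _ (RGenOInfty.measurableE R)) => // _ [_ [a ->] <-].
rewrite setTI; have -> : (fun w => inner (X w) v) @^-1` `]a, +oo[%classic =
    X @^-1` [set x | a < inner x v].
  by apply/seteqP; split => w /=; rewrite in_itv/= andbT.
apply: mX => x /= ax.
have d0 : 0 < hnorm v + 1 by rewrite ltr_wpDl// hnorm_ge0.
exists ((inner x v - a) / (hnorm v + 1)); first by rewrite divr_gt0// subr_gt0.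
move=> y; rewrite ltr_pdivlMr// => hy.
have := inner_le (y - x) v; rewrite innerBl.
have := hnorm_ge0 (y - x); have := hnorm_ge0 v; rewrite ler_norml; nra.
Qed.

Lemma sqi_of_hnorm (x : Omega -> R) (Y : Omega -> L2 l) (c : R) : measurable_fun setT x -> 0 < c ->
  (forall w, x w ^+ 2 <= c * hnorm (Y w) ^+ 2) -> (second_moment P Y < +oo)%E ->
  sqi P x /\ ((dot P x x / c)%:E <= second_moment P Y)%E.
Proof.
move=> mx c0 xY hY.
have le1 : (\int[P]_w (x w ^+ 2 / c)%:E <= second_moment P Y)%E.
  apply: ge0_le_integral_nomeas => // w _; rewrite lee_fin ?divr_ge0 ?sqr_ge0 ?(ltW c0)//.
  by rewrite ler_pdivrMr// mulrC.
have mx2 : measurable_fun setT (fun w => x w ^+ 2) by exact: measurable_funX.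
have i1 : P.-integrable setT (EFin \o (fun w => x w ^+ 2 / c)).
  apply/integrableP; split; first by apply/measurable_EFinP; exact: measurable_funM.
  apply: le_lt_trans hY; apply: le_trans le1; apply: ge0_le_integral_nomeas => // w _.
  by rewrite /= ger0_norm// divr_ge0 ?sqr_ge0 ?(ltW c0).
have sx : sqi P x.
  split => //.
  have -> : (fun w => x w ^+ 2) = (fun w => c * (x w ^+ 2 / c)).
    by apply/funext => w; rewrite mulrC divfK// gt_eqF.
  exact: integrableRZ.
split => //; apply: le_trans le1.
have -> : dot P x x / c = \int[P]_w (x w ^+ 2 / c).
  rewrite mulrC -RintegralZl//; last exact: sqi_mul.
  by apply: eq_Rintegral => w _; rewrite -expr2 mulrC.
rewrite /Rintegral fineK//; exact: integrable_fin_num i1.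
Qed.

Lemma inner_sq_le X v w : (inner (X w) v) ^+ 2 <= (hnorm v ^+ 2 + 1) * hnorm (X w) ^+ 2.
Proof.
apply: (@le_trans _ _ (hnorm v ^+ 2 * hnorm (X w) ^+ 2)); last first.
  by rewrite ler_wpM2r ?sqr_ge0// lerDl.
rewrite -exprMn -[leLHS]real_normK ?num_real// mulrC.
by apply: lerXn2r; rewrite ?nnegrE ?normr_ge0 ?mulr_ge0 ?hnorm_ge0// inner_le.
Qed.

Lemma L2Omega_sqi X v : L2Omega P X -> sqi P (fun w => inner (X w) v).
Proof.
move=> [mX sX]; have c0 : 0 < hnorm v ^+ 2 + 1 by rewrite ltr_wpDl// sqr_ge0.
exact: (sqi_of_hnorm (L2Omega_inner_measurable v mX) c0 (inner_sq_le X v) sX).1.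
Qed.

End coordinates.

Section C1_bounds.
Context {R : realType}.
Variables (T : R) (gam : R -> R).
Hypotheses (hT : 0 < T) (hgam : C1_on T gam).

Lemma C1_on_bounds : exists G0 GL : R, [/\ 0 <= G0, 0 <= GL,
  forall x, 0 <= x <= T -> `|gam x| <= G0 &
  forall x y, 0 <= x <= T -> 0 <= y <= T -> `|gam x - gam y| <= GL * `|x - y|].
Proof.
have [cg [g' cg' dg]] := hgam.
have nb (f : R -> R) : {within `[0, T], continuous f} ->
    exists2 M : R, 0 <= M & forall x, 0 <= x <= T -> `|f x| <= M.
  move=> cf; have cn : {within `[0, T], continuous (fun x => `|f x|)}.
    by move=> x; apply: continuous_comp; [exact: cf|exact: norm_continuous].
  by have [c _ hc] := EVT_max (ltW hT) cn; exists `|f c| => // x xI; apply: hc; rewrite in_itv.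
have [G0 G00 hG0] := nb _ cg; have [GL GL0 hGL] := nb _ cg'.
exists G0, GL; split => // x y.
wlog xy : x y / y <= x.
  move=> h xI yI; have [xy|/ltW xy] := leP y x; first exact: h.
  by rewrite distrC [`|x - y|]distrC; exact: h.
move=> /andP[x0 xT] /andP[y0 yT].
have dd z : z \in `]y, x[ -> is_derive z 1 gam (g' z).
  rewrite in_itv/= => /andP[yz zx]; apply: dg.
  by rewrite in_itv/= (le_lt_trans y0 yz) (lt_le_trans zx xT).
have cc : {within `[y, x], continuous gam}.
  apply: continuous_subspaceW cg => z /=; rewrite !in_itv/= => /andP[yz zx].
  by rewrite (le_trans y0 yz) (le_trans zx xT).
have [c] := MVT_segment xy dd cc; rewrite in_itv/= => /andP[yc cx] ->.
rewrite normrM ler_wpM2r//; apply: hGL.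
by rewrite (le_trans y0 yc) (le_trans cx xT).
Qed.

End C1_bounds.

Section sampled_limits.
Context {R : realType}.
Implicit Types (x y t T C A : R).

(** The Hoelder bound makes g continuous inside ]0, t[. *)
Lemma measurable_patch_holder (g : R -> R) t C : 0 < t -> 0 <= C ->
  (forall x y, 0 < x <= y -> y < t ->
     `|g x - g y| <= C * ((y - x) `^ 2^-1 * (t - y) `^ (- (3 / 4)))) ->
  measurable_fun setT (g \_ `]0, t[ : measurableTypeR R -> R).
Proof.
move=> t0 C0 hg; apply/(measurable_restrictT _ (measurable_itv _)).
apply: open_continuous_measurable_fun; first exact: interval_open.
move=> x; rewrite inE/= in_itv/= => /andP[x0 xt].
apply/cvgrPdist_le => eps eps0.
pose K := C * ((t - x) / 2) `^ (- (3 / 4)).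
have K0 : 0 <= K by rewrite mulr_ge0 ?powR_ge0.
have tx : 0 < t - x by rewrite subr_gt0.
pose del := (eps / (K + 1)) ^+ 2.
have ek : 0 < eps / (K + 1) by rewrite divr_gt0// ltr_wpDl.
have del0 : 0 < del by rewrite exprn_gt0.
near=> y.
have y0 : 0 < y by near: y; exact: lt_nbhsr.
have yx : y < x + (t - x) / 2 by near: y; apply: lt_nbhsl; rewrite ltrDl divr_gt0.
have xy : `|x - y| <= del by near: y; exact: cvgr_dist_le.
have hx2 : (t - x) / 2 <= t - x by rewrite ler_pdivrMr// ler_pMr// ler1n.
have st := splitr (t - x).
have key a b : 0 < a <= b -> b < t -> (t - x) / 2 <= t - b -> b - a <= del -> `|g a - g b| <= eps.
  move=> ab bt tb ba; apply: le_trans (hg _ _ ab bt) _.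
  apply: (@le_trans _ _ (K * (eps / (K + 1)))); last first.
    rewrite mulrCA ler_piMr ?(ltW eps0)// ler_pdivrMr ?mul1r ?lerDl// ltr_wpDl//.
  rewrite /K -mulrA ler_wpM2l// mulrC; apply: ler_pM; rewrite ?powR_ge0//.
    rewrite !powRN lef_pV2 ?posrE ?powR_gt0 ?divr_gt0// ?subr_gt0//.
    by rewrite ge0_ler_powR ?nnegrE ?subr_ge0 ?(ltW bt)// ?divr_ge0 ?(ltW tx)//.
  have ba0 : 0 <= b - a by rewrite subr_ge0; case/andP: ab.
  apply: (@le_trans _ _ (del `^ 2^-1)); first by rewrite ge0_ler_powR ?nnegrE ?(ltW del0).
  by rewrite powR12_sqrt ?(ltW del0)// sqrtr_sqr ger0_norm// ltW.
have [le_xy|lt_yx] := leP x y.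
  apply: key; rewrite ?x0//.
  - by move: yx st; set q := (t - x) / 2; lra.
  - by move: yx st; set q := (t - x) / 2; lra.
  - by rewrite -(ger0_norm (_ : 0 <= y - x)) ?subr_ge0// distrC.
rewrite distrC; apply: key; rewrite ?y0 ?(ltW lt_yx)//.
by rewrite -(ger0_norm (_ : 0 <= x - y)) ?subr_ge0// ltW.
Unshelve. all: by end_near. Qed.

End sampled_limits.

(** * Second moments of the noise *)

Section noise.
Context {R : realType}.
Local Notation leb := (@lebesgue_measure R).
Local Notation MR := (measurableTypeR R).
Variables (l T : R) (hl : 0 < l) (hT : 0 < T)
  (rho : nat -> R) (e : nat -> L2 l) (hA : dirichlet_eigenbasis rho e)
  (al be s mu la H1 H2 : R)
  (hbe : 0 < be) (hbeal : be <= al) (hal : al < 1)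
  (hmu : 0 < mu) (hla : 0 <= la)
  (hH1 : 0 < H1 <= 1 / 2) (hH2 : 0 < H2 <= 1 / 2)
  (gam : R -> R) (hgam : C1_on T gam) (hgam0 : gam 0 = 0)
  (d : measure_display) (Omega : measurableType d) (P : probability Omega R)
  (W : R -> R -> Omega -> R) (hW : fractional_brownian_sheet P l T H1 H2 W)
  (th kap : R) (hth : 0 < th < pi / 2) (hkap : 0 < kap)
  (F : R -> R -> R -> R)
  (hF : solution_kernel rho e al be s mu la kap th F).

Let phi := pi - th.
Let uk := ukernel al be mu la kap phi.

(** The uniform bound and the Hoelder bound on u_k carry over to the product
    with gam, which is bounded and Lipschitz. *)
Lemma kernel_sample : exists A C : R, [/\ 0 <= C, forall rs t x, 0 < rs -> 0 < t <= T ->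
    0 <= x < t -> `|gam x * uk rs (t - x)| <= A &
  forall rs t x y, 0 < rs -> 0 < t <= T -> 0 <= x <= y -> y < t ->
    `|gam x * uk rs (t - x) - gam y * uk rs (t - y)| <=
       C * ((y - x) `^ 2^-1 * (t - y) `^ (- (3 / 4)))].
Proof.
have ca : pi / 2 < phi < pi := contour_angle hth.
have [G0 [GL [G00 GL0 hG hGL]]] := C1_on_bounds hT hgam.
have [Cb Cb0 hb] := ukernel_bounded T hbe hbeal hal hmu hla hkap ca.
have [Ch Ch0 hh] := ukernel_holder hbe hbeal hal hmu hla hkap ca hT.
exists (G0 * Cb), (GL * Cb * (T `^ 2^-1 * T `^ (3 / 4)) + G0 * Ch); split.
- by rewrite addr_ge0 ?mulr_ge0 ?powR_ge0.
- move=> rs t x rs0 /andP[t0 tT] /andP[x0 xt]; rewrite normrM; apply: ler_pM => //.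
    by apply: hG; rewrite x0 (le_trans (ltW xt)).
  by apply: hb => //; rewrite subr_gt0 xt (le_trans _ tT)// gerBl.
move=> rs t x y rs0 /andP[t0 tT] /andP[x0 xy] yt.
have xt := le_lt_trans xy yt.
have xI : 0 <= x <= T by rewrite x0 (le_trans (ltW xt)).
have y0 := le_trans x0 xy.
have yI : 0 <= y <= T by rewrite y0 (le_trans (ltW yt)).
have ty : 0 < t - y by rewrite subr_gt0.
have tyT : t - y <= T by rewrite (le_trans _ tT)// gerBl.
have txT : t - x <= T by rewrite (le_trans _ tT)// gerBl.
have yx0 : 0 <= y - x by rewrite subr_ge0.
set Y := (y - x) `^ 2^-1 * (t - y) `^ (- (3 / 4)).
have -> : gam x * uk rs (t - x) - gam y * uk rs (t - y) =
  (gam x - gam y) * uk rs (t - x) + gam y * (uk rs (t - x) - uk rs (t - y)) by ring.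
apply: le_trans (ler_normD _ _) _; rewrite [leRHS]mulrDl; apply: lerD; last first.
  rewrite normrM -mulrA; apply: ler_pM => //; first exact: hG.
  rewrite distrC; apply: le_trans (hh _ _ _ rs0 _ txT) _.
    by rewrite ty lerD2l lerN2.
  by rewrite /Y (_ : t - x - (t - y) = y - x)//; ring.
apply: (@le_trans _ _ (GL * (y - x) * Cb)).
  rewrite normrM; apply: ler_pM => //.
    by apply: le_trans (hGL _ _ xI yI) _; rewrite distrC ger0_norm.
  by apply: hb => //; rewrite txT andbT subr_gt0.
have h34 : 0 <= 3 / 4 :> R by lra.
have hp := @powR_ge_inv R T (t - y) _ h34 (introT andP (conj ty tyT)).
have -> : GL * (y - x) * Cb = GL * Cb * ((y - x) `^ 2^-1 * (y - x) `^ 2^-1).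
  by rewrite powR12_sqrt// -expr2 sqr_sqrtr//; ring.
have -> : GL * Cb * (T `^ 2^-1 * T `^ (3 / 4)) * Y = GL * Cb * ((y - x) `^ 2^-1 *
    (T `^ 2^-1 * (T `^ (3 / 4) * (t - y) `^ (- (3 / 4))))) by rewrite /Y; ring.
apply: ler_wpM2l; first by rewrite mulr_ge0.
rewrite ler_wpM2l ?powR_ge0//; apply: (@le_trans _ _ (T `^ 2^-1)); last by rewrite ler_peMr ?powR_ge0.
rewrite ge0_ler_powR ?nnegrE ?invr_ge0 ?(ltW hT)//.
by rewrite (le_trans _ txT)// lerD2r ltW.
Qed.

Lemma eigen_sample (a w : R) n1 N1 : 0 < w -> continuous n1 ->
  (forall x : R, is_derive x 1 N1 (n1 x)) ->
  (fun k => \sum_(0 <= i < k.+1) a * sin (w * (i%:R * (l / k.+1%:R))) *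
     (N1 (i.+1%:R * (l / k.+1%:R)) - N1 (i%:R * (l / k.+1%:R)))) @ \oo -->
  dot (lebD l) (fun x => a * sin (w * x)) n1.
Proof.
move=> w0 cn dN.
apply: (@riemann_holder R l (`|a| * w * (l `^ 2^-1 * l `^ (3 / 4))) `|a| (fun x => a * sin (w * x))) => //.
- by rewrite !mulr_ge0 ?powR_ge0// ltW.
- apply: measurable_funM; first exact: measurable_cst.
  by apply: measurable_sinf; apply: measurable_funM; [exact: measurable_cst|exact: measurable_id].
- by move=> x _; rewrite normrM ler_piMr// sin_max.
move=> x y /andP[x0 xy] yl; have ly : 0 < l - y by rewrite subr_gt0.
have yx0 : 0 <= y - x by rewrite subr_ge0.
have lyl : l - y <= l by rewrite gerBl (le_trans x0).
have h34 : 0 <= 3 / 4 :> R by lra.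
have hp := @powR_ge_inv R l (l - y) _ h34 (introT andP (conj ly lyl)).
rewrite -mulrBr normrM.
apply: (@le_trans _ _ (`|a| * (w * (y - x)))).
  rewrite ler_wpM2l//; apply: le_trans (sin_lip _ _) _.
  by rewrite -mulrBr normrM (gtr0_norm w0) distrC (ger0_norm yx0).
have -> : `|a| * (w * (y - x)) = `|a| * w * ((y - x) `^ 2^-1 * (y - x) `^ 2^-1).
  by rewrite powR12_sqrt// -expr2 sqr_sqrtr//; ring.
have -> : `|a| * w * (l `^ 2^-1 * l `^ (3 / 4)) * ((y - x) `^ 2^-1 * (l - y) `^ (- (3 / 4))) =
  `|a| * w * ((y - x) `^ 2^-1 * (l `^ 2^-1 * (l `^ (3 / 4) * (l - y) `^ (- (3 / 4))))) by ring.
apply: ler_wpM2l; first by rewrite mulr_ge0// ltW.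
rewrite ler_wpM2l ?powR_ge0//; apply: (@le_trans _ _ (l `^ 2^-1)); last by rewrite ler_peMr ?powR_ge0.
rewrite ge0_ler_powR ?nnegrE ?invr_ge0 ?(ltW hl)//.
by rewrite lerBlDr (le_trans (ltW yl))// lerDl.
Qed.

(** Z is compared, through [variance_lsc], with the grid approximations of its
    k-th coordinate, whose integrand is e_k(y) gam(tau) u_k(t - tau). Both
    families of elementary integrands converge weakly to this function: the
    one in the definition of Z by [pairing_cvg], the grids by
    [riemann_holder]. The variance on a grid factors, and [sine_form_bound]
    and [kernel_form] bound the two factors. *)
Lemma noise_coord_bound m : 0 <= m <= 1 -> al * m < H2 -> exists2 C : R, 0 <= C &
  forall k (t : R) Z, t \in `[0, T] ->
    is_wiener_integral P W t (fun tau x y => F (t - tau) x y * gam tau) Z ->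
    dot P (fun w => inner (Z w) (e k)) (fun w => inner (Z w) (e k)) <=
      C * (Num.sqrt (rho k) `^ (1 - 2 * H1) * ((rho k `^ s) `^ (- m)) ^+ 2).
Proof.
move=> hm amH.
have ca : pi / 2 < phi < pi := contour_angle hth.
have [A [CH [CH0 hAb hHo]]] := kernel_sample.
have [a [ea a2 wl]] := eigen_explicit hl hA.
have [G0 [GL [G00 GL0 hG hGL]]] := C1_on_bounds hT hgam.
have KF := kernel_form hG hGL hbe hbeal hal hmu hla hkap ca hT GL0 hH2 _ hm amH.
set C2 := kernel_form_const _ _ _ _ _ _ _ _ _ in KF.
have C20 : 0 <= C2.
  rewrite /C2 /kernel_form_const; apply: mulr_ge0; first exact: sqr_ge0.
  by rewrite !addr_ge0// mulr_ge0 ?sqr_ge0.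
exists (7 * C2); first by rewrite mulr_ge0.
move=> k t Z tT [hZ [p [rp cvp cvZ]]].
set Zk := (fun w => _); have sZ : sqi P Zk := L2Omega_sqi (e k) hZ.
have ho := eigenfunction_orthonormal hA.
have e01 : inner (e k) (e k) = 1 by rewrite ho eqxx.
have rs0 : 0 < rho k `^ s by rewrite powR_gt0// (eigenvalue_gt0 hA).
set w := Num.sqrt (rho k).
have w0 : 0 < w by rewrite sqrtr_gt0 (eigenvalue_gt0 hA).
have cvk : (fun n => dot P (fun w => scalar_integral W (e k) (p n) w - Zk w)
    (fun w => scalar_integral W (e k) (p n) w - Zk w)) @ \oo --> (0 : R).
  have sX n : sqi P (fun w => scalar_integral W (e k) (p n) w - Zk w).
    by apply: sqiB => //; exact: (scalar_integral_sqi hW tT).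
  apply/cvgrPdist_le => eps eps0.
  have e20 : 0 < eps / 2 by rewrite divr_gt0.
  apply: filterS (cvge0_le cvZ e20) => n hn.
  have c2 : 0 < (2 : R) by [].
  have le2 w' : (scalar_integral W (e k) (p n) w' - Zk w') ^+ 2 <=
     2 * hnorm (elem_integral W (p n) w' - Z w') ^+ 2.
    rewrite -scalar_integralE -innerBl.
    apply: le_trans (inner_sq_le (fun w => elem_integral W (p n) w - Z w) (e k) w') _.
    by rewrite hnorm_sq e01.
  have [_ h] := sqi_of_hnorm (sX n).1 c2 le2 (le_lt_trans hn (ltry _)).
  rewrite sub0r normrN ger0_norm ?dot_ge0//.
  by have := le_trans h hn; rewrite lee_fin ler_pdivrMr// divfK.
have [t0 tTT] : 0 <= t /\ t <= T by move: tT; rewrite in_itv/= => /andP[].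
have B0 : 0 <= 7 * C2 * (w `^ (1 - 2 * H1) * ((rho k `^ s) `^ (- m)) ^+ 2).
  exact: (mulr_ge0 (mulr_ge0 (ler0n _ 7) C20) (mulr_ge0 (powR_ge0 _ _) (sqr_ge0 _))).
move: t0; rewrite le_eqVlt => /orP[/eqP t0|t0].
  (* over a degenerate interval all the increments vanish *)
  have s0 n : scalar_integral W (e k) (p n) = (fun=> 0).
    apply/funext => w'; rewrite /scalar_integral.
    rewrite (all_sum_in (g := fun=> 0) (rp n)) ?big1// => q.
    rewrite -t0 => /and5P[_ _ _ t00 /andP[tt trt]].
    have tr0 : tr q = 0 by apply/le_anti; rewrite trt (le_trans t00).
    have tl0 : tl q = 0 by apply/le_anti; rewrite t00 andbT -tr0.
    by rewrite /term_inc /sheet_inc tr0 tl0 subrr mulr0.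
  have cst : (fun _ : nat => dot P Zk Zk) @ \oo --> dot P Zk Zk by exact: cvg_cst.
  have e0 : (fun n => dot P (fun w => scalar_integral W (e k) (p n) w - Zk w)
    (fun w => scalar_integral W (e k) (p n) w - Zk w)) = (fun=> dot P Zk Zk).
    apply/funext => n; rewrite s0 /dot; apply: eq_Rintegral => w' _.
    by rewrite sub0r mulrNN.
  rewrite e0 in cvk; have -> : dot P Zk Zk = 0 by apply: (cvg_unique _ cst cvk); exact: Rhausdorff.
  exact: B0.
have tI : 0 < t <= T by rewrite t0.
pose f1 (x : R) := a k * sin (w * x).
(* cutting off at 0 leaves the first node of the grid unchanged since gam 0 = 0 *)
pose f2 : R -> R := (fun x : R => gam x * uk (rho k `^ s) (t - x)) \_ `]0, t[.
have f2E (x : R) : 0 <= x < t -> f2 x = gam x * uk (rho k `^ s) (t - x).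
  move=> /andP[]; rewrite le_eqVlt => /orP[/eqP <-|x0] xt.
    by rewrite /f2 patchE memNset ?hgam0 ?mul0r//= in_itv/= ltxx.
  by rewrite /f2 patchE mem_set//= in_itv/= x0.
have mf2 : measurable_fun setT (f2 : MR -> R).
  apply: (measurable_patch_holder t0 CH0) => x y /andP[x0 xy] yt.
  by apply: hHo => //; rewrite (ltW x0).
(* the grid approximations to which Z is compared *)
pose q n := grid_terms t (e k) n.+1 (fun i => f1 (i%:R * (l / n.+1%:R)))
   (fun j => gam (j%:R * (t / n.+1%:R)) * uk (rho k `^ s) (t - j%:R * (t / n.+1%:R))).
apply: (@variance_lsc R d Omega P l T H1 H2 W hW hH1 hH2 t tT (e k) p q Zk) => //.
- by move=> n; exact: (grid_rect (e k) hl tI).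
- move=> n; rewrite (variance_grid hW hl tI e01).
  have -> : 7 * C2 * (w `^ (1 - 2 * H1) * (rho k `^ s) `^ (- m) ^+ 2) =
    7 * w `^ (1 - 2 * H1) * (C2 * (rho k `^ s) `^ (- m) ^+ 2) by ring.
  have psd := fbm_form_psd hW hH1 hl tI e01 n.+1.
  apply: le_trans (ler_wpM2r (psd _) _) _.
    apply: (sine_form_bound hH1 hl _ (a2 k) (ltn0Sn n)).
    by apply: le_trans (wl k); rewrite ler_peMl ?ler1n// divr_ge0 ?pi_ge0 ?(ltW hl).
  by rewrite ler_wpM2l ?mulr_ge0 ?powR_ge0//; apply: KF.
move=> N1 N2 [n1 cn1 dN1] [n2 cn2 dN2].
have A1 := @pairing_cvg R l hl rho e hA F (fun k => ufun al be s mu la kap th (rho k)) gam hF.1 hF.2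
   p t k f2 A n1 n2 N1 N2 t0 rp cvp mf2 _ _ cn1 dN1 cn2 dN2.
have A1' : (fun n => pairing (e k) N1 N2 (p n)) @ \oo --> dot (lebD l) (e k) n1 * dot (lebD t) f2 n2.
  apply: A1 => tau; rewrite in_itv/= => /andP[u0 ut].
    by rewrite f2E ?(ltW u0)//; apply: hAb => //; rewrite (ltW u0).
  by rewrite f2E ?(ltW u0)// ufunE// subr_gt0.
have ef1 : dot (lebD l) (e k) n1 = dot (lebD l) f1 n1.
  rewrite !dot_lebD; apply: eq_Rintegral => x; rewrite inE/= in_itv/= => /andP[x0 xl].
  by rewrite ea ?in_itv/= ?(ltW x0) ?(ltW xl).
have S1 := @eigen_sample (a k) w n1 N1 w0 cn1 dN1.
have S2 := @riemann_holder R t CH A f2 t0 CH0 mf2 _ _ n2 N2 cn2 dN2.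
have S2' : (fun n => \sum_(0 <= j < n.+1) gam (j%:R * (t / n.+1%:R)) * uk (rho k `^ s) (t - j%:R * (t / n.+1%:R)) *
     (N2 (j.+1%:R * (t / n.+1%:R)) - N2 (j%:R * (t / n.+1%:R)))) @ \oo --> dot (lebD t) f2 n2.
  have E n : \sum_(0 <= j < n.+1) gam (j%:R * (t / n.+1%:R)) * uk (rho k `^ s) (t - j%:R * (t / n.+1%:R)) *
     (N2 (j.+1%:R * (t / n.+1%:R)) - N2 (j%:R * (t / n.+1%:R))) =
     \sum_(0 <= j < n.+1) f2 (j%:R * (t / n.+1%:R)) * (N2 (j.+1%:R * (t / n.+1%:R)) - N2 (j%:R * (t / n.+1%:R))).
    apply: eq_big_nat => j /andP[_ jn]; have [j0 j1 j2] := grid_mem t0 jn.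
    rewrite f2E// j0 (lt_le_trans _ j2)// ltr_pM2r ?divr_gt0// ltr_nat.
    exact: ltnSn.
  rewrite (eq_cvg _ _ E); apply: S2 => [x xI|x y /andP[x0 xy] yt].
    by rewrite f2E//; exact: hAb.
  by rewrite !f2E ?x0 ?(le_lt_trans xy)// ?(le_trans x0)//; apply: hHo => //; rewrite x0.
have A2 : (fun n => pairing (e k) N1 N2 (q n)) @ \oo --> dot (lebD l) f1 n1 * dot (lebD t) f2 n2.
  have E n : pairing (e k) N1 N2 (q n) = (\sum_(0 <= i < n.+1) a k * sin (w * (i%:R * (l / n.+1%:R))) *
     (N1 (i.+1%:R * (l / n.+1%:R)) - N1 (i%:R * (l / n.+1%:R)))) *
    (\sum_(0 <= j < n.+1) gam (j%:R * (t / n.+1%:R)) * uk (rho k `^ s) (t - j%:R * (t / n.+1%:R)) *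
     (N2 (j.+1%:R * (t / n.+1%:R)) - N2 (j%:R * (t / n.+1%:R)))).
    by rewrite /q (pairing_grid _ e01).
  by rewrite (eq_cvg _ _ E); exact: cvgM.
by rewrite ef1 in A1'; rewrite -[X in _ --> X](subrr (dot (lebD l) f1 n1 * dot (lebD t) f2 n2)); exact: cvgB.
Qed.

End noise.

(** * Parseval's identity and second moments *)

Section parseval.
Context {R : realType}.
Variables (l : R) (rho : nat -> R) (e : nat -> L2 l).
Hypothesis hA : dirichlet_eigenbasis rho e.
Implicit Types (v w : L2 l) (n k : nat).

Let ho := eigenfunction_orthonormal hA.

Lemma hnorm_eigen k : hnorm (e k) = 1.
Proof. by rewrite /hnorm ho eqxx sqrtr1. Qed.

Lemma inner_partial_sum (c : nat -> R) n k : inner (\sum_(j < n) c j *: e j) (e k) =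
  if (k < n)%N then c k else 0.
Proof.
rewrite inner_suml; case: ltnP => kn.
  rewrite (bigD1 (Ordinal kn))//= innerZl ho eqxx mulr1 big1 ?addr0// => i ik.
  by rewrite innerZl ho; have /negbTE -> : (i : nat) != k by []; rewrite mulr0.
rewrite big1// => i _; rewrite innerZl ho.
by have /negbTE -> : (i : nat) != k; [rewrite neq_ltn (leq_trans (ltn_ord i) kn)|rewrite mulr0].
Qed.

Lemma projection_error v n : hnorm (\sum_(k < n) inner v (e k) *: e k - v) ^+ 2 =
  hnorm v ^+ 2 - \sum_(k < n) inner v (e k) ^+ 2.
Proof.
set S := \sum_(k < n) _ *: _.
have SS : inner S S = \sum_(k < n) inner v (e k) ^+ 2.
  rewrite {1}/S inner_suml; apply: eq_bigr => k _.
  have := inner_partial_sum (fun j => inner v (e j)) n k; rewrite ltn_ord -/S => Sk.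
  by rewrite innerZl (innerC (e k)) Sk expr2.
have Sv : inner S v = \sum_(k < n) inner v (e k) ^+ 2.
  rewrite /S inner_suml; apply: eq_bigr => k _.
  by rewrite innerZl (innerC (e k)) expr2.
rewrite !hnorm_sq innerBl !innerBr (innerC v S) SS Sv; ring.
Qed.

Lemma bessel v n : \sum_(k < n) inner v (e k) ^+ 2 <= hnorm v ^+ 2.
Proof. by rewrite -subr_ge0 -projection_error sqr_ge0. Qed.

Lemma parseval v : (fun n => \sum_(k < n) inner v (e k) ^+ 2) @ \oo --> hnorm v ^+ 2.
Proof.
have h := eigenfunction_basis hA v.
have E n : \sum_(k < n) inner v (e k) ^+ 2 = hnorm v ^+ 2 -
    hnorm (\sum_(k < n) inner v (e k) *: e k - v) * hnorm (\sum_(k < n) inner v (e k) *: e k - v).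
  by rewrite -expr2 projection_error; ring.
have L := cvgB (cvg_cst (hnorm v ^+ 2)) (cvgM h h).
by rewrite mulr0 subr0 in L; rewrite (eq_cvg _ _ E); exact: L.
Qed.

End parseval.

Section second_moments.
Context {R : realType} {d : measure_display} {Omega : measurableType d}.
Variable P : probability Omega R.
Variables (l : R) (rho : nat -> R) (e : nat -> L2 l).
Hypothesis hA : dirichlet_eigenbasis rho e.
Implicit Types (X Y : Omega -> L2 l).

(** The norm is the limit of the Parseval sums of the coordinates. *)
Lemma measurable_hnorm_sq X : (forall k, measurable_fun setT (fun w => inner (X w) (e k))) ->
  measurable_fun setT (fun w => (hnorm (X w) ^+ 2)%:E).
Proof.
move=> mX; apply/measurable_EFinP.
apply: (@measurable_fun_cvg _ _ _ setT (fun n w => \sum_(k < n) inner (X w) (e k) ^+ 2)).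
  by move=> n; apply: measurable_sum => k; exact: measurable_funX.
by move=> w _; exact: (parseval hA).
Qed.

Lemma L2Omega_coord X k : L2Omega P X -> measurable_fun setT (fun w => inner (X w) (e k)).
Proof. by move=> [mX _]; exact: L2Omega_inner_measurable. Qed.

Lemma second_moment_ge0 X : (0 <= second_moment P X)%E.
Proof. by apply: integral_ge0 => w _; rewrite lee_fin sqr_ge0. Qed.

Lemma second_moment_triangle X Y : L2Omega P X -> L2Omega P Y ->
  (second_moment P X <= 2%:E * second_moment P (fun w => (X w - Y w)%R) + 2%:E * second_moment P Y)%E.
Proof.
move=> hX hY.
have mY := measurable_hnorm_sq (fun k => L2Omega_coord k hY).
have mD : measurable_fun setT (fun w => (hnorm (X w - Y w) ^+ 2)%:E).
  apply: measurable_hnorm_sq => k.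
  rewrite (_ : (fun w => _) = (fun w => inner (X w) (e k) - inner (Y w) (e k))).
    by apply: measurable_funB; exact: L2Omega_coord.
  by apply/funext => w; rewrite innerBl.
have pos (Z : Omega -> L2 l) w : (0 <= (hnorm (Z w) ^+ 2)%:E)%E by rewrite lee_fin sqr_ge0.
have lin (a b : Omega -> \bar R) : (forall w, 0 <= a w)%E -> (forall w, 0 <= b w)%E ->
    measurable_fun setT a -> measurable_fun setT b ->
    (\int[P]_w (2%:E * a w + 2%:E * b w) = 2%:E * \int[P]_w a w + 2%:E * \int[P]_w b w)%E.
  move=> a0 b0 ma mb; rewrite ge0_integralD ?ge0_integralZl_EFin//; first last.
  - exact: measurable_funeM.
  - by move=> w _; rewrite mule_ge0.
  - exact: measurable_funeM.
  - by move=> w _; rewrite mule_ge0.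
have eq_le (x y : \bar R) : x = y -> (x <= y)%E by move=> ->.
have h := eq_le _ _ (lin _ _ (pos (fun w => X w - Y w)) (pos Y) mD mY).
apply: le_trans h.
apply: ge0_le_integral_nomeas => // w _.
rewrite -!EFinM -EFinD lee_fin !hnorm_sq.
by rewrite -{1 2}(subrK (Y w) (X w)) inner_sqD.
Qed.

Lemma sum_coord_le X n : L2Omega P X ->
  ((\sum_(k < n) dot P (fun w => inner (X w) (e k)) (fun w => inner (X w) (e k)))%:E
     <= second_moment P X)%E.
Proof.
move=> hX; pose x k w := inner (X w) (e k).
have sx k : sqi P (x k) by exact: L2Omega_sqi.
have E : (P.-integrable setT (EFin \o (fun w => \sum_(k < n) x k w ^+ 2))) /\
   \int[P]_w (\sum_(k < n) x k w ^+ 2) = \sum_(k < n) dot P (x k) (x k).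
  elim: n => [|n [i1 e1]].
    rewrite big_ord0; under eq_fun do rewrite big_ord0.
    by split; [exact: integrable0|rewrite /Rintegral integral0].
  have -> : (fun w => \sum_(k < n.+1) x k w ^+ 2) = (fun w => \sum_(k < n) x k w ^+ 2 + x n w ^+ 2).
    by apply/funext => w; rewrite big_ord_recr.
  have i2 := (sx n).2.
  split; first exact: (integrableRD _ i1 i2).
  have dn : dot P (x n) (x n) = \int[P]_w (x n w ^+ 2).
    by apply: eq_Rintegral => w _; rewrite expr2.
  by rewrite RintegralD// e1 big_ord_recr/= dn.
have [i1 <-] := E.
rewrite /Rintegral fineK; last exact: integrable_fin_num i1.
apply: ge0_le_integral_nomeas => // w _.
  by rewrite lee_fin sumr_ge0// => k _; rewrite sqr_ge0.
by rewrite lee_fin; exact: (bessel hA).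
Qed.

(** Preimages of open sets under a continuous map are open, so measurability
    with respect to the Borel sets of H is preserved. *)
Lemma L2Omega_lipschitz (Phi : L2 l -> L2 l) K X : 0 <= K ->
  (forall v w, hnorm (Phi v - Phi w) <= K * hnorm (v - w)) ->
  (forall v, hnorm (Phi v) <= K * (1 + hnorm v)) -> L2Omega P X ->
  L2Omega P (fun w => Phi (X w)) /\
  (second_moment P (fun w => Phi (X w)) <= (2 * K ^+ 2)%:E * (1 + second_moment P X))%E.
Proof.
move=> K0 hL hG hX; have [mX sX] := hX.
have K1 : 0 < K + 1 by rewrite ltr_wpDl.
have le : (second_moment P (fun w => Phi (X w)) <= (2 * K ^+ 2)%:E * (1 + second_moment P X))%E.
  have mh := measurable_hnorm_sq (fun k => L2Omega_coord k hX).
  have c0 : 0 <= 2 * K ^+ 2 := mulr_ge0 (ler0n _ 2) (sqr_ge0 _).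
  have -> : (1 + second_moment P X)%E = (\int[P]_w (1 + (hnorm (X w) ^+ 2)%:E))%E.
    rewrite ge0_integralD//; last by move=> w _; rewrite lee_fin sqr_ge0.
    by congr (_ + _)%E; rewrite integral_cst// mul1e; exact/esym/probability_setT.
  rewrite -ge0_integralZl_EFin//; first last.
  - by apply: emeasurable_funD.
  - by move=> w _; rewrite adde_ge0// lee_fin sqr_ge0.
  apply: ge0_le_integral_nomeas => // w _; first by rewrite lee_fin sqr_ge0.
  rewrite -EFinD -EFinM lee_fin.
  apply: (@le_trans _ _ ((K * (1 + hnorm (X w))) ^+ 2)).
    by apply: lerXn2r; rewrite ?nnegrE ?hnorm_ge0 ?mulr_ge0 ?addr_ge0 ?hnorm_ge0.
  rewrite exprMn (_ : 2 * K ^+ 2 * _ = K ^+ 2 * (2 * (1 + hnorm (X w) ^+ 2))); last by ring.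
  rewrite ler_wpM2l ?sqr_ge0//.
  by have := sqr_ge0 (1 - hnorm (X w)); lra.
split; last exact: le.
split.
  move=> U hU; apply: (mX [set v | U (Phi v)]) => v Uv; have [eps eps0 hw] := hU _ Uv.
  exists (eps / (K + 1)); first by rewrite divr_gt0.
  move=> w; rewrite ltr_pdivlMr// => h; apply: hw; apply: le_lt_trans (hL _ _) _.
  apply: le_lt_trans h; rewrite mulrC ler_wpM2l ?hnorm_ge0// lerDl//.
apply: le_lt_trans le _; rewrite lte_mul_pinfty//.
- by rewrite lee_fin mulr_ge0 ?sqr_ge0.
- by rewrite lte_add_pinfty ?ltry.
Qed.

(** Near each time the second moment is bounded by continuity and
    [second_moment_triangle]; compactness of [0, T] makes the bound uniform.
    *)
Lemma second_moment_bounded (T : R) (u : R -> Omega -> L2 l) : C_L2Omega P T u ->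
  exists2 M : R, 0 <= M & forall r : R, r \in `[0, T] -> (second_moment P (u r) <= M%:E)%E.
Proof.
move=> hu.
have cpt : compact (`[0, T]%classic : set R) by exact: segment_compact.
have nc := (compact_near_coveringP _).1 cpt.
pose Q (M r : R) := r \in `[0, T] -> (second_moment P (u r) <= M%:E)%E.
have gen (a b : \bar R) : (a <= 1)%E -> b \is a fin_num ->
    (2%:E * a + 2%:E * b <= (2 + 2 * fine b)%:E)%E.
  move=> a1 bf; rewrite (EFinD 2 (2 * fine b)) (EFinM 2 (fine b)) fineK// leeD2r//.
  have : (2%:E * a <= 2%:E * 1)%E by rewrite lee_wpmul2l.
  by rewrite mule1.
have key r : `[0, T]%classic r -> \forall r' \near r & M \near +oo, Q M r'.
  move=> /= rT; have [hr cv] := hu r rT.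
  have finr : second_moment P (u r) \is a fin_num.
    by rewrite ge0_fin_numE ?second_moment_ge0//; case: hr.
  have [A hA' hAr] : exists2 A, nbhs r A & forall r', A r' -> r' \in `[0, T] ->
      (second_moment P (fun w => (u r' w - u r w)%R) <= 1)%E.
    have /fine_cvgP[f1 /cvgrPdist_le /(_ _ ltr01) f2] := cv.
    have : \forall r' \near within `[0, T] (nbhs r),
        (second_moment P (fun w => (u r' w - u r w)%R) <= 1)%E.
      near=> r'.
      have g1 : second_moment P (fun w => (u r' w - u r w)%R) \is a fin_num by near: r'.
      rewrite -(fineK g1) lee_fin; apply: le_trans (ler_norm _) _.
      by rewrite -normrN -sub0r; near: r'.
    rewrite near_withinE => hh.
    by exists (fun r' => r' \in `[0, T] -> (second_moment P (fun w => (u r' w - u r w)%R) <= 1)%E).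
  exists (A, [set M | 2 + 2 * fine (second_moment P (u r)) <= M]).
    split => //=; near=> M; near: M; apply: nbhs_pinfty_ge; exact: num_real.
  move=> [r' M] /= [Ar' hM] r'T.
  apply: le_trans (second_moment_triangle (hu r' r'T).1 hr) _.
  apply: (@le_trans _ _ (2 + 2 * fine (second_moment P (u r)))%:E); last by rewrite lee_fin.
  exact: gen (hAr _ Ar' r'T) finr.
have [M0 [_ hM0]] := nc R (pinfty_nbhs R) Q _ key.
exists (Num.max 0 (M0 + 1)); first by rewrite le_max lexx.
move=> r rT; apply: le_trans (hM0 (M0 + 1) _ r rT rT) _; first by rewrite ltrDl.
by rewrite lee_fin le_max lexx orbT.
Unshelve. all: by end_near. Qed.

End second_moments.

(** * The drift term *)

(** By the mean value theorem each term but the first is at most an increment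
    of - x^(1 - p) / (p - 1) over a unit interval, and these telescope. *)
Lemma sum_powR_le {R : realType} (p : R) n : 1 < p ->
  \sum_(0 <= k < n) k.+1%:R `^ (- p) <= 1 + (p - 1)^-1.
Proof.
move=> p1; have p10 : 0 < p - 1 by rewrite subr_gt0.
have step k : k.+2%:R `^ (- p) <= (p - 1)^-1 * (k.+1%:R `^ (1 - p) - k.+2%:R `^ (1 - p)).
  have k12 : (k.+1%:R : R) < k.+2%:R by rewrite ltr_nat.
  have dF (x : R) : 0 < x -> is_derive x 1 (fun y => y `^ (1 - p)) ((1 - p) * x `^ (- p)).
    by move=> x0; apply: is_derive_eq (is_derive1_powR (1 - p) x0) _; congr (_ * _ `^ _); ring.
  have pos (x : R) : k.+1%:R <= x -> 0 < x by apply: lt_le_trans.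
  have dd (x : R) : x \in `]k.+1%:R, k.+2%:R[ -> is_derive x 1 (fun y : R => y `^ (1 - p)) ((1 - p) * x `^ (- p)).
    by rewrite in_itv/= => /andP[/ltW /pos x0 _]; exact: dF.
  have cc : {within `[k.+1%:R, k.+2%:R], continuous (fun y : R => y `^ (1 - p))}.
    by apply: derivable_within_continuous => x; rewrite in_itv/= => /andP[/pos x0 _]; case: (dF _ x0).
  have [c] := @MVT R _ (fun x => (1 - p) * x `^ (- p)) _ _ k12 dd cc.
  rewrite in_itv/= => /andP[k1c ck2] hc.
  have c0 : 0 < c := pos _ (ltW k1c).
  have -> : k.+1%:R `^ (1 - p) - k.+2%:R `^ (1 - p) = (p - 1) * c `^ (- p).
    have e1 : k.+2%:R - k.+1%:R = 1 :> R by rewrite -natr1 addrAC subrr add0r.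
    by rewrite e1 mulr1 in hc; rewrite -opprB hc; ring.
  rewrite mulKf ?gt_eqF// !powRN lef_pV2 ?posrE ?powR_gt0//.
  by rewrite ge0_ler_powR ?nnegrE ?(ltW c0) ?(ltW ck2)// (le_trans ler01)// ltW.
have p0 : 0 <= (p - 1)^-1 by rewrite invr_ge0 ltW.
case: n => [|n]; first by rewrite big_nil addr_ge0.
rewrite big_nat_recl//= powR1 lerD2l.
apply: (@le_trans _ _ (\sum_(0 <= k < n) (p - 1)^-1 * (k.+1%:R `^ (1 - p) - k.+2%:R `^ (1 - p)))).
  by apply: ler_sum_nat => k _; exact: step.
rewrite -mulr_sumr; under eq_bigr do rewrite -opprB.
rewrite sumrN telescope_sumr// opprB powR1 -[leRHS]mulr1 ler_wpM2l//.
Qed.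

Section products.
Context {R : realType} {d : measure_display} {Omega : measurableType d}.
Variable P : probability Omega R.

Lemma Rintegral_sum_mul n (a b : nat -> Omega -> R) :
  (forall k, sqi P (a k)) -> (forall k, sqi P (b k)) ->
  \int[P]_w (\sum_(k < n) a k w * b k w) = \sum_(k < n) dot P (a k) (b k).
Proof.
move=> sa sb.
suff [] : P.-integrable setT (EFin \o (fun w => \sum_(k < n) a k w * b k w)) /\
  \int[P]_w (\sum_(k < n) a k w * b k w) = \sum_(k < n) dot P (a k) (b k) by [].
elim: n => [|n [i1 e1]].
  rewrite big_ord0; under eq_fun do rewrite big_ord0.
  by split; [exact: integrable0|rewrite /Rintegral integral0].
have -> : (fun w => \sum_(k < n.+1) a k w * b k w) = (fun w => \sum_(k < n) a k w * b k w + a n w * b n w).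
  by apply/funext => w; rewrite big_ord_recr.
have i2 := sqi_mul (sa n) (sb n).
split; first exact: (integrableRD _ i1 i2).
by rewrite RintegralD// e1 big_ord_recr.
Qed.

Lemma sqi_cst (c : R) : sqi P (fun=> c) /\ dot P (fun=> c) (fun=> c) = c ^+ 2.
Proof.
split.
  split; first exact: measurable_cst.
  apply: (@bounded_integrableR _ _ _ P setT _ (c ^+ 2)) => //.
    by rewrite -ge0_fin_numE ?measure_ge0// fin_num_measure.
  by move=> x _; rewrite ger0_norm ?sqr_ge0.
transitivity (c * c * fine (P setT)); first exact: Rintegral_cst.
by rewrite probability_setT mulr1 expr2.
Qed.

Lemma dot_sum3 (c : R) (y z : Omega -> R) : sqi P y -> sqi P z ->
  dot P (fun w => c + y w + z w) (fun w => c + y w + z w) <= 3 * (c ^+ 2 + dot P y y + dot P z z).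
Proof.
move=> sy sz; have [sc ec] := sqi_cst c.
have scy := sqiD sc sy.
rewrite -nrm_sq; apply: (@le_trans _ _ ((nrm P (fun=> c) + nrm P y + nrm P z) ^+ 2)).
  apply: lerXn2r; rewrite ?nnegrE ?addr_ge0 ?nrm_ge0//.
  apply: le_trans (nrmD scy sz) _; rewrite lerD2r; exact: nrmD.
rewrite -ec -!nrm_sq; set a := nrm _ _; set b := nrm _ _; set g := nrm _ _.
have := sqr_ge0 (a - b); have := sqr_ge0 (a - g); have := sqr_ge0 (b - g); nra.
Qed.

End products.

Section drift.
Context {R : realType}.
Local Notation leb := (@lebesgue_measure R).
Variables (l T : R) (hT : 0 < T)
  (rho : nat -> R) (e : nat -> L2 l) (hA : dirichlet_eigenbasis rho e)
  (al be s mu la : R)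
  (hbe : 0 < be) (hbeal : be <= al) (hal : al < 1) (hs : 0 < s)
  (hmu : 0 < mu) (hla : 0 <= la)
  (d : measure_display) (Omega : measurableType d) (P : probability Omega R)
  (th kap : R) (hth : 0 < th < pi / 2) (hkap : 0 < kap)
  (S : R -> L2 l -> L2 l)
  (hS : solution_operator rho e al be s mu la kap th S)
  (f : L2 l -> L2 l) (cf : R) (hcf : 0 < cf)
  (hf_growth : forall v, hnorm (f v) <= cf * (1 + hnorm v))
  (hf_lip : forall v w, hnorm (f v - f w) <= cf * hnorm (v - w))
  (sg : R) (hsg : 0 <= sg <= 2 * s)
  (u : R -> Omega -> L2 l) (hu : C_L2Omega P T u).

(** Duality: the weak definition of the time integral is tested against the
    weighted truncation of Y itself, which turns the left-hand side a into an
    integral over time of sums of rho_k^sg E[y_k X_k], where y_k and X_k are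
    the coordinates of Y and of the integrand. For m = sg / (2 s) and nu = (1
    + al) / 2 < 1, [ukernel_decay] gives rho_k^(- sg / 2) (t - tau)^(- nu),
    and Young's inequality with a parameter absorbs half of a into the
    left-hand side. The remainder only involves the second moments of f(u),
    bounded on [0, T]. *)
Lemma drift_bound : exists2 B : R, 0 <= B & forall (t : R) (Y : Omega -> L2 l) n,
  t \in `[0, T] -> is_time_integral P t (fun tau w => S (t - tau) (f (u tau w))) Y ->
  \sum_(k < n) rho k `^ sg * dot P (fun w => inner (Y w) (e k)) (fun w => inner (Y w) (e k)) <= B.
Proof.
have shuffle (a1 a2 a3 a4 a5 a6 : R) :
  a1 * (a2 * (a3 * a4)) * (a5 * a6) = a2 * a4 * (a1 * a3 * a5 * a6) by ring.
have ca := contour_angle hth.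
have [M0 M00 hM] := second_moment_bounded hA hu.
have [sg0 sg2] := andP hsg.
have al0 : 0 < al := lt_le_trans hbe hbeal.
pose m := sg / (2 * s); pose nu := (1 + al) / 2.
have s20 : 0 < 2 * s by rewrite mulr_gt0.
have hm : 0 <= m <= 1 by rewrite /m divr_ge0 ?(ltW s20)//= ler_pdivrMr// mul1r.
have nuE : 2 * nu = 1 + al by rewrite /nu; field.
have hnu : al * m < nu <= 1.
  have [m0 m1] := andP hm; have := ler_piMr (ltW al0) m1 => h.
  by apply/andP; split; move: nuE h hal; set y := al * m; lra.
have nu1 : nu < 1 by move: nuE hal; lra.
have nu0 : 0 <= nu by move: nuE al0; lra.
have [C0 C00 hC] := ukernel_decay T hbe hbeal hal hmu hla hkap ca hm hnu.
(* K1 bounds the time integral of K (t - tau)^(- nu); it is made positive because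
   it also serves as the parameter of Young's inequality *)
pose K := C0 + 1; have K0 : 0 < K by rewrite ltr_wpDl.
have nu10 : 0 < 1 - nu by rewrite subr_gt0.
pose K1 := K * (T `^ (1 - nu) / (1 - nu)).
have K10 : 0 < K1 by rewrite mulr_gt0// divr_gt0// powR_gt0.
pose M1 := 2 * cf ^+ 2 * (1 + M0).
have M10 : 0 <= M1 by rewrite /M1 mulr_ge0 ?addr_ge0// mulr_ge0 ?sqr_ge0.
have M1E : M1%:E = ((2 * cf ^+ 2)%:E * (1 + M0%:E))%E by rewrite -EFinD -EFinM.
exists (K1 ^+ 2 * M1); first by rewrite mulr_ge0 ?sqr_ge0.
move=> t Y n tT [hY hX hint].
have [t0 tTT] : 0 <= t /\ t <= T by move: tT; rewrite in_itv/= => /andP[].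
have r0 k : 0 < rho k := eigenvalue_gt0 hA k.
have rp0 k q : 0 < rho k `^ q by rewrite powR_gt0.
pose y k w := inner (Y w) (e k).
have sy k : sqi P (y k) by exact: L2Omega_sqi.
set a := \sum_(k < n) _.
have a0 : 0 <= a by apply: sumr_ge0 => k _; rewrite mulr_ge0 ?powR_ge0 ?dot_ge0.
(* the test function is a function of Y, truncated to finitely many modes *)
pose Phi (v : L2 l) : L2 l := \sum_(k < n) (rho k `^ sg * inner v (e k)) *: e k.
pose KP := \sum_(k < n) rho k `^ sg.
have KP0 : 0 <= KP by apply: sumr_ge0 => k _; exact: powR_ge0.
have PhiG v : hnorm (Phi v) <= KP * hnorm v.
  apply: le_trans (hnorm_sum _ _) _; rewrite mulr_suml; apply: ler_sum => k _.
  rewrite hnormZ (hnorm_eigen hA) mulr1 normrM (gtr0_norm (rp0 _ _)) ler_wpM2l ?powR_ge0//.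
  by apply: le_trans (inner_le _ _) _; rewrite (hnorm_eigen hA) mulr1.
have PhiB v w : Phi v - Phi w = Phi (v - w).
  rewrite /Phi -sumrB; apply: eq_bigr => k _; rewrite innerBl mulrBr scalerBl//.
have hPsi : L2Omega P (fun w => Phi (Y w)).
  apply: (L2Omega_lipschitz hA KP0 _ _ hY).1 => [v w|v]; first by rewrite PhiB.
  by apply: le_trans (PhiG v) _; rewrite ler_wpM2l// lerDr.
have innerPhi v z : inner z (Phi v) = \sum_(k < n) (rho k `^ sg * inner v (e k)) * inner z (e k).
  by rewrite innerC inner_suml; apply: eq_bigr => k _; rewrite innerZl (innerC (e k)).
have [ih eqh] := hint _ hPsi.
have syk k : sqi P (fun w => rho k `^ sg * y k w) by exact: sqiZ.
have lhs : \int[P]_w inner (Y w) (Phi (Y w)) = a.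
  under eq_Rintegral do rewrite innerPhi.
  rewrite (Rintegral_sum_mul n (a := fun k w => rho k `^ sg * y k w) (b := y))//.
  by apply: eq_bigr => k _; rewrite dotZl.
(* the bound given by Young's inequality, in which a reappears with weight 1 / 2
   after multiplication by K1 *)
pose B' := (K1 * M1 + a / K1) / 2.
have bnd tau : tau \in `]0, t[ -> \int[P]_w inner (S (t - tau) (f (u tau w))) (Phi (Y w)) <=
   K * B' * (t - tau) `^ (- nu).
  move=> tauI; have hXt := hX _ tauI.
  have [u0 ut] : 0 < tau /\ tau < t by move: tauI; rewrite in_itv/= => /andP[].
  have x0 : 0 < t - tau by rewrite subr_gt0.
  have xT : 0 < t - tau <= T by rewrite x0 (le_trans _ tTT)// gerBl ltW.
  have tauT : tau \in `[0, T] by rewrite in_itv/= (ltW u0) (le_trans (ltW ut)).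
  have [hfu smf] := L2Omega_lipschitz hA (ltW hcf) hf_lip hf_growth (hu tauT).1.
  pose F k w := inner (f (u tau w)) (e k).
  have sF k : sqi P (F k) by exact: L2Omega_sqi.
  pose c k := ukernel al be mu la kap (pi - th) (rho k `^ s) (t - tau).
  have sX k : sqi P (fun w => c k * F k w) by exact: sqiZ.
  under eq_Rintegral.
    move=> w _; rewrite innerPhi.
    rewrite (eq_bigr (fun k : 'I_n => (rho k `^ sg * y k w) * (c k * F k w))); last first.
      by move=> k _; rewrite (solution_coord hbe hbeal hal hmu hla hkap hth hA _ _ hS x0).
    over.
  rewrite (Rintegral_sum_mul n (a := fun k w => rho k `^ sg * y k w) (b := fun k w => c k * F k w))//.
  have sumF : \sum_(k < n) nrm P (F k) ^+ 2 <= M1.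
    rewrite -lee_fin; under eq_bigr do rewrite nrm_sq.
    apply: le_trans (sum_coord_le hA n hfu) _; apply: le_trans smf _.
    have c20 : 0 <= 2 * cf ^+ 2 := mulr_ge0 (ler0n _ 2) (sqr_ge0 _).
    by rewrite M1E lee_wpmul2l ?lee_fin// leeD2l// hM.
  apply: (@le_trans _ _ (\sum_(k < n) K * (t - tau) `^ (- nu) *
     ((K1 * nrm P (F k) ^+ 2 + rho k `^ sg * dot P (y k) (y k) / K1) / 2))).
    apply: ler_sum => k _; rewrite dotZl// dotZr//.
    have cb : `|c k| <= K * (rho k `^ (- (sg / 2)) * (t - tau) `^ (- nu)).
      apply: le_trans (hC _ _ (rp0 _ _) xT) _.
      rewrite -powRrM (_ : s * - m = - (sg / 2)); last by rewrite /m; field; rewrite gt_eqF.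
      by rewrite ler_wpM2r ?mulr_ge0 ?powR_ge0// lerDl.
    apply: le_trans (ler_norm _) _; rewrite mulrA normrM normrM (gtr0_norm (rp0 _ _)).
    apply: (@le_trans _ _ (rho k `^ sg * (K * (rho k `^ (- (sg / 2)) * (t - tau) `^ (- nu))) * (nrm P (y k) * nrm P (F k)))).
      apply: ler_pM; rewrite ?mulr_ge0 ?powR_ge0//.
        by rewrite ler_wpM2l ?powR_ge0.
      exact: cauchy_schwarz_sqrt.
    rewrite shuffle.
    rewrite -powRD_gt0// (_ : sg + - (sg / 2) = sg / 2); last by field.
    rewrite ler_wpM2l ?mulr_ge0 ?powR_ge0 ?(ltW K0)//.
    have -> : rho k `^ sg * dot P (y k) (y k) = (rho k `^ (sg / 2) * nrm P (y k)) ^+ 2.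
      rewrite exprMn nrm_sq; congr (_ * _).
      by rewrite expr2 -powRD_gt0//; congr (_ `^ _); field.
    set p := rho k `^ (sg / 2) * _; set q := nrm P (F k).
    rewrite ler_pdivlMr// -subr_ge0.
    have -> : K1 * q ^+ 2 + p ^+ 2 / K1 - p * q * 2 = K1 * (q - p / K1) ^+ 2 by field; rewrite gt_eqF.
    by rewrite mulr_ge0 ?sqr_ge0 ?(ltW K10).
  rewrite -mulr_sumr -mulr_suml big_split/= -mulr_sumr -mulr_suml -/a.
  rewrite [leRHS]mulrAC ler_wpM2l ?mulr_ge0 ?powR_ge0 ?(ltW K0)// /B' ler_wpM2r ?invr_ge0//.
  by rewrite lerD2r ler_wpM2l// ltW.
have B'0 : 0 <= B'.
  apply: divr_ge0 => //; apply: addr_ge0; first exact: mulr_ge0 (ltW K10) M10.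
  exact: divr_ge0 a0 (ltW K10).
have aB : a <= K1 * B'.
  move: t0; rewrite le_eqVlt => /orP[/eqP t0|t0].
    rewrite -lhs eqh -t0 set_itvoo0// Rintegral_set0 mulr_ge0//; exact: ltW.
  have nuI : 0 <= nu < 1 by rewrite nu0.
  have [si sb] := singular_powR nuI t0.
  rewrite -lhs eqh.
  apply: (@le_trans _ _ (\int[leb]_(tau in `]0, t[) (K * B' * (t - tau) `^ (- nu)))).
    apply: le_Rintegral => //; first exact: integrableRZ.
  rewrite RintegralZl// /K1 [leRHS]mulrAC; apply: ler_wpM2l; first exact: mulr_ge0 (ltW K0) B'0.
  apply: le_trans sb _; rewrite ler_wpM2r ?invr_ge0 ?(ltW nu10)//.
  by rewrite ge0_ler_powR ?nnegrE ?(ltW t0) ?(ltW nu10) ?(ltW hT).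
have E : K1 * B' = (K1 ^+ 2 * M1 + a) / 2 by rewrite /B'; field; rewrite gt_eqF.
by move: aB; rewrite E; set X := K1 ^+ 2 * M1; lra.
Qed.

End drift.

(** * Summation over the spectrum and the bound *)

Section spectral_sums.
Context {R : realType}.
Variables (l : R) (hl : 0 < l) (rho : nat -> R) (e : nat -> L2 l).
Hypothesis hA : dirichlet_eigenbasis rho e.
Implicit Types (p q sg : R).

(** Because sqrt (rho k) >= (k + 1) pi / l. *)
Lemma spectral_sum_le p : 1 < p -> exists2 C : R, 0 <= C &
  forall n, \sum_(k < n) Num.sqrt (rho k) `^ (- p) <= C.
Proof.
move=> p1; have [a [_ _ wl]] := eigen_explicit hl hA.
have p0 : 0 <= p by rewrite (le_trans ler01)// ltW.
have c0 : 0 < pi / l by rewrite divr_gt0// pi_gt0.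
exists ((pi / l) `^ (- p) * (1 + (p - 1)^-1)).
  by rewrite mulr_ge0 ?powR_ge0// addr_ge0// invr_ge0 subr_ge0 ltW.
move=> n; apply: le_trans (ler_wpM2l (powR_ge0 _ _) (sum_powR_le n p1)).
rewrite mulr_sumr big_mkord; apply: ler_sum => k _.
have k0 : 0 < k.+1%:R * (pi / l) by rewrite mulr_gt0.
rewrite -powRM ?(ltW c0)// mulrC !powRN lef_pV2 ?posrE ?powR_gt0//.
  by rewrite ge0_ler_powR ?nnegrE ?(ltW k0)// (le_trans (ltW k0)).
exact: lt_le_trans k0 (wl k).
Qed.

Lemma Hdot_sqnorm_partial q v n : Hdot rho e q v ->
  \sum_(k < n) rho k `^ q * inner v (e k) ^+ 2 <= fine (Hdot_sqnorm rho e q v).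
Proof.
move=> hv; have pos k : (0 <= (rho k `^ q * inner v (e k) ^+ 2)%:E)%E.
  by rewrite lee_fin mulr_ge0 ?powR_ge0 ?sqr_ge0.
rewrite -lee_fin fineK; last by rewrite ge0_fin_numE ?nneseries_ge0.
rewrite -sumEFin -(big_mkord xpredT (fun k => (rho k `^ q * inner v (e k) ^+ 2)%:E)).
exact: nneseries_lim_ge.
Qed.

(** Monotone convergence for the series of coordinates. *)
Lemma integral_Hdot_sqnorm_le (d : measure_display) (Omega : measurableType d)
  (P : probability Omega R) (X : Omega -> L2 l) q (c : R) :
  (forall k, sqi P (fun w => inner (X w) (e k))) ->
  (forall n, \sum_(k < n) rho k `^ q * dot P (fun w => inner (X w) (e k)) (fun w => inner (X w) (e k)) <= c) ->
  (\int[P]_w Hdot_sqnorm rho e q (X w) <= c%:E)%E.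
Proof.
move=> sX hc; pose x k w := inner (X w) (e k).
rewrite /Hdot_sqnorm integral_nneseries//; first last.
- by move=> k w _; rewrite lee_fin mulr_ge0 ?powR_ge0 ?sqr_ge0.
- by move=> k; apply/measurable_EFinP; apply: measurable_funM => //; apply: measurable_funX; case: (sX k).
have E k : (\int[P]_w (rho k `^ q * inner (X w) (e k) ^+ 2)%:E)%E = (rho k `^ q * dot P (x k) (x k))%:E.
  have ix := integrableRZ measurableT (rho k `^ q) (sX k).2.
  have -> : rho k `^ q * dot P (x k) (x k) = \int[P]_w (rho k `^ q * x k w ^+ 2).
    have -> : dot P (x k) (x k) = \int[P]_w (x k w ^+ 2).
      by apply: eq_Rintegral => w _; rewrite expr2.
    by rewrite RintegralZl//; exact: (sX k).2.
  by rewrite /Rintegral fineK//; exact: integrable_fin_num ix.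
under eq_eseriesr do rewrite E.
have pos k : (0 <= (rho k `^ q * dot P (x k) (x k))%:E)%E.
  by rewrite lee_fin mulr_ge0 ?powR_ge0 ?dot_ge0.
apply: lime_le; first by apply: is_cvg_nneseries => k _ _; exact: pos.
near=> n; rewrite big_mkord sumEFin lee_fin; exact: hc.
Unshelve. all: by end_near. Qed.

End spectral_sums.

Theorem theorem3p3 (R : realType) (l T : R) (hl : 0 < l) (hT : 0 < T)
  (rho : nat -> R) (e : nat -> L2 l) (hA : dirichlet_eigenbasis rho e)
  (al be s mu la H1 H2 : R)
  (hbe : 0 < be) (hbeal : be <= al) (hal : al < 1)
  (hs : 0 < s < 1) (hmu : 0 < mu) (hla : 0 <= la)
  (hH1 : 0 < H1 <= 1 / 2) (hH2 : 0 < H2 <= 1 / 2)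
  (gam : R -> R) (hgam : C1_on T gam) (hgam0 : gam 0 = 0)
  (d : measure_display) (Omega : measurableType d) (P : probability Omega R)
  (Ft : R -> set (set Omega)) (hFt : filtration T Ft)
  (W : R -> R -> Omega -> R) (hW : fractional_brownian_sheet P l T H1 H2 W)
  (th kap : R) (hth : 0 < th < pi / 2) (hkap : 0 < kap)
  (S : R -> L2 l -> L2 l)
  (hS : solution_operator rho e al be s mu la kap th S)
  (F : R -> R -> R -> R)
  (hF : solution_kernel rho e al be s mu la kap th F)
  (f : L2 l -> L2 l) (cf : R) (hcf : 0 < cf)
  (hf_growth : forall v, hnorm (f v) <= cf * (1 + hnorm v))
  (hf_lip : forall v w, hnorm (f v - f w) <= cf * hnorm (v - w))
  (hsH1 : (1 - H1) / 2 < s) (hsH2 : 0 < 2 * s * H2 / al + H1 - 1)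
  (sg : R)
  (hsg : 0 <= 2 * sg <
         Num.min (2 * s + H1 - 1) (2 * s * H2 / al + H1 - 1))
  (g : L2 l) (hg : g \in Hdot rho e sg)
  (u : R -> Omega -> L2 l) (hu : mild_solution P T W S F f gam g u) :
  exists c : R, forall t : R, t \in `[0, T] ->
    (\int[P]_w Hdot_sqnorm rho e sg (u t w) <= c%:E)%E.
Proof.
have distr (r a b c : R) : r * (3 * (a + b + c)) = 3 * (r * a) + (3 * (r * b) + 3 * (r * c)) by ring.
have al0 : 0 < al := lt_le_trans hbe hbeal.
have /andP[s0 s1] := hs.
have /andP[H10 H1h] := hH1; have /andP[H20 H2h] := hH2.
have /andP[sg0] := hsg; rewrite lt_min => /andP[sgA sgB].
have sg00 : 0 <= sg by lra.
have s20 : 0 < 2 * s by rewrite mulr_gt0.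
have sgs : 0 <= sg <= 2 * s by rewrite sg00/=; lra.
(* 2 s m + H1 - 1 > sg, the decay needed for the noise series to converge, is
   compatible with al m < H2 and m <= 1 *)
pose m0 := (sg + 1 - H1) / (2 * s).
have m00 : 0 <= m0 by rewrite divr_ge0 ?(ltW s20)//; lra.
have m01 : m0 < 1 by rewrite ltr_pdivrMr// mul1r; lra.
have m0H : m0 < H2 / al.
  rewrite ltr_pdivrMr//; have -> : H2 / al * (2 * s) = 2 * s * H2 / al by ring.
  by move: sgB; set y := 2 * s * H2 / al; lra.
pose m1 := Num.min 1 (H2 / al).
have m0m1 : m0 < m1 by rewrite lt_min m01.
pose m := (m0 + m1) / 2.
have mE : 2 * m = m0 + m1 by rewrite /m; field.
have mm0 : m0 < m by move: mE m0m1; lra.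
have mm1 : m < m1 by move: mE m0m1; lra.
have hm : 0 <= m <= 1.
  rewrite (le_trans m00 (ltW mm0))/=; apply: le_trans (ltW mm1) _.
  by rewrite /m1 ge_min lexx.
have amH : al * m < H2.
  rewrite mulrC -ltr_pdivlMr//; apply: lt_le_trans mm1 _.
  by rewrite /m1 ge_min lexx orbT.
pose p := 4 * s * m + 2 * H1 - 1 - 2 * sg.
have p1 : 1 < p.
  have : sg + 1 - H1 < m * (2 * s) by rewrite -ltr_pdivrMr.
  by rewrite /p (_ : 4 * s * m = 2 * (m * (2 * s))); [lra|ring].
have [CZ CZ0 hZ] := noise_coord_bound hl hT hA hbe hbeal hal hmu hla hH1 hH2 hgam hgam0 hW hth hkap hF hm amH.
have [CS CS0 hS1] := spectral_sum_le hl hA p1.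
have [BY BY0 hY] := drift_bound hT hA hbe hbeal hal s0 hmu hla hth hkap hS hcf hf_growth hf_lip sgs hu.1 (P := P).
have ca := contour_angle hth.
have [Cb Cb0 hb] := ukernel_bounded T hbe hbeal hal hmu hla hkap ca.
have gS : Hdot rho e sg g by move: hg; rewrite inE.
have r0 k : 0 < rho k := eigenvalue_gt0 hA k.
pose BG := (Cb + 1) ^+ 2 * fine (Hdot_sqnorm rho e sg g).
exists (3 * (BG + BY + CZ * CS)) => t tT.
have [Y [Z [iY iZ hae]]] := hu.2 t tT.
have [t0 tTT] : 0 <= t /\ t <= T by move: tT; rewrite in_itv/= => /andP[].
have hut := (hu.1 t tT).1.
have hYO : L2Omega P Y by case: iY.
have hZO : L2Omega P Z by case: iZ.
pose y k w := inner (Y w) (e k); pose z k w := inner (Z w) (e k).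
pose x k w := inner (u t w) (e k); pose G k := inner (S t g) (e k).
have sy k : sqi P (y k) by exact: L2Omega_sqi.
have sz k : sqi P (z k) by exact: L2Omega_sqi.
have sx k : sqi P (x k) by exact: L2Omega_sqi.
have Gle k : G k ^+ 2 <= (Cb + 1) ^+ 2 * inner g (e k) ^+ 2.
  rewrite -exprMn -[leLHS]real_normK ?num_real// -[leRHS]real_normK ?num_real//.
  apply: lerXn2r; rewrite ?nnegrE// normrM (ger0_norm (_ : 0 <= Cb + 1)) ?addr_ge0//.
  move: t0; rewrite le_eqVlt => /orP[/eqP t0|t0].
    by rewrite /G -t0 (solution_coord0 _ _ hS) ler_peMl// lerDr.
  rewrite /G (solution_coord hbe hbeal hal hmu hla hkap hth hA _ _ hS t0) normrM ler_wpM2r//.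
  by apply: le_trans (hb _ _ _ _) _; rewrite ?powR_gt0 ?t0// lerDl.
have xE k : dot P (x k) (x k) <= 3 * (G k ^+ 2 + dot P (y k) (y k) + dot P (z k) (z k)).
  apply: le_trans (dot_sum3 (G k) (sy k) (sz k)).
  rewrite le_eqVlt; apply/orP; left; apply/eqP.
  rewrite /dot /Rintegral; congr fine; apply: ae_eq_integral => //.
  - by apply/measurable_EFinP; apply: measurable_funM; case: (sx k).
  - have mg : measurable_fun setT (fun w => G k + y k w + z k w).
      apply: measurable_funD; last by case: (sz k).
      by apply: measurable_funD; [exact: measurable_cst|case: (sy k)].
    by apply/measurable_EFinP; exact: measurable_funM.
  - apply: filterS hae => w hw _.
    by rewrite /x (heq_inner (e k) hw) !innerDl.
apply: integral_Hdot_sqnorm_le => // n.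
apply: (@le_trans _ _ (\sum_(k < n) (3 * ((Cb + 1) ^+ 2 * (rho k `^ sg * inner g (e k) ^+ 2)) +
   (3 * (rho k `^ sg * dot P (y k) (y k)) + 3 * (CZ * Num.sqrt (rho k) `^ (- p)))))).
  apply: ler_sum => k _.
  apply: le_trans (ler_wpM2l (powR_ge0 _ _) (xE k)) _.
  have h1 := ler_wpM2l (powR_ge0 (rho k) sg) (Gle k).
  have h2 : rho k `^ sg * dot P (z k) (z k) <= CZ * Num.sqrt (rho k) `^ (- p).
    apply: le_trans (ler_wpM2l (powR_ge0 (rho k) sg) (hZ k t Z tT iZ)) _.
    have w0 : 0 < Num.sqrt (rho k) by rewrite sqrtr_gt0.
    rewrite mulrCA ler_wpM2l//; set w := Num.sqrt (rho k) in w0 *.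
    have -> : rho k = w `^ 2 by rewrite powR_mulrn ?(ltW w0)// sqr_sqrtr// ltW.
    rewrite -[(_ `^ _) ^+ 2]powR_mulrn ?powR_ge0// -!powRrM -!powRD_gt0//.
    by rewrite le_eqVlt; apply/orP; left; apply/eqP; congr (_ `^ _); rewrite /p; ring.
  have e1 : rho k `^ sg * (3 * (G k ^+ 2 + dot P (y k) (y k) + dot P (z k) (z k))) =
    3 * (rho k `^ sg * G k ^+ 2) + (3 * (rho k `^ sg * dot P (y k) (y k)) + 3 * (rho k `^ sg * dot P (z k) (z k))).
    exact: distr.
  rewrite e1; apply: lerD.
    by rewrite ler_wpM2l//; apply: le_trans h1 _; rewrite mulrCA.
  by rewrite lerD2l ler_wpM2l.
rewrite !big_split/= -!mulr_sumr -!mulrDr ler_wpM2l// -addrA; apply: lerD.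
  by rewrite ler_wpM2l ?sqr_ge0//; exact: Hdot_sqnorm_partial.
apply: lerD; first exact: hY iY.
by rewrite ler_wpM2l//; exact: hS1.
Qed.
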